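(* Let $z\in W^{2,1}(0,T;U_0)$, $N\in W^{1,1}(0,T;H_N)$, $f\in L^2(0,T;H)$, $u^0\in U_0$ with $u^0-z(0)\in U_0^D$, and $u^1\in H$. Let $\mathbb C\in B$ be such that for some $\gamma>0$ one has $\mathbb C(x)\xi\cdot\xi\ge\gamma|\xi|^2$ for every $\xi\in\mathbb R^{d\times d}_{sym}$ and a.e. $x\in\Omega$. Let $\delta_0>0$ and let $\mathbb F\in C^2((0,T+\delta_0);B)\cap L^1(0,T+\delta_0;B)$ satisfy $\mathbb F(t,x)\xi\cdot\xi\ge0$, $\dot{\mathbb F}(t,x)\xi\cdot\xi\le0$, $\ddot{\mathbb F}(t,x)\xi\cdot\xi\ge0$ for every $\xi\in\mathbb R^{d\times d}_{sym}$, $t\in(0,T+\delta_0)$ and a.e. $x\in\Omega$. Assume moreover that the crack does not move, i.e. $\Gamma_T=\Gamma_0$. Then there exists at most one generalized solution to the system with kernel $\mathbb F$.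
   Context: Geometry. $T>0$; $\Omega\subset\mathbb R^d$ is a bounded open set with Lipschitz boundary; $\partial_D\Omega\subset\partial\Omega$ is a (possibly empty) Borel set and $\partial_N\Omega:=\partial\Omega\setminus\partial_D\Omega$. $\Gamma\subset\overline\Omega$ is closed with $\mathcal L^d(\Gamma)=0$ and $\mathcal H^{d-1}(\Gamma\cap\partial\Omega)=0$; for every $x\in\Gamma$ there is an open neighborhood $U$ of $x$ in $\mathbb R^d$ such that $(U\cap\Omega)\setminus\Gamma$ is the union of two disjoint open sets $U^+,U^-$ with Lipschitz boundary; $\{\Gamma_t\}_{t\in[0,T]}$ is a family of closed (possibly empty) subsets of $\Gamma$ with $\Gamma_s\subset\Gamma_t$ for $0\le s\le t\le T$. Spaces. $H$ denotes $L^2(\Omega;\mathbb R^m)$ for whichever $m$ is appropriate (vector- or matrix-valued functions; $L^2(\Omega\setminus\Gamma_t)$ is identified with $L^2(\Omega)$), identified with its dual; $H_N:=L^2(\partial_N\Omega;\mathbb R^d)$. $U_t:=H^1(\Omega\setminus\Gamma_t;\mathbb R^d)$; for $u\in U_t$, $eu$ is the symmetric part of the distributional gradient of $u$ in $\Omega\setminus\Gamma_t$, and $\|u\|_{U_t}:=(\|u\|_H^2+\|eu\|_H^2)^{1/2}$ (equivalent to the $H^1$ norm by Korn's inequality). Traces on $\partial\Omega$ are well defined, and $U_t^D:=\{u\in U_t: u=0\text{ on }\partial_D\Omega\}$. $C_w^0([0,T];X)$ is the set of weakly continuous functions $[0,T]\to X$. A dot denotes the time derivative; Sobolev functions of time are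 identified with their continuous representatives. $$\mathcal C_w:=\{u\in C_w^0([0,T];U_T):\dot u\in C_w^0([0,T];H),\ u(t)\in U_t\ \forall t\in[0,T]\},$$ $$\mathcal C_c^1:=\{\varphi\in C_c^1(0,T;U_T^D):\varphi(t)\in U_t^D\ \forall t\in[0,T]\}.$$ $B:=L^\infty(\Omega;\mathcal L_{sym}(\mathbb R^{d\times d}_{sym},\mathbb R^{d\times d}_{sym}))$, where $\mathcal L_{sym}$ is the space of linear maps $\mathbb A$ on symmetric matrices with $\mathbb A\xi\cdot\eta=\mathbb A\eta\cdot\xi$; elements of $B$ act pointwise on matrix fields. Generalized solution with kernel $\mathbb F$: a function $u\in\mathcal C_w$ with $u(t)-z(t)\in U_t^D$ for every $t\in[0,T]$, $u(0)=u^0$ in $U_0$, $\dot u(0)=u^1$ in $H$, and for every $\varphi\in\mathcal C_c^1$ $$-\int_0^T(\dot u,\dot\varphi)_H\,dt+\int_0^T(\mathbb C eu,e\varphi)_H\,dt-\int_0^T\int_0^t(\mathbb F(t-r)(eu(r)-eu^0),e\dot\varphi(t))_H\,dr\,dt=\int_0^T(f,\varphi)_H\,dt+\int_0^T(N,\varphi)_{H_N}\,dt.$$ *)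

(* Defs.v *)
From HB Require Import structures.
From mathcomp Require Import all_boot all_order all_algebra.
From mathcomp Require Import all_classical all_reals all_analysis.

Set Implicit Arguments.
Unset Strict Implicit.
Unset Printing Implicit Defensive.
Import Order.TTheory GRing.Theory Num.Theory.
Import numFieldNormedType.Exports.

Local Open Scope classical_set_scope.
Local Open Scope ring_scope.

(* The library norm on matrices is the sup norm; [enorm] is the Euclidean
   (Frobenius) one.  The two induce the same topology. *)

Definition mdot {R : realType} {m n} (A B : 'M[R]_(m, n)) : R :=
  \sum_i \sum_j A i j * B i j.

Definition enorm {R : realType} {m n} (A : 'M[R]_(m, n)) : R :=
  Num.sqrt (mdot A A).

Definition ebase {R : realType} {d} (j : 'I_d) : 'rV[R]_d := delta_mx 0 j.

(* The Lebesgue measure on R^d and the Hausdorff measures come from outer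
   measures of the form
   inf { sum_k w (i_k) | A is covered by the sets c (i_k) },
   over at most countable families of admissible indices ([None] stands for
   an unused position), restricted to the Caratheodory measurable sets. *)

Section cover_outer.
Context {R : realType} {T I : Type}.
Variables (adm : set I) (c : I -> set T) (w : I -> \bar R).
Local Open Scope ereal_scope.

Definition admissible_cover (A : set T) (E : (option I)^nat) :=
  (forall k i, E k = Some i -> adm i) /\
  A `<=` \bigcup_k oapp c set0 (E k).

Definition cover_outer (A : set T) : \bar R :=
  ereal_inf [set \sum_(k <oo) oapp w 0 (E k) | E in admissible_cover A].

Hypothesis w0 : forall i, adm i -> 0 <= w i.

Let oapp_w0 A E k : admissible_cover A E -> 0 <= oapp w 0 (E k).
Proof. by move=> [aE _]; case Ek : (E k) => [i|]//=; exact/w0/aE/Ek. Qed.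

Lemma cover_outer_ge0 A : 0 <= cover_outer A.
Proof.
apply: le_ereal_inf_tmp => _ [E AE <-].
by apply: nneseries_ge0 => k _ _; exact: oapp_w0 AE.
Qed.

Lemma cover_outer0 : cover_outer set0 = 0.
Proof.
apply/eqP; rewrite eq_le cover_outer_ge0 andbT.
apply: ereal_inf_lbound; exists (fun=> None); first by split.
by rewrite eseries0.
Qed.

Lemma le_cover_outer : {homo cover_outer : A B / A `<=` B >-> A <= B}.
Proof.
move=> A B AB; apply: ereal_inf_le_tmp => _ [E [aE BE] <-].
by exists E => //; split => //; exact: subset_trans BE.
Qed.

Lemma cover_outer_sigma_subadditive : sigma_subadditive cover_outer.
Proof.
move=> A; have [[i ioo]|] := pselect (exists i, cover_outer (A i) = +oo).
  rewrite (eseries_pinfty _ _ ioo) ?leey// => n _.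
  by rewrite -ltNye (lt_le_trans _ (cover_outer_ge0 _)).
rewrite -forallNE => Aoo.
suff add2e (e : {posnum R}) :
    cover_outer (\bigcup_n A n) <= \sum_(i <oo) cover_outer (A i) + e%:num%:E.
  by apply/lee_addgt0Pr => _/posnumP[].
rewrite (le_trans _ (epsilon_trick _ _ _))//; last first.
  by move=> n; exact: cover_outer_ge0.
pose P n (B : (option I)^nat) := admissible_cover (A n) B /\
  \sum_(k <oo) oapp w 0 (B k) <=
    cover_outer (A n) + (e%:num / (2 ^ n.+1)%:R)%:E.
have [G PG] : {G : ((option I)^nat)^nat & forall n, P n (G n)}.
  apply: (@choice _ _ P) => n; rewrite /P /cover_outer.
  set S := (X in ereal_inf X); move infS : (ereal_inf S) => iS.
  case: iS infS => [r Sr|Soo|Soo].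
  - have en1 : (0 < e%:num / (2 ^ n.+1)%:R)%R by [].
    have /(lb_ereal_inf_adherent en1) : ereal_inf S \is a fin_num by rewrite Sr.
    move=> [x [B AB xS]] xlt.
    by exists B; split => //; rewrite xS -Sr; exact/ltW.
  - by have := Aoo n; rewrite /cover_outer Soo.
  - by have := cover_outer_ge0 (A n); rewrite /cover_outer Soo.
pose W (x : nat * nat) := oapp w 0 (G x.1 x.2).
have W_ge0 x : 0 <= W x by exact: oapp_w0 (PG x.1).1.
apply: (@le_trans _ _ (\esum_(i in setT) W i)).
  apply: ereal_inf_lbound => /=.
  have /card_esym/ppcard_eqP[f] := card_nat2.
  exists (fun k => G (f k).1 (f k).2).
    split => [k i|]; first exact: (PG (f k).1).1.1.
    move=> t [n _] /(PG n).1.2[k _ Gnk]; exists (f^-1%FUN (n, k)) => //=.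
    by rewrite invK ?inE.
  rewrite -(esum_pred_image W _ xpredT) ?[fun=> _]set_true//.
  by rewrite image_eq.
rewrite (_ : esum _ _ = \sum_(i <oo) \sum_(j <oo) W (i, j)); last first.
  pose J : nat -> set (nat * nat) := fun i => [set (i, j) | j in setT].
  rewrite (_ : setT = \bigcup_k J k); last first.
    by rewrite predeqE => -[a b]; split => // _; exists a => //; exists b.
  rewrite esum_bigcupT /=; last 2 first.
    - apply/trivIsetP => i j _ _ ij.
      rewrite predeqE => -[n m] /=; split => //= -[] [_] _ [<-{n} _].
      by move=> [m' _] [] /esym/eqP; rewrite (negbTE ij).
    - by move=> /= nm; exact: W_ge0.
  rewrite -(image_id [set: nat]) -fun_true esum_pred_image//; last first.
    by move=> n _; exact: esum_ge0.
  apply: eq_eseriesr => /= j _.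
  rewrite -(esum_pred_image W (pair j) predT)//=; last first.
    by move=> ? ? _ _; exact: (@can_inj _ _ _ snd).
  by congr esum; rewrite predeqE => -[a b]; split; move=> [i _ <-]; exists i.
apply: lee_lim.
- apply: is_cvg_nneseries => n *.
  by apply: nneseries_ge0 => m *; exact: (W_ge0 (n, m)).
- by apply: is_cvg_nneseries => n *; apply: adde_ge0 => //; exact: cover_outer_ge0.
- by near=> n; apply: lee_sum => i _; exact: (PG i).2.
Unshelve. all: by end_near. Qed.

End cover_outer.

Section lebesgue.
Context {R : realType} {d : nat}.
Implicit Types ab : 'rV[R]_d * 'rV[R]_d.

Definition proper_box : set ('rV[R]_d * 'rV[R]_d) :=
  fun ab => forall i, ab.1 0 i <= ab.2 0 i.
Definition obox ab : set 'rV[R]_d :=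
  [set x | forall i, ab.1 0 i < x 0 i < ab.2 0 i].
Definition box_volume ab : \bar R := (\prod_i (ab.2 0 i - ab.1 0 i))%:E.

Definition lebesgue_outer : set 'rV[R]_d -> \bar R :=
  cover_outer proper_box obox box_volume.

Let box_volume_ge0 ab : proper_box ab -> (0 <= box_volume ab)%E.
Proof.
by move=> pab; rewrite lee_fin; apply: prodr_ge0 => i _; rewrite subr_ge0.
Qed.

HB.instance Definition _ := isOuterMeasure.Build R 'rV[R]_d lebesgue_outer
  (cover_outer0 obox box_volume_ge0) (cover_outer_ge0 obox box_volume_ge0)
  (@le_cover_outer _ _ _ proper_box obox box_volume)
  (cover_outer_sigma_subadditive obox box_volume_ge0).
End lebesgue.

Section hausdorff.
Context {R : realType} {d : nat} (s : nat).
Implicit Types (A : set 'rV[R]_d) (delta : R).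

(* volume of the unit ball of R^n, by the recursion in steps of two *)
Fixpoint ball_volume (n : nat) : R :=
  match n with
  | 0%N => 1
  | 1%N => 2
  | n'.+2 => 2 * pi / n%:R * ball_volume n'
  end.

Definition diam_le delta : set (set 'rV[R]_d) :=
  [set A | forall x y, A x -> A y -> enorm (x - y) <= delta].

(* only used on sets of finite diameter; for s = 0 the weight is 1 *)
Definition hausdorff_weight A : \bar R :=
  (ball_volume s *
   (sup [set enorm (xy.1 - xy.2) | xy in A `*` A] / 2) ^+ s)%:E.

Definition hausdorff_content delta : set 'rV[R]_d -> \bar R :=
  cover_outer (diam_le delta) id hausdorff_weight.

Definition hausdorff_outer A : \bar R :=
  ereal_sup [set hausdorff_content delta A | delta in [set r : R | 0 < r]].

Let ball_volume_ge0 n : 0 <= ball_volume n.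
Proof.
suff : 0 <= ball_volume n /\ 0 <= ball_volume n.+1 by case.
elim: n => [|n [IH1 IH2]]; first by rewrite /= ler01 ler0n.
split=> //=; rewrite mulr_ge0//= divr_ge0//= mulr_ge0//.
exact: pi_ge0.
Qed.

Let hausdorff_weight_ge0 delta A :
  diam_le delta A -> (0 <= hausdorff_weight A)%E.
Proof.
move=> dA; rewrite lee_fin mulr_ge0// exprn_ge0// divr_ge0//.
have [[x Ax]|A0] := pselect (A !=set0).
  have e0 : 0 <= enorm (x - x) by exact: sqrtr_ge0.
  apply: (le_trans e0); apply: ub_le_sup; last by exists (x, x).
  by exists delta => _ [[y z] [/= Ay Az] <-]; exact: dA.
rewrite (_ : [set _ | _ in _] = set0) ?sup0//.
by rewrite -subset0 => _ [[y z] [/= Ay _] _]; apply: A0; exists y.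
Qed.

Let hausdorff_outer0 : hausdorff_outer set0 = 0%E.
Proof.
apply/eqP; rewrite eq_le; apply/andP; split.
  apply: ge_ereal_sup => _ [delta _ <-].
  by rewrite /hausdorff_content (cover_outer0 id (@hausdorff_weight_ge0 delta)).
apply: ereal_sup_ubound; exists 1 => //=.
exact: (cover_outer0 id (@hausdorff_weight_ge0 1)).
Qed.

Let hausdorff_outer_ge0 A : (0 <= hausdorff_outer A)%E.
Proof.
apply: (@le_trans _ _ (hausdorff_content 1 A)).
  exact: (cover_outer_ge0 id (@hausdorff_weight_ge0 1)).
by apply: ereal_sup_ubound; exists 1 => //=.
Qed.

Let le_hausdorff_outer :
  {homo hausdorff_outer : A B / A `<=` B >-> (A <= B)%E}.
Proof.
move=> A B AB; apply: ge_ereal_sup => _ [delta delta0 <-].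
apply: (@le_trans _ _ (hausdorff_content delta B)).
  exact: le_cover_outer.
by apply: ereal_sup_ubound; exists delta.
Qed.

Let hausdorff_outer_sigma_subadditive : sigma_subadditive hausdorff_outer.
Proof.
move=> A; apply: ge_ereal_sup => _ [delta delta0 <-].
apply: (le_trans (cover_outer_sigma_subadditive id (@hausdorff_weight_ge0 delta) A)).
apply: lee_nneseries => k _.
  by move=> _; exact: (cover_outer_ge0 id (@hausdorff_weight_ge0 delta)).
by apply: ereal_sup_ubound; exists delta.
Qed.

HB.instance Definition _ := isOuterMeasure.Build R 'rV[R]_d hausdorff_outer
  hausdorff_outer0 hausdorff_outer_ge0 le_hausdorff_outer
  hausdorff_outer_sigma_subadditive.
End hausdorff.

(* R^d with the Lebesgue, resp. H^s, measurable sets *)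
Definition lebesgue_om (R : realType) (d : nat) :
  {outer_measure set 'rV[R]_d -> \bar R} := @lebesgue_outer R d.
Definition hausdorff_om (R : realType) (d s : nat) :
  {outer_measure set 'rV[R]_d -> \bar R} := @hausdorff_outer R d s.

Notation lebesgue_space R d := (caratheodory_type (lebesgue_om R d)).
Notation hausdorff_space R d s := (caratheodory_type (hausdorff_om R d s)).

Definition leb (R : realType) (d : nat) :
  {measure set (lebesgue_space R d) -> \bar R} := lebesgue_om R d.
Definition hausd (R : realType) (d s : nat) :
  {measure set (hausdorff_space R d s) -> \bar R} := hausdorff_om R d s.

(* L^2, L^oo and Sobolev spaces are handled through representatives:
   [sn_mem] is the set of admissible representatives inside an ambient vector
   space, and two of them denote the same element when the seminorm of their
   difference vanishes. *)

Record snspace (R : realType) := SNSpace {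
  sn_car :> lmodType R;
  sn_mem : set sn_car;
  sn_norm : sn_car -> R }.

Section time_functions.
Context {R : realType} (X : snspace R).
Implicit Types (D : set R) (f g : R -> X) (l : X -> R).
Local Notation mu := (@lebesgue_measure R).

Definition dual_element l :=
  (forall a x y, sn_mem x -> sn_mem y -> l (a *: x + y) = a * l x + l y) /\
  exists M, forall x : X, sn_mem x -> `|l x| <= M * sn_norm x.

Definition weakly_continuous D f :=
  (forall t, D t -> sn_mem (f t)) /\
  forall l, dual_element l -> {within D, continuous (l \o f)}.

Definition strongly_continuous D f :=
  forall t, D t -> sn_mem (f t) /\
    (fun s => sn_norm (f s - f t)) @ within D (nbhs t) --> (0 : R).

(* D is meant to be open *)
Definition strong_derivative D f g :=
  forall t, D t -> [/\ sn_mem (f t), sn_mem (g t) &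
    (fun h => sn_norm (h^-1 *: (f (t + h) - f t) - g t)) @ 0^' --> (0 : R)].

Definition simple_function f :=
  [/\ finite_set (range f), (forall t, sn_mem (f t)) &
      forall v, measurable (f @^-1` [set v])].

Definition simple_integral D f : X :=
  \sum_(v \in range f) fine (mu (D `&` f @^-1` [set v])) *: v.

Definition strongly_measurable D f :=
  {ae mu, forall t, D t -> sn_mem (f t)} /\
  exists s : (R -> X)^nat, (forall n, simple_function (s n)) /\
    {ae mu, forall t, D t ->
      (fun n => sn_norm (f t - s n t)) @ \oo --> (0 : R)}.

(* D is meant to have finite measure *)
Definition is_bochner_integral D f (v : X) :=
  [/\ sn_mem v, strongly_measurable D f &
      exists s : (R -> X)^nat, [/\ (forall n, simple_function (s n)),
        (fun n => (\int[mu]_(t in D) (sn_norm (f t - s n t))%:E)%E) @ \oo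
          --> (0 : \bar R) &
        (fun n => sn_norm (simple_integral D (s n) - v)) @ \oo --> (0 : R)]].

Definition bochner_Lp (p : nat) D f :=
  strongly_measurable D f /\
  (\int[mu]_(t in D) (sn_norm (f t) ^+ p)%:E < +oo)%E.

Definition test_function1 (a b : R) (eta : R -> R) :=
  (forall n t, derivable (derive1n n eta) t 1) /\
  exists c e, [/\ a < c, e < b & forall t, t \notin `[c, e] -> eta t = 0].

(* distributional: int (eta' f + eta g) = 0 as a Bochner integral *)
Definition weak_derivative (a b : R) f g :=
  forall eta, test_function1 a b eta ->
    is_bochner_integral `]a, b[%classic
      (fun t => derive1 eta t *: f t + eta t *: g t) 0.

(* W^{1,1} and W^{2,1}; f, and its derivative in the second case, are the
   continuous representatives *)
Definition sobolev11 (a b : R) f :=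
  strongly_continuous `[a, b]%classic f /\
  exists g, bochner_Lp 1 `]a, b[%classic g /\ weak_derivative a b f g.

Definition sobolev21 (a b : R) f :=
  strongly_continuous `[a, b]%classic f /\
  exists g, sobolev11 a b g /\ weak_derivative a b f g.

Definition C2_with (a b : R) f f1 f2 :=
  [/\ strong_derivative `]a, b[%classic f f1,
      strong_derivative `]a, b[%classic f1 f2 &
      strongly_continuous `]a, b[%classic f2].

Definition C1c_with (a b : R) f f1 :=
  [/\ strong_derivative `]a, b[%classic f f1,
      strongly_continuous `]a, b[%classic f1 &
      exists c e, [/\ a < c, e < b & forall t, t \in `[a, b] ->
        t \notin `[c, e] -> sn_norm (f t) = 0]].

End time_functions.

Definition L2 {disp} {T : measurableType disp} {R : realType}
    (mu : {measure set T -> \bar R}) (D : set T) (m n : nat) : snspace R :=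
  @SNSpace R (T -> 'M[R]_(m, n))
    [set f : T -> 'M[R]_(m, n) |
             (forall i j, measurable_fun D (fun x => f x i j)) /\
             (\int[mu]_(x in D) (mdot (f x) (f x))%:E < +oo)%E]
    (fun f => Num.sqrt (\int[mu]_(x in D) mdot (f x) (f x))).

Definition L2dot {disp} {T : measurableType disp} {R : realType}
    (mu : {measure set T -> \bar R}) (D : set T) {m n : nat}
    (f g : T -> 'M[R]_(m, n)) : R :=
  \int[mu]_(x in D) mdot (f x) (g x).

Section spaces.
Context {R : realType} {d : nat}.
Local Notation V := 'rV[R]_d.
Implicit Types (O Omega K S : set V) (u : V -> V).

Definition symmx (xi : 'M[R]_d) := xi^T = xi.

Definition bd (O : set V) : set V := closure O `\` interior O.

(* near each boundary point, O is the strict epigraph, in the direction nu,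
   of a Lipschitz function of the component orthogonal to nu *)
Definition lipschitz_boundary O :=
  forall x, bd O x -> exists (nu : V) (r L : R) (g : V -> R),
    [/\ enorm nu = 1, 0 < r,
        (forall y y', `|g y - g y'| <= L * enorm (y - y')) &
        forall y, enorm (y - x) < r ->
          O y <-> g (y - mdot y nu *: nu) < mdot y nu].

Definition borel_set (A : set V) := <<s [set O : set V | open O] >> A.

Fixpoint iter_partial (s : seq 'I_d) (phi : V -> R) : V -> R :=
  match s with
  | [::] => phi
  | j :: s' => fun x => 'D_(ebase j) (iter_partial s' phi) x
  end.

Definition smooth (phi : V -> R) :=
  forall s, continuous (iter_partial s phi) /\
    forall x j, derivable (iter_partial s phi) x (ebase j).

Definition test_function O (phi : V -> R) :=
  smooth phi /\ exists K, [/\ compact K, K `<=` O &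
                              forall x, ~ K x -> phi x = 0].

(* G = Du in the sense of distributions on O, with G in L^2 *)
Definition is_weak_gradient O u (G : V -> 'M[R]_d) :=
  sn_mem (s := L2 (leb R d) O d d) G /\
  forall phi, test_function O phi -> forall i j,
    (\int[leb R d]_(x in O) (u x 0 i * 'D_(ebase j) phi x)) =
    - (\int[leb R d]_(x in O) (G x i j * phi x)).

(* some weak gradient, unique almost everywhere on O *)
Definition weak_gradient O u : V -> 'M[R]_d :=
  xget (fun=> 0) [set G | is_weak_gradient O u G].

Definition strain O u : V -> 'M[R]_d :=
  fun x => 2^-1 *: (weak_gradient O u x + (weak_gradient O u x)^T).

Definition Hspace Omega (m n : nat) : snspace R := L2 (leb R d) Omega m n.

(* H^1(Omega \ K; R^d), with norm (|u|_H^2 + |eu|_H^2)^(1/2) *)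
Definition Uspace Omega K : snspace R :=
  @SNSpace R (V -> V)
    [set u : V -> V | sn_mem (s := Hspace Omega 1 d) u /\
             exists G, is_weak_gradient (Omega `\` K) u G]
    (fun u => Num.sqrt
       (sn_norm (s := Hspace Omega 1 d) u ^+ 2 +
        sn_norm (s := Hspace Omega d d) (strain (Omega `\` K) u) ^+ 2)).

Definition jacobian_matrix (w : V -> V) : V -> 'M[R]_d :=
  fun x => \matrix_(i, j) 'D_(ebase j) (fun y => w y 0 i) x.

(* g is the trace on the boundary of Omega of u in H^1(Omega \ K; R^d):
   locally away from K, it is the L^2 limit of the restrictions to the
   boundary of smooth functions converging to u in H^1.  This determines g
   up to H^{d-1}-null sets as soon as K meets the boundary of Omega in an
   H^{d-1}-null set. *)
Definition is_trace Omega K u (g : V -> V) :=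
  (forall i, measurable_fun (bd Omega : set (hausdorff_space R d d.-1))
               (fun x : hausdorff_space R d d.-1 => g x 0 i)) /\
  forall x, bd Omega x -> ~ K x ->
  exists (W : set V) (w : (V -> V)^nat),
    [/\ [/\ open W, W x & W `&` K = set0],
        (forall n i, smooth (fun y => w n y 0 i)),
        (fun n => (\int[leb R d]_(y in W `&` Omega)
           (enorm (w n y - u y) ^+ 2)%:E)%E) @ \oo --> (0 : \bar R),
        (fun n => (\int[leb R d]_(y in W `&` Omega)
           (enorm (jacobian_matrix (w n) y -
                   weak_gradient (Omega `\` K) u y) ^+ 2)%:E)%E) @ \oo
          --> (0 : \bar R) &
        (fun n => (\int[hausd R d d.-1]_(y in W `&` bd Omega)
           (enorm (w n y - g y) ^+ 2)%:E)%E) @ \oo --> (0 : \bar R)].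

Definition trace Omega K u : V -> V :=
  xget (fun=> 0) [set g | is_trace Omega K u g].

Definition zero_trace Omega K S u :=
  exists2 g, is_trace Omega K u g &
    {ae hausd R d d.-1, forall x, S x -> g x = 0}.

Definition UDspace Omega K S : snspace R :=
  @SNSpace R (V -> V)
    [set u : V -> V | sn_mem (s := Uspace Omega K) u /\ zero_trace Omega K S u]
    (sn_norm (s := Uspace Omega K)).

(* L^oo(Omega; L_sym(R^{d x d}_sym, R^{d x d}_sym)), with the essential
   supremum of the operator norm; the values on non-symmetric matrices are
   irrelevant *)
Definition Linfty_bound Omega (A : V -> 'M[R]_d -> 'M[R]_d) (M : R) :=
  {ae leb R d, forall x, Omega x ->
     forall xi, symmx xi -> enorm (A x xi) <= M * enorm xi}.

Definition Bspace Omega : snspace R :=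
  @SNSpace R (V -> 'M[R]_d -> 'M[R]_d)
    [set A : V -> 'M[R]_d -> 'M[R]_d |
         [/\ {ae leb R d, forall x, Omega x ->
                   [/\ (forall xi, symmx xi -> symmx (A x xi)),
                       (forall a xi eta, symmx xi -> symmx eta ->
                          A x (a *: xi + eta) = a *: A x xi + A x eta) &
                       (forall xi eta, symmx xi -> symmx eta ->
                          mdot (A x xi) eta = mdot (A x eta) xi)]},
                 (forall xi, symmx xi -> forall i j,
                    measurable_fun (Omega : set (lebesgue_space R d))
                      (fun x : lebesgue_space R d => A x xi i j)) &
                 exists M, Linfty_bound Omega A M]]
    (fun A => inf [set M | 0 <= M /\ Linfty_bound Omega A M]).

Definition apply_field (A : V -> 'M[R]_d -> 'M[R]_d) (E : V -> 'M[R]_d) :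
  V -> 'M[R]_d := fun x => A x (E x).

Record crack_geometry (T : R) Omega S (Gamma : set V) (Gammat : R -> set V) :
    Prop := CrackGeometry {
  T_gt0 : 0 < T;
  Omega_bounded : bounded_set Omega;
  Omega_open : open Omega;
  Omega_lipschitz : lipschitz_boundary Omega;
  dirichlet_borel : borel_set S;
  dirichlet_sub : S `<=` bd Omega;
  Gamma_sub : Gamma `<=` closure Omega;
  Gamma_closed : closed Gamma;
  Gamma_null : leb R d Gamma = 0%E;
  Gamma_bd_null : hausd R d d.-1 (Gamma `&` bd Omega) = 0%E;
  Gamma_two_sided : forall x, Gamma x -> exists U Up Um : set V,
    [/\ open U /\ U x,
        [/\ open Up, open Um & Up `&` Um = set0],
        lipschitz_boundary Up /\ lipschitz_boundary Um &
        (U `&` Omega) `\` Gamma = Up `|` Um];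
  Gammat_closed : forall t, t \in `[0, T] -> closed (Gammat t);
  Gammat_sub : forall t, t \in `[0, T] -> Gammat t `<=` Gamma;
  Gammat_incr : forall s t, 0 <= s -> s <= t -> t <= T ->
    Gammat s `<=` Gammat t }.

Section generalized_solution.
Variables (T : R) (Omega S : set V) (Gammat : R -> set V).
Local Notation mu := (@lebesgue_measure R).
Local Notation U t := (Uspace Omega (Gammat t)).
Local Notation UD t := (UDspace Omega (Gammat t) S).
Local Notation e t := (strain (Omega `\` Gammat t)).
Local Notation "<< f , g >>" := (L2dot (leb R d) Omega f g).

Definition neumann : set V := bd Omega `\` S.
Definition HNspace : snspace R := L2 (hausd R d d.-1) neumann 1 d.

(* v is the weakly continuous representative of the time derivative of u *)
Definition Cw_with (u v : R -> V -> V) :=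
  [/\ weakly_continuous (X := U T) `[0, T]%classic u,
      weakly_continuous (X := Hspace Omega 1 d) `[0, T]%classic v,
      weak_derivative (X := Hspace Omega 1 d) 0 T u v &
      forall t, t \in `[0, T] -> sn_mem (s := U t) (u t)].

Definition admissible_test (phi phi1 : R -> V -> V) :=
  C1c_with (X := UD T) 0 T phi phi1 /\
  forall t, t \in `[0, T] -> sn_mem (s := UD t) (phi t).

Definition generalized_solution
    (z : R -> V -> V) (N f : R -> V -> V) (u0 u1 : V -> V)
    (C : V -> 'M[R]_d -> 'M[R]_d) (F : R -> V -> 'M[R]_d -> 'M[R]_d)
    (u : R -> V -> V) :=
  exists v : R -> V -> V,
  [/\ Cw_with u v,
      (forall t, t \in `[0, T] -> sn_mem (s := UD t) (u t - z t)),
      sn_norm (s := U 0) (u 0 - u0) = 0 /\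
      sn_norm (s := Hspace Omega 1 d) (v 0 - u1) = 0 &
      forall phi phi1, admissible_test phi phi1 ->
      - (\int[mu]_(t in `[0, T]) << v t, phi1 t >>)
      + (\int[mu]_(t in `[0, T])
           << apply_field C (e T (u t)), e T (phi t) >>)
      - (\int[mu]_(t in `[0, T]) (\int[mu]_(r in `[0, t])
           << apply_field (F (t - r)) (e T (u r) - e 0 u0), e T (phi1 t) >>))
      = (\int[mu]_(t in `[0, T]) << f t, phi t >>)
      + (\int[mu]_(t in `[0, T])
           L2dot (hausd R d d.-1) neumann (N t)
             (trace Omega (Gammat T) (phi t)))].

End generalized_solution.
End spaces.

(* Main.v *)
Require Import Defs.
From mathcomp Require Import all_boot all_order all_algebra.
From mathcomp Require Import all_classical all_reals all_analysis.
From mathcomp Require Import measurable_realfun zify ring lra.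

Set Implicit Arguments.
Unset Strict Implicit.
Unset Printing Implicit Defensive.
Import Order.TTheory GRing.Theory Num.Theory.
Import numFieldNormedType.Exports.

Local Open Scope classical_set_scope.
Local Open Scope ring_scope.

(** Let [delta] be the difference of two solutions, [dv] its velocity and [E] its
    strain.  As the crack does not grow, the space of admissible displacements
    is the same at all times and contains [delta t].  The loads cancel in the
    difference of the two equations.  Tested against [eta(t) * psi(x)], with
    [psi] an admissible displacement that vanishes on the Dirichlet part, it
    says that a continuous function of time is, in the sense of distributions,
    a primitive of another one; the du Bois-Reymond lemma and the vanishing
    initial data then give, at every time,

      [(dv t, psi) + int_0^t (F (t - r) (E r) + C (E r), e psi) dr = 0].

    Since [(delta t, psi)] is the primitive of [(dv, psi)],

      [|delta s|^2 = int_0^s int_0^s (dv r, dv q) dr dq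
                   = 2 int_0^s (dv t, delta t) dt
                   = - 2 int_0^s int_0^t (F (t - r) (E r) + C (E r), E t) dr dt],

    the second equality because the integrand is symmetric
    ([square_triangle]) and the third one by the choice [psi = delta t].  It
    remains to see that the last double integral is nonnegative
    ([relaxation_form_ge0]): then [delta] vanishes.

    This positivity holds because [F + C] is nonnegative, nonincreasing and
    convex in time.  A sequence of quadratic forms with these properties is a
    combination, with positive coefficients, of triangle kernels
    [max (m - |i - j|, 0)], and a triangle kernel is a sum of the rank one
    kernels of the windows of length [m]; hence
    [sum_(i, j) A_|i - j| (x_i, x_j)] is nonnegative ([pairing_convex_ge0]).  The
    strains are only weakly continuous in time, so that the kernel
    [(F (t - r) (E r), E t)] is continuous in each variable separately and not
    jointly; Riemann sums still converge in one variable at a time, and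
    [double_integral_ge0] deduces the positivity of the integral by
    contradiction, from Riemann sums that are concatenated one after the
    other.  The singularity of [F] at time zero is removed by a shift of the
    kernel and restored by dominated convergence ([convolution_form_ge0]).

    Three facts of functional analysis are needed on the way.  The set of
    representatives of displacements is stable under linear combinations and
    the strain is linear up to null sets, which rests on the uniqueness of
    weak gradients ([weak_gradient_unique]) and on the measurability of open
    sets for the Lebesgue and the Hausdorff measures ([separated_caratheodory]).
    Weakly continuous functions on a compact interval are bounded
    ([weakly_continuous_bounded]).  Finally, bounded functionals commute with
    the Bochner integral ([dual_bochner_integral]), so that the weak derivative
    in time can be tested against a fixed field. *)

(** * Open sets are measurable for the Lebesgue and the Hausdorff measures *)

Section separated_additivity.
Context {R : realType} {T : Type} (mu : {outer_measure set T -> \bar R}).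
Local Open Scope ereal_scope.

(** The additivity of metric outer measures, restricted to sets that lie on the
    two sides of a slab for the function [rho], in practice a coordinate. *)
Definition separated_additive (rho : T -> R) := forall a b A B, (a < b)%R ->
  (forall x, A x -> (rho x <= a)%R) -> (forall x, B x -> (b <= rho x)%R) ->
  mu A + mu B <= mu (A `|` B).

(** Caratheodory's criterion for metric outer measures, in one direction of
    space.  The masses of the layers [s k <= rho <= s k.+1] are controlled by
    the increments over two steps of the bounded sequence
    [mu (X `&` [set x | rho x <= s k])], so that they are summable and the
    part of [X] close to the level [c] has small mass. *)
Lemma separated_caratheodory rho c : separated_additive rho ->
  mu.-caratheodory [set x | (rho x < c)%R].
Proof.
move=> sep; apply: le_caratheodory_measurable => X.
have [muX|] := ltP (mu X) +oo; last by rewrite leye_eq => /eqP ->; exact: leey.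
have fin A : A `<=` X -> mu A \is a fin_num.
  move=> AX; rewrite ge0_fin_numE ?outer_measure_ge0//.
  exact: le_lt_trans (le_outer_measure _ _ _ AX) muX.
pose s k : R := (c - k.+1%:R^-1)%R.
have s_lt k : (s k < s k.+1)%R.
  by rewrite /s ltrD2l ltrN2 ltf_pV2 ?posrE ?ltr0n// ltr_nat.
have s_nd : {homo s : m n / (m <= n)%N >-> (m <= n)%R}.
  by apply: homo_leq => [//||k]; [exact: le_trans|exact: ltW].
pose Y k := X `&` [set x | (rho x <= s k)%R].
pose L k := X `&` [set x | (s k <= rho x <= s k.+1)%R].
pose g k := fine (mu (Y k)); pose l k := fine (mu (L k)).
have gE k : mu (Y k) = (g k)%:E by rewrite fineK// fin//; exact: subIsetl.
have lE k : mu (L k) = (l k)%:E by rewrite fineK// fin//; exact: subIsetl.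
have gS k : (g k <= g k.+1)%R.
  rewrite -lee_fin -!gE; apply: le_outer_measure => x [Xx /= h]; split=> //=.
  exact: le_trans h (ltW (s_lt _)).
have g_nd : {homo g : m n / (m <= n)%N >-> (m <= n)%R}.
  by apply: homo_leq => [//||//]; exact: le_trans.
have lg k : (l k.+1 + g k <= g k.+2)%R.
  rewrite -lee_fin EFinD -lE -!gE addeC.
  apply: (le_trans (sep _ _ _ _ (s_lt k) _ _)).
  - by move=> x [].
  - by move=> x [_ /andP[]].
  - apply: le_outer_measure => x [[Xx /= h]|[Xx /= /andP[_ h]]]; split=> //=.
    apply: le_trans h _; apply: ltW; exact: lt_trans (s_lt _) (s_lt _).
have g_le k : (g k <= fine (mu X))%R.
  rewrite -lee_fin -gE fineK ?fin//; apply: le_outer_measure; exact: subIsetl.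
apply/lee_addgt0Pr => _/posnumP[e].
(* Beyond index [n] the increments of [g] are negligible. *)
have [n gn] : exists n, forall m, (n <= m)%N -> (g m - g n <= e%:num / 2)%R.
  pose M := sup (range g).
  have supg : has_sup (range g).
    split; first by exists (g 0%N); exists 0%N.
    by exists (fine (mu X)) => _ [k _ <-].
  have e2 : (0 < e%:num / 2)%R by [].
  have [_ [n _ <-] hn] := sup_adherent e2 supg.
  exists n => m _; rewrite lerBlDr.
  have : (g m <= M)%R by apply: ub_le_sup; [exact: supg.2|exists m].
  by move=> /le_trans; apply; rewrite /M; lra.
pose F k := if k is k'.+1 then L (n.+1 + k')%N else Y n.+1.
have XF : X `&` [set x | (rho x < c)%R] `<=` \bigcup_k F k.
  move=> x [Xx /= xc].
  have [N hN] : exists N, (rho x <= s N)%R.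
    have [N] := ltr_add_invr xc; rewrite -ltrBrDr => h.
    by exists N; apply: ltW.
  have [xn|xn] := leP (rho x) (s n.+1); first by exists 0%N.
  have exN : exists N, (rho x <= s N)%R by exists N.
  have := ex_minnP exN; case=> [[|m]] hm mmin.
    suff : (s 0%N <= s n.+1)%R by move=> /(le_trans hm); rewrite leNgt xn.
    exact: s_nd.
  have nm : (n.+1 <= m)%N.
    rewrite leqNgt; apply/negP => mn.
    have : (s m.+1 <= s n.+1)%R by exact: s_nd.
    by move=> /(le_trans hm); rewrite leNgt xn.
  exists (m - n.+1).+1 => //=; rewrite subnKC//; split=> //=; rewrite hm andbT leNgt.
  by apply/negP => /ltW /mmin; rewrite ltnn.
(* Each layer is bounded by an increment of [g] over two steps. *)
have sumL N : (\sum_(k < N) l (n.+1 + k)%N <= g (n.+1 + N)%N + g (n + N)%N - g n.+1 - g n)%R.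
  elim: N => [|N IH]; first by rewrite big_ord0 !addn0; lra.
  rewrite big_ord_recr/=; have := lg (n + N)%N.
  by rewrite !addnS !addSn in IH *; lra.
have sumF : \sum_(k <oo) mu (F k) <= (g n.+1 + e%:num)%:E.
  apply: lime_le; first by apply: is_cvg_nneseries => *; exact: outer_measure_ge0.
  apply: nearW => -[|N].
    rewrite big_mkord big_ord0 lee_fin addr_ge0//.
    by rewrite -lee_fin -gE outer_measure_ge0.
  rewrite big_mkord big_ord_recl/= gE EFinD; apply: leeD => //.
  rewrite (eq_bigr (fun k : 'I_N => (l (n.+1 + k)%N)%:E)); last first.
    by move=> k _; rewrite lE.
  rewrite sumEFin lee_fin (le_trans (sumL N))//.
  have h1 := gn (n.+1 + N)%N; have h2 := gn (n + N)%N.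
  have h3 := gS n.
  have /h1 {}h1 : (n <= n.+1 + N)%N by rewrite addSnnS leq_addr.
  have /h2 {}h2 : (n <= n + N)%N by rewrite leq_addr.
  lra.
have up : mu (X `&` [set x | (rho x < c)%R]) <= (g n.+1 + e%:num)%:E.
  apply: le_trans (le_outer_measure _ _ _ XF) _.
  exact: le_trans (outer_measure_sigma_subadditive _ _) sumF.
have lowX : mu (Y n.+1) + mu (X `&` ~` [set x | (rho x < c)%R]) <= mu X.
  apply: (@le_trans _ _ (mu (Y n.+1 `|` (X `&` ~` [set x | (rho x < c)%R])))).
    apply: (sep (s n.+1) c); first by rewrite /s ltrBlDr ltrDl invr_gt0 ltr0n.
      by move=> x [].
    by move=> x [_ /= /negP]; rewrite -leNgt.
  by apply: le_outer_measure => x [[]|[]].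
rewrite (le_trans (leeD2r _ up))// EFinD -gE -addeA [_%:E + _]addeC addeA.
exact: leeD2r.
Qed.

End separated_additivity.

Section cover_splitting.
Context {R : realType} {T I : Type}.
Variables (adm : set I) (c : I -> set T) (w : I -> \bar R).
Local Open Scope ereal_scope.
Hypothesis w0 : forall i, adm i -> 0 <= w i.

(** If every admissible set can be cut into two pieces of no larger total
    weight, each cover of the union splits into covers of the two sets. *)
Lemma cover_outer_split (A B : set T) :
  (forall i, adm i -> exists i1 i2 : option I,
    [/\ forall j, i1 = Some j -> adm j, forall j, i2 = Some j -> adm j,
        c i `&` A `<=` oapp c set0 i1, c i `&` B `<=` oapp c set0 i2 &
        oapp w 0 i1 + oapp w 0 i2 <= w i]) ->
  cover_outer adm c w A + cover_outer adm c w B <= cover_outer adm c w (A `|` B).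
Proof.
move=> split; apply: le_ereal_inf_tmp => _ [E [admE covE] <-].
have /choice[E12 E12P] : forall k, exists ij : option I * option I,
    [/\ forall j, ij.1 = Some j -> adm j, forall j, ij.2 = Some j -> adm j,
        oapp c set0 (E k) `&` A `<=` oapp c set0 ij.1,
        oapp c set0 (E k) `&` B `<=` oapp c set0 ij.2 &
        oapp w 0 ij.1 + oapp w 0 ij.2 <= oapp w 0 (E k)].
  move=> k; case Ek : (E k) => [i|]; last first.
    by exists (None, None); split => //=; rewrite ?set0I ?adde0.
  by have [i1 [i2 h]] := split _ (admE _ _ Ek); exists (i1, i2).
have pos (F : (option I)^nat) : (forall k i, F k = Some i -> adm i) ->
    forall k, 0 <= oapp w 0 (F k).
  by move=> aF k; case Fk : (F k) => [i|]//=; exact/w0/aF/Fk.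
have adm1 k i : (E12 k).1 = Some i -> adm i by case: (E12P k) => + *; exact.
have adm2 k i : (E12 k).2 = Some i -> adm i by case: (E12P k) => _ + *; exact.
apply: (@le_trans _ _ (\sum_(k <oo) oapp w 0 (E12 k).1 +
                       \sum_(k <oo) oapp w 0 (E12 k).2)).
  apply: leeD; apply: ereal_inf_lbound.
    exists (fun k => (E12 k).1) => //; split=> // x Ax.
    have [k _ Ekx] := covE x (or_introl Ax); exists k => //.
    by have [_ _ h _ _] := E12P k; exact: h.
  exists (fun k => (E12 k).2) => //; split=> // x Bx.
  have [k _ Ekx] := covE x (or_intror Bx); exists k => //.
  by have [_ _ _ h _] := E12P k; exact: h.
rewrite -nneseriesD; last 2 first.
- by move=> k _ _; exact: (pos (fun k => (E12 k).1)).
- by move=> k _ _; exact: (pos (fun k => (E12 k).2)).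
apply: lee_nneseries => k _.
  by move=> _; apply: adde_ge0; [exact: (pos (fun k => (E12 k).1))|exact: (pos (fun k => (E12 k).2))].
by have [] := E12P k.
Qed.
End cover_splitting.

Section euclidean_norm.
Context {R : realType}.

Lemma mdot_ge0 m n (A : 'M[R]_(m, n)) : 0 <= mdot A A.
Proof. by apply: sumr_ge0 => i _; apply: sumr_ge0 => j _; rewrite -expr2 sqr_ge0. Qed.

Lemma sqr_entry_le_mdot m n (A : 'M[R]_(m, n)) i j : A i j ^+ 2 <= mdot A A.
Proof.
rewrite /mdot (bigD1 i)//= (bigD1 j)//= -expr2 -addrA lerDl addr_ge0//.
  by apply: sumr_ge0 => k _; rewrite -expr2 sqr_ge0.
by apply: sumr_ge0 => k _; apply: sumr_ge0 => l _; rewrite -expr2 sqr_ge0.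
Qed.

Lemma entry_le_enorm m n (A : 'M[R]_(m, n)) i j : `|A i j| <= enorm A.
Proof. by rewrite -sqrtr_sqr /enorm ler_wsqrtr// sqr_entry_le_mdot. Qed.
End euclidean_norm.

Section separated_lebesgue_hausdorff.
Context {R : realType} {d : nat}.
Local Open Scope ereal_scope.

Let box_volume_ge0' (ab : 'rV[R]_d * 'rV[R]_d) :
  proper_box ab -> 0 <= box_volume ab.
Proof.
by move=> pab; rewrite lee_fin; apply: prodr_ge0 => i _; rewrite subr_ge0.
Qed.

(** A box is cut by the hyperplane half way between the two sets. *)
Lemma lebesgue_separated (i : 'I_d) :
  separated_additive (lebesgue_om R d) (fun x => x 0%R i).
Proof.
move=> a b A B ab Aa Bb; apply: cover_outer_split => [|[p q] pq].
  exact: box_volume_ge0'.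
have [m [am mb]] : exists m, (a < m /\ m < b)%R.
  by exists ((a + b) / 2)%R; rewrite midf_lt//; split; lra.
pose t := Num.min (Num.max m (p 0%R i)) (q 0%R i).
have pqi : (p 0%R i <= q 0%R i)%R := pq i.
have pt : (p 0%R i <= t)%R by rewrite /t le_min pqi andbT le_max lexx orbT.
have tq : (t <= q 0%R i)%R by rewrite /t ge_min lexx orbT.
pose q1 : 'rV[R]_d := \row_j (if j == i then t else q 0%R j).
pose p2 : 'rV[R]_d := \row_j (if j == i then t else p 0%R j).
exists (Some (p, q1)), (Some (p2, q)); split.
- by move=> _ [<-] j /=; rewrite /q1 mxE; case: eqP => [->|_]//; exact: pq.
- by move=> _ [<-] j /=; rewrite /p2 mxE; case: eqP => [->|_]//; exact: pq.
- move=> x [/= xpq /Aa xa] j /=; rewrite /q1 mxE.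
  have /andP[pj qj] := xpq j; rewrite pj/=; case: eqP => [ji|_]//.
  rewrite ji in pj qj *; rewrite /t lt_min qj andbT lt_max.
  by rewrite (le_lt_trans xa am).
- move=> x [/= xpq /Bb xb] j /=; rewrite /p2 mxE.
  have /andP[pj qj] := xpq j; rewrite qj andbT; case: eqP => [ji|_]//.
  rewrite ji in pj qj *; rewrite /t gt_min; apply/orP; left; rewrite gt_max pj andbT.
  exact: lt_le_trans mb xb.
- rewrite /= /box_volume -EFinD lee_fin.
  rewrite (bigD1 i)//= [X in (_ + X <= _)%R](bigD1 i)//= [leRHS](bigD1 i)//=.
  rewrite /q1 /p2 !mxE eqxx.
  under eq_bigr => j /negbTE ji do rewrite mxE ji.
  under [X in (_ + _ * X)%R]eq_bigr => j /negbTE ji do rewrite mxE ji.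
  by rewrite -mulrDl [X in (X * _)%R](_ : _ = (q 0%R i - p 0%R i)%R)//; lra.
Qed.

Lemma adde_sup_le (S1 S2 : set (\bar R)) (M : \bar R) :
  S1 !=set0 -> S2 !=set0 -> (forall x, S1 x -> 0 <= x) ->
  (forall y, S2 y -> 0 <= y) ->
  (forall x y, S1 x -> S2 y -> x + y <= M) ->
  ereal_sup S1 + ereal_sup S2 <= M.
Proof.
move=> [x0 S1x0] [y0 S2y0] S10 S20 S12.
have [->|Moo] := eqVneq M +oo; first exact: leey.
have M0 : 0 <= M by rewrite (le_trans _ (S12 _ _ S1x0 S2y0))// adde_ge0 ?(S10 _ S1x0) ?(S20 _ S2y0).
have Mfin : M \is a fin_num by rewrite ge0_fin_numE// ltey.
have xfin x : S1 x -> x \is a fin_num.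
  move=> S1x; rewrite ge0_fin_numE ?S10//.
  rewrite (le_lt_trans _ (_ : M < +oo)) ?ltey//.
  by rewrite (le_trans _ (S12 _ _ S1x S2y0))// leeDl// S20.
have S2M x : S1 x -> ereal_sup S2 <= M - x.
  by move=> S1x; apply: ge_ereal_sup => y S2y; rewrite leeBrDl ?xfin// S12.
have s20 : 0 <= ereal_sup S2 by rewrite (le_trans (S20 _ S2y0))// ereal_sup_ubound.
have s2fin : ereal_sup S2 \is a fin_num.
  rewrite ge0_fin_numE// (le_lt_trans (S2M _ S1x0))// -ge0_fin_numE.
    by rewrite fin_numB Mfin xfin.
  exact: le_trans s20 (S2M _ S1x0).
rewrite -leeBrDr//; apply: ge_ereal_sup => x S1x; rewrite leeBrDr//.
by rewrite -leeBrDl ?xfin// S2M.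
Qed.

Let hausdorff_weight_ge0' s delta (A : set 'rV[R]_d) :
  diam_le delta A -> 0 <= hausdorff_weight s A.
Proof.
have bv n : (0 <= ball_volume n :> R)%R.
  suff : (0 <= ball_volume n :> R)%R /\ (0 <= ball_volume n.+1 :> R)%R by case.
  elim: n => [|n [IH1 IH2]]; first by rewrite /= ler01 ler0n.
  split=> //=; rewrite mulr_ge0//= divr_ge0//= mulr_ge0//; exact: pi_ge0.
move=> dA; rewrite lee_fin mulr_ge0// exprn_ge0// divr_ge0//.
have [[x Ax]|A0] := pselect (A !=set0).
  have e0 : (0 <= enorm (x - x))%R by exact: sqrtr_ge0.
  apply: (le_trans e0); apply: ub_le_sup; last by exists (x, x).
  by exists delta => _ [[y z] [/= Ay Az] <-]; exact: dA.
rewrite (_ : [set _ | _ in _] = set0) ?sup0//.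
by rewrite -subset0 => _ [[y z] [/= Ay _] _]; apply: A0; exists y.
Qed.

Lemma hausdorff_content_ge0 s delta (A : set 'rV[R]_d) :
  0 <= hausdorff_content s delta A.
Proof. apply: cover_outer_ge0; exact: hausdorff_weight_ge0'. Qed.

Lemma le_hausdorff_content s delta delta' (A : set 'rV[R]_d) :
  (delta <= delta')%R -> hausdorff_content s delta' A <= hausdorff_content s delta A.
Proof.
move=> dd'; apply: ereal_inf_le_tmp => _ [E [aE cE] <-]; exists E => //.
split=> // k i /aE di x y ix iy; exact: le_trans (di _ _ ix iy) dd'.
Qed.

(** A set of diameter smaller than the gap meets at most one of the two
    sets. *)
Lemma hausdorff_separated s (i : 'I_d) :
  separated_additive (hausdorff_om R d s) (fun x => x 0%R i).
Proof.
move=> a b A B ab Aa Bb.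
apply: adde_sup_le.
- by exists (hausdorff_content s 1 A); exists 1%R => /=.
- by exists (hausdorff_content s 1 B); exists 1%R => /=.
- by move=> _ [delta _ <-]; exact: hausdorff_content_ge0.
- by move=> _ [delta _ <-]; exact: hausdorff_content_ge0.
move=> _ _ [d1 /= d10 <-] [d2 /= d20 <-].
pose dl := Num.min (Num.min d1 d2) ((b - a) / 2)%R.
have dl0 : (0 < dl)%R by rewrite /dl !lt_min d10 d20/=; lra.
have dl1 : (dl <= d1)%R by rewrite /dl !ge_min lexx.
have dl2 : (dl <= d2)%R by rewrite /dl !ge_min lexx !orbT.
have dl3 : (dl < b - a)%R.
  by apply: (@le_lt_trans _ _ ((b - a) / 2)%R); [rewrite /dl !ge_min lexx !orbT|lra].
apply: (@le_trans _ _ (hausdorff_content s dl (A `|` B))); last first.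
  by apply: ereal_sup_ubound; exists dl.
apply: le_trans (leeD (le_hausdorff_content s _ dl1) (le_hausdorff_content s _ dl2)) _.
apply: cover_outer_split => [X|X dX]; first exact: hausdorff_weight_ge0'.
have w0 := hausdorff_weight_ge0' s dX.
have [[x [Xx Ax]]|XA] := pselect ((X `&` A) !=set0).
  exists (Some X), None; split=> //=.
  - by move=> _ [<-].
  - move=> y [Xy By]; have := dX y x Xy Xx.
    have := entry_le_enorm (y - x)%R 0%R i; rewrite !mxE.
    have := Aa _ Ax; have := Bb _ By => h1 h2 h3 h4.
    have h5 := ler_norm (y 0%R i - x 0%R i)%R; lra.
  - by rewrite adde0.
exists None, (Some X); split=> //=.
- by move=> _ [<-].
- by move=> y [Xy Ay]; apply: XA; exists y.
- by rewrite add0e.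
Qed.

End separated_lebesgue_hausdorff.

Section boxes.
Context {R : realType} {d : nat}.
Local Notation V := 'rV[R]_d.

Definition cbox (ab : V * V) : set V :=
  [set x | forall i, ab.1 0 i <= x 0 i <= ab.2 0 i].

(** Boxes with rational vertices are countably many, so that an open set is a
    countable union of them. *)
Definition rational_box (pq : 'rV[rat]_d * 'rV[rat]_d) : V * V :=
  (map_mx ratr pq.1, map_mx ratr pq.2).

Lemma compact_cbox ab : compact (cbox ab).
Proof.
rewrite (_ : cbox ab =
    [set v | forall i, `[ab.1 0 i, ab.2 0 i]%classic (v ord0 i)]).
  have := @rV_compact R d (fun i => `[ab.1 0 i, ab.2 0 i]%classic).
  by apply=> i; exact: segment_compact.
by apply/seteqP; split => x /= h i; have := h i; rewrite in_itv.
Qed.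

Lemma obox_sub_cbox ab : obox ab `<=` cbox ab.
Proof. by move=> x h i; have /andP[/ltW -> /ltW ->] := h i. Qed.

Lemma open_rational_box (O : set V) x : open O -> O x ->
  exists pq, obox (rational_box pq) x /\ cbox (rational_box pq) `<=` O.
Proof.
move=> oO Ox; have : nbhs x O by exact: open_nbhs_nbhs.
move=> /nbhs_ballP[e /= e0 eO].
have e2 : 0 < e / 2 by rewrite divr_gt0.
have /choice[p hp] : forall i, exists q : rat, x 0 i - e / 2 < ratr q < x 0 i.
  move=> i; have [|q] := @rat_in_itvoo R (x 0 i - e / 2) (x 0 i); first lra.
  by rewrite in_itv/=; exists q.
have /choice[q hq] : forall i, exists q : rat, x 0 i < ratr q < x 0 i + e / 2.
  move=> i; have [|q] := @rat_in_itvoo R (x 0 i) (x 0 i + e / 2); first lra.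
  by rewrite in_itv/=; exists q.
exists (\row_i p i, \row_i q i); split => [i|y hy].
  rewrite /rational_box/= !mxE.
  by have /andP[_ ->] := hp i; have /andP[-> _] := hq i.
apply: eO; split=> // i j; rewrite ord1 /ball/= ltr_norml.
have := hy j; rewrite /rational_box/= !mxE => /andP[h1 h2].
have /andP[h3 h4] := hp j; have /andP[h5 h6] := hq j.
by apply/andP; split; lra.
Qed.

End boxes.

Section borel_measurable.
Context {R : realType} {d : nat}.
Local Notation V := 'rV[R]_d.
Variable mu : {outer_measure set V -> \bar R}.
Hypothesis sep : forall i, separated_additive mu (fun x : V => x 0 i).
Local Notation Vmu := (caratheodory_type mu).

(** Half-spaces are Caratheodory measurable because slabs separate; boxes, then
    open sets, are obtained from them. *)
Lemma measurable_coord i : measurable_fun setT (fun x : Vmu => (x : V) 0 i).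
Proof.
apply: (measurability _ (RGenInftyO.measurableE R)) => _ [_ [c ->] <-].
rewrite setTI; have := separated_caratheodory c (@sep i).
by congr (mu.-caratheodory _); apply/seteqP; split => x /=; rewrite in_itv.
Qed.

Lemma measurable_obox ab : measurable (obox ab : set Vmu).
Proof.
rewrite (_ : obox ab = \bigcap_(i in [set: 'I_d])
    ((fun x : Vmu => (x : V) 0 i) @^-1` `]ab.1 0 i, ab.2 0 i[%classic)).
  apply: fin_bigcap_measurable => // i _.
  by rewrite -[X in measurable X]setTI; apply: measurable_coord.
apply/seteqP; split=> x /= h i; first by move=> _; rewrite /= in_itv; exact: h.
by have := h i I; rewrite /= in_itv.
Qed.

Lemma measurable_open (O : set V) : open O -> measurable (O : set Vmu).
Proof.
move=> oO.
rewrite (_ : O = \bigcup_pq (if `[< cbox (rational_box pq) `<=` O >]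
    then obox (rational_box pq) else set0)).
  apply: countable_bigcupT_measurable => [|pq]; first exact: countableP.
  by case: ifP => _; [exact: measurable_obox|exact: measurable0].
apply/seteqP; split=> [x Ox|x [pq _]].
  have [pq [h1 h2]] := open_rational_box oO Ox.
  by exists pq => //; case: asboolP.
by case: asboolP => // h /obox_sub_cbox/h.
Qed.

Lemma measurable_closed (F : set V) : closed F -> measurable (F : set Vmu).
Proof.
move=> cF; rewrite -[F]setCK; apply: measurableC; apply: measurable_open.
exact: closed_openC.
Qed.

Lemma measurable_continuous (D : set Vmu) (f : V -> R) : continuous f ->
  measurable_fun D (f : Vmu -> R).
Proof.
move=> cf; apply: (@measurable_funS _ _ _ _ setT) => //.
apply: (measurability _ (RGenOInfty.measurableE R)) => _ [_ [c ->] <-].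
rewrite setTI; apply: measurable_open; move/continuousP: cf; apply.
exact: interval_open.
Qed.

Lemma measurable_bd (O : set V) : measurable (bd O : set Vmu).
Proof.
apply: measurableD; first exact/measurable_closed/closed_closure.
exact/measurable_open/open_interior.
Qed.

End borel_measurable.

Section lebesgue_finite.
Context {R : realType} {d : nat}.
Local Notation V := 'rV[R]_d.
Local Open Scope ereal_scope.

Lemma leb_obox_le (ab : V * V) : proper_box ab ->
  leb R d (obox ab) <= box_volume ab.
Proof.
move=> pab.
pose E k : option (V * V) := if k is 0%N then Some ab else None.
apply: (@le_trans _ _ (\sum_(k <oo) oapp box_volume 0 (E k))).
  apply: ereal_inf_lbound; exists E => //; split => [[|k] i// [<-]//|x xab].
  by exists 0%N.
apply: lime_le; first by apply: is_cvg_nneseries => -[|k] _ _ //=; rewrite lee_fin;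
  apply: prodr_ge0 => i _; rewrite subr_ge0.
apply: nearW => -[|n]; first by rewrite big_mkord big_ord0 lee_fin;
  apply: prodr_ge0 => i _; rewrite subr_ge0.
by rewrite big_mkord big_ord_recl/= big1// adde0.
Qed.

Lemma leb_bounded (A : set V) : bounded_set A -> leb R d A < +oo.
Proof.
move=> -[M [Mr hM]].
have M0 : (0 < `|M| + 1)%R by rewrite ltr_wpDl.
have lM : (M < `|M| + 1)%R by rewrite (le_lt_trans (ler_norm _))// ltrDl.
pose ab : V * V := (const_mx (- (`|M| + 2))%R, const_mx (`|M| + 2)%R).
have pab : proper_box ab by move=> i; rewrite !mxE; have := normr_ge0 M; lra.
apply: le_lt_trans (_ : _ <= box_volume ab) (ltey _).
apply: le_trans (leb_obox_le pab); apply: le_outer_measure => x Ax i.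
have := hM _ lM x Ax; rewrite /= !mxE => h.
have : (`|x 0%R i| <= `|M| + 1)%R.
  apply: le_trans h; rewrite [leRHS]mx_normrE.
  by apply: le_trans (le_bigmax _ _ (0%R, i)).
by rewrite ler_norml => /andP[h1 h2]; apply/andP; split; lra.
Qed.

Lemma leb_obox_fin (ab : V * V) : leb R d (obox ab) < +oo.
Proof.
apply: leb_bounded; have [M [Mr hM]] := compact_bounded (@compact_cbox _ _ ab).
by exists M; split=> // r Mr' x /obox_sub_cbox; exact: hM.
Qed.

End lebesgue_finite.

(** * Smooth bumps and the fundamental lemma of the calculus of variations *)

Lemma is_derive_cvg {R : numFieldType} {V W : normedModType R} (f : V -> W)
    x v (df : W) :
  (fun h => h^-1 *: (f (h *: v + x) - f x)) @ 0^' --> df -> is_derive x v f df.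
Proof.
by move=> fdf; apply: DeriveDef; [apply/cvg_ex; exists df|exact/cvg_lim].
Qed.

Section bumps.
Context {R : realType}.

(** All the derivatives of [exp (- 1 / x)] on the positive half-line, extended
    by zero, are of the form [p (1 / x) * exp (- 1 / x)]. *)
Definition flat (p : {poly R}) (x : R) : R :=
  if 0 < x then p.[x^-1] * expR (- x^-1) else 0.

Lemma horner_expRN_bound (p : {poly R}) : exists C, forall y, 1 <= y ->
  `|p.[y] * expR (- y)| <= C / y.
Proof.
pose n := size p; pose A := \sum_(i < n) `|p`_i|.
exists (A * n.+1`!%:R) => y y1.
have y0 : 0 < y by rewrite (lt_le_trans _ y1).
have pA : `|p.[y]| <= A * y ^+ n.
  rewrite horner_coef (le_trans (ler_norm_sum _ _ _))// mulr_suml.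
  apply: ler_sum => i _; rewrite normrM ler_wpM2l// (ger0_norm (exprn_ge0 _ (ltW y0)))//.
  by rewrite ler_weXn2l// ltnW.
have yexp : y ^+ n.+1 <= n.+1`!%:R * expR y.
  have /(le_trans _) := @expR_ge1Dxn R y n (ltW y0).
  move=> /(_ (y ^+ n.+1 / n.+1`!%:R)); rewrite lerDr => /(_ ler01).
  by rewrite ler_pdivrMr ?ltr0n ?fact_gt0// mulrC.
rewrite normrM (ger0_norm (expR_ge0 _)) expRN ler_pdivlMr// mulrAC.
rewrite ler_pdivrMr ?expR_gt0// (@le_trans _ _ (A * y ^+ n * y))//.
  by rewrite ler_wpM2r// ltW.
rewrite -!mulrA -exprSr ler_wpM2l//.
exact: sumr_ge0.
Qed.

Lemma is_derive_flat (p : {poly R}) (x : R) :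
  is_derive x 1 (flat p) (flat ('X^2 * (p - p^`())) x).
Proof.
have [x0|x0|->] := ltgtP x 0.
- rewrite [X in is_derive _ _ _ X](_ : _ = 0); last first.
    by rewrite /flat ltNge (ltW x0).
  apply: (near_eq_is_derive (f := cst 0)).
  near=> y; rewrite /= /flat ifF//; apply/negbTE; rewrite -leNgt.
  by near: y; apply: filterS (lt_nbhsl x0) => y /= /ltW.
- rewrite [X in is_derive _ _ _ X](_ : _ =
      ('X^2 * (p - p^`())).[x^-1] * expR (- x^-1)); last by rewrite /flat x0.
  apply: (near_eq_is_derive
      (f := (horner p \o GRing.inv) * (expR \o (fun y => - y^-1)))).
    near=> y; rewrite /flat ifT//.
    by near: y; exact: lt_nbhsr.
  have dV : is_derive x 1 (fun y : R => y^-1) (- x ^- 2 *: 1).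
    by apply: (is_deriveV (f := id)) => //; rewrite gt_eqF.
  have dNV : is_derive x 1 (fun y : R => - y^-1) (- (- x ^- 2 *: 1)).
    exact: (is_deriveN (f := fun y : R => y^-1)).
  have d1 := @is_derive1_comp _ (horner p) _ x _ _ (is_derive_poly p x^-1) dV.
  have d2 := @is_derive1_comp _ expR (fun y => - y^-1) x _ _
    (is_derive_expR (- x^-1)) dNV.
  have dM := is_deriveM d1 d2.
  apply: is_derive_eq; rewrite /GRing.scale/= !hornerE/= ?mulr1 -?exprVn; ring.
- rewrite [X in is_derive _ _ _ X](_ : _ = 0); last by rewrite /flat ltxx.
  apply: is_derive_cvg.
  have [C hC] := horner_expRN_bound (p * 'X).
  apply/cvgr0Pnorm_le => e e0.
  near=> h; rewrite [h *: 1]mulr1 addr0 {2}/flat ltxx subr0.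
  have [h0|h0] := ltP 0 h; last by rewrite /flat ltNge h0/= scaler0 normr0 ltW.
  have h1 : h < 1.
    rewrite (le_lt_trans (ler_norm _))//; near: h.
    by apply: dnbhs0_lt.
  rewrite /flat h0 /GRing.scale/=.
  rewrite [X in `|X|](_ : _ = (p * 'X).[h^-1] * expR (- h^-1)); last first.
    by rewrite hornerM hornerX; ring.
  apply: (le_trans (hC _ _)); first by rewrite invf_ge1// ltW.
  rewrite invrK.
  have C1 : 0 < `|C| + 1 by rewrite ltr_wpDl.
  rewrite (@le_trans _ _ ((`|C| + 1) * `|h|))//.
    have := ler_norm (C * h); rewrite normrM => /le_trans; apply.
    by rewrite ler_wpM2r// lerDl.
  rewrite mulrC -ler_pdivlMr//.
  by near: h; apply: dnbhs0_le; rewrite divr_gt0.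
Unshelve. all: by end_near. Qed.

(** A class of functions of one variable that is closed under differentiation,
    so that its members are smooth, and that contains enough bumps. *)
Inductive bumpy : (R -> R) -> Prop :=
| bumpy_flat p a b : bumpy (fun x => flat p (a * x + b))
| bumpyD f g : bumpy f -> bumpy g -> bumpy (fun x => f x + g x)
| bumpyZ c f : bumpy f -> bumpy (fun x => c * f x)
| bumpyM f g : bumpy f -> bumpy g -> bumpy (fun x => f x * g x).

Lemma is_derive_bumpy f : bumpy f ->
  exists2 f', bumpy f' & forall x : R, is_derive x 1 f (f' x).
Proof.
elim=> [p a b|{}f g bf [f' bf' df] bg [g' bg' dg]|c {}f bf [f' bf' df]|
  {}f g bf [f' bf' df] bg [g' bg' dg]].
- exists (fun x => flat (a *: ('X^2 * (p - p^`()))) (a * x + b)).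
    exact: bumpy_flat.
  move=> x.
  have dl : is_derive x 1 (fun x => a * x + b) a.
    have dD := is_deriveD (is_deriveZ a (is_derive_id x (1 : R)))
      (is_derive_cst b x (1 : R)).
    by apply: is_derive_eq; rewrite addr0 [_ *: 1]mulr1.
  have dc := @is_derive1_comp _ (flat p) _ x _ _ (is_derive_flat p (a * x + b)) dl.
  apply: is_derive_eq; rewrite /flat; case: ifP => _; last by rewrite mul0r.
  by rewrite hornerZ; ring.
- exists (fun x => f' x + g' x); first exact: bumpyD.
  by move=> x; exact: is_deriveD.
- exists (fun x => c * f' x); first exact: bumpyZ.
  by move=> x; exact: (is_deriveZ c (df x)).
- exists (fun x => f x * g' x + g x * f' x); first by apply: bumpyD; exact: bumpyM.
  by move=> x; exact: is_deriveM.
Qed.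

Lemma bumpy_derivable f x : bumpy f -> derivable f x 1.
Proof. by move=> /is_derive_bumpy[f' _ /(_ x)[]]. Qed.

Lemma bumpy_derive1 f : bumpy f -> bumpy (derive1 f).
Proof.
move=> /is_derive_bumpy[f' bf' df]; rewrite (_ : derive1 f = f')//.
by apply/funext => x; rewrite derive1E derive_val.
Qed.

Lemma bumpy_derive1n n f : bumpy f -> bumpy (derive1n n f).
Proof.
by move=> bf; elim: n => [//|n IH]; rewrite derive1nS; exact: bumpy_derive1.
Qed.

Lemma bumpy_continuous f : bumpy f -> continuous f.
Proof.
move=> bf x; apply/differentiable_continuous/derivable1_diffP.
exact: bumpy_derivable.
Qed.

Definition bump (n : nat) (a b x : R) : R :=
  flat 1 (n.+1%:R * x + - (n.+1%:R * a)) * flat 1 (- n.+1%:R * x + n.+1%:R * b).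

Lemma bumpE n a b x :
  bump n a b x = flat 1 (n.+1%:R * (x - a)) * flat 1 (n.+1%:R * (b - x)).
Proof. by rewrite /bump -mulrBr; congr (_ * flat 1 _); ring. Qed.

Lemma bumpy_bump n a b : bumpy (bump n a b).
Proof. by apply: bumpyM; exact: bumpy_flat. Qed.

Lemma flat1_ge0 (x : R) : 0 <= flat 1 x.
Proof. by rewrite /flat; case: ifP => // _; rewrite hornerC mul1r expR_ge0. Qed.

Lemma flat1_le1 (x : R) : flat 1 x <= 1.
Proof.
rewrite /flat; case: ifPn => // x0; rewrite hornerC mul1r -expR0 ler_expR.
by rewrite oppr_le0 invr_ge0 ltW.
Qed.

Lemma bump_ge0 n a b x : 0 <= bump n a b x.
Proof. by rewrite mulr_ge0 ?flat1_ge0. Qed.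

Lemma bump_le1 n a b x : bump n a b x <= 1.
Proof. by rewrite mulr_ile1 ?flat1_ge0 ?flat1_le1. Qed.

Lemma bump_eq0 n a b x : ~~ (a < x < b) -> bump n a b x = 0.
Proof.
have n0 : 0 < n.+1%:R :> R by rewrite ltr0n.
rewrite negb_and -!leNgt bumpE /flat !(pmulr_rgt0 _ n0) !subr_gt0.
by case/orP => h; rewrite !ltNge h/= ?mul0r ?mulr0.
Qed.

Lemma bump_gt0 n a b x : a < x < b -> 0 < bump n a b x.
Proof.
move=> /andP[ax xb]; have n0 : 0 < n.+1%:R :> R by rewrite ltr0n.
rewrite bumpE /flat !(pmulr_rgt0 _ n0) !subr_gt0 ax xb.
by rewrite !hornerC !mul1r mulr_gt0 ?expR_gt0.
Qed.

(** Both factors are of the form [exp (- 1 / (n * y))] with [y > 0]. *)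
Lemma bump_cvg a b x : a < x < b -> bump n a b x @[n --> \oo] --> (1 : R).
Proof.
move=> /andP[ax xb].
have flat_cvg (y : R) : 0 < y -> flat 1 (n.+1%:R * y) @[n --> \oo] --> (1 : R).
  move=> y0; rewrite (_ : (fun _ => _) =
      (fun n => expR (- (harmonic n * y^-1)))); last first.
    apply/funext => n; rewrite /flat pmulr_rgt0 ?ltr0n// y0 hornerC mul1r.
    by rewrite invfM /harmonic.
  rewrite -expR0; apply: continuous_cvg; first exact: continuous_expR.
  rewrite -[X in _ --> X]oppr0; apply: cvgN.
  by rewrite -[X in _ --> X](mul0r y^-1); apply: cvgMl; exact: cvg_harmonic.
have h1 := flat_cvg (x - a); have h2 := flat_cvg (b - x).
rewrite !subr_gt0 in h1 h2; have := cvgM (h1 ax) (h2 xb); rewrite mulr1.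
rewrite (_ : (fun n => bump n a b x) = fun n : nat =>
  flat 1 (n.+1%:R * (x - a)) * flat 1 (n.+1%:R * (b - x))); first exact.
by apply/funext => n; rewrite bumpE.
Qed.

End bumps.

Lemma ae_imply2 {disp} {T : measurableType disp} {R : realType}
    {mu : {measure set T -> \bar R}} (P Q S : T -> Prop) :
  {ae mu, forall x, P x} -> {ae mu, forall x, Q x} ->
  (forall x, P x -> Q x -> S x) -> {ae mu, forall x, S x}.
Proof. by move=> hP hQ PQS; apply: filterS2 hP hQ. Qed.

Lemma ae_imply {disp} {T : measurableType disp} {R : realType}
    {mu : {measure set T -> \bar R}} (P Q : T -> Prop) :
  {ae mu, forall x, P x} -> (forall x, P x -> Q x) -> {ae mu, forall x, Q x}.
Proof. by move=> hP PQ; apply: filterS hP. Qed.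

Lemma ae_forall_fin {disp} {T : measurableType disp} {R : realType}
    {mu : {measure set T -> \bar R}} {I : finType} (P : I -> T -> Prop) :
  (forall i, {ae mu, forall x, P i x}) -> {ae mu, forall x, forall i, P i x}.
Proof. by move=> hP; exact: filter_forall. Qed.

Lemma RintegralN {disp} {T : measurableType disp} {R : realType}
    (mu : {measure set T -> \bar R}) (D : set T) (f : T -> R) :
  \int[mu]_(x in D) (- f x) = - \int[mu]_(x in D) f x.
Proof.
rewrite /Rintegral.
rewrite (_ : (fun x => (- f x)%:E) = (\- (EFin \o f))%E)//.
rewrite integralE [in RHS]integralE funeposN funenegN.
set a := integral _ _ (_^\-)%E; set b := integral _ _ _.
have a0 : (0 <= a)%E by apply: integral_ge0 => x _; exact: funeneg_ge0.
have b0 : (0 <= b)%E by apply: integral_ge0 => x _; exact: funepos_ge0.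
move: a b a0 b0 => [a| |] [b| |]//= _ _; rewrite ?opprB ?oppr0//.
Qed.

Section product_bumps.
Context {R : realType} {d : nat}.
Local Notation V := 'rV[R]_d.

Definition prod_fun (b : 'I_d -> R -> R) (x : V) : R := \prod_i b i (x 0 i).

Lemma continuous_prod_fun b : (forall i, bumpy (b i)) -> continuous (prod_fun b).
Proof.
move=> bb; rewrite /prod_fun; apply: continuous_big => [|i _].
  exact: mul_continuous.
move=> x; apply: continuous_comp; first exact: coord_continuous.
exact: bumpy_continuous.
Qed.

Lemma is_derive_prod_fun b j (x : V) : (forall i, bumpy (b i)) ->
  is_derive x (ebase j) (prod_fun b)
    (prod_fun (fun i => if i == j then derive1 (b j) else b i) x).
Proof.
move=> bb; apply: is_derive_cvg.
pose c := \prod_(i | i != j) b i (x 0 i).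
have -> : prod_fun (fun i => if i == j then (b j)^`()%classic else b i) x =
    (b j)^`()%classic (x 0 j) * c.
  rewrite /prod_fun (bigD1 j)//= eqxx; congr (_ * _).
  by apply: eq_bigr => i /negbTE ->.
have -> : (fun h => h^-1 *: (prod_fun b (h *: ebase j + x) - prod_fun b x)) =
    (fun h => (h^-1 *: (b j (h *: 1 + x 0 j) - b j (x 0 j))) * c).
  apply/funext => h; rewrite /prod_fun (bigD1 j)//= [X in _ - X](bigD1 j)//=.
  rewrite !mxE !eqxx [h *: 1]mulr1 /GRing.scale/= mulr1.
  rewrite (eq_bigr (fun i => b i (x 0 i))); last first.
    by move=> i /negbTE ij; rewrite !mxE ij andbF mulr0 add0r.
  by rewrite -mulrBl mulrA.
apply: cvgMl; rewrite derive1E.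
exact: (@bumpy_derivable _ (b j) (x 0 j) (bb j)).
Qed.

(** A partial derivative of a product of functions of one coordinate changes
    one of the factors only. *)
Lemma iter_partial_prod_fun b s : (forall i, bumpy (b i)) ->
  exists2 b', (forall i, bumpy (b' i)) & iter_partial s (prod_fun b) = prod_fun b'.
Proof.
move=> bb; elim: s => [|j s [b' bb' IH]]; first by exists b.
exists (fun i => if i == j then derive1 (b' j) else b' i).
  by move=> i; case: eqP => // _; exact: bumpy_derive1.
apply/funext => x /=; rewrite IH.
by have [_ ->] := is_derive_prod_fun j x bb'.
Qed.

Lemma smooth_prod_fun b : (forall i, bumpy (b i)) -> smooth (prod_fun b).
Proof.
move=> bb s; have [b' bb' ->] := iter_partial_prod_fun s bb; split.
  exact: continuous_prod_fun.
by move=> x j; have [] := is_derive_prod_fun j x bb'.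
Qed.

Definition box_bump n (ab : V * V) : V -> R :=
  prod_fun (fun i => bump n (ab.1 0 i) (ab.2 0 i)).

Lemma box_bump_eq0 n ab x : ~ obox ab x -> box_bump n ab x = 0.
Proof.
move=> /existsNP[i /negP h]; rewrite /box_bump /prod_fun (bigD1 i)//=.
by rewrite bump_eq0// mul0r.
Qed.

Lemma box_bump_ge0 n ab x : 0 <= box_bump n ab x.
Proof. by apply: prodr_ge0 => i _; exact: bump_ge0. Qed.

Lemma box_bump_le1 n ab x : box_bump n ab x <= 1.
Proof. by apply: prodr_ile1 => i _; rewrite bump_ge0 bump_le1. Qed.

Lemma test_function_box_bump (O : set V) n ab : cbox ab `<=` O ->
  test_function O (box_bump n ab).
Proof.
move=> abO; split; first by apply: smooth_prod_fun => i; exact: bumpy_bump.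
exists (cbox ab); split=> //; first exact: compact_cbox.
by move=> x xab; apply: box_bump_eq0 => /obox_sub_cbox.
Qed.

Lemma box_bump_cvg ab x : obox ab x -> box_bump n ab x @[n --> \oo] --> (1 : R).
Proof.
move=> xab; rewrite /box_bump /prod_fun.
have := @cvg_big R 'I_d (@GRing.mul R) 1 xpredT (@mul_continuous R) nat \oo
  (index_enum 'I_d)
  (fun i n => bump n (ab.1 0 i) (ab.2 0 i) (x 0 i)) (fun=> 1) _
  (fun i _ => bump_cvg (xab i)).
rewrite big1_eq; exact.
Qed.

End product_bumps.

Section fundamental_lemma.
Context {R : realType} {d : nat}.
Local Notation V := 'rV[R]_d.
Local Notation mu := (leb R d).
Local Notation Vl := (lebesgue_space R d).
Variables (O : set V) (oO : open O).

Section vanishing_on_boxes.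
Variable g : V -> R.
Hypothesis mg : measurable_fun (O : set Vl) (g : Vl -> R).
Hypothesis g2 : (\int[mu]_(x in O) (g x ^+ 2)%:E < +oo)%E.
Hypothesis g0 : forall phi, test_function O phi ->
  \int[mu]_(x in O) (g x * phi x) = 0.

Let mO : measurable (O : set Vl).
Proof. exact: measurable_open (@lebesgue_separated R d) _ oO. Qed.

Let mobox (ab : V * V) : measurable (obox ab : set Vl).
Proof. exact: measurable_obox (@lebesgue_separated R d) _. Qed.

Let subO ab : cbox ab `<=` O -> obox ab `<=` O.
Proof. by move=> abO; apply: subset_trans abO; exact: obox_sub_cbox. Qed.

Let g_integrable ab : cbox ab `<=` O ->
  mu.-integrable (obox ab) (EFin \o (g : Vl -> R)).
Proof.
move=> /subO abO.
have mgab : measurable_fun (obox ab : set Vl) (g : Vl -> R).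
  exact: measurable_funS mg.
have mg2 : measurable_fun (obox ab : set Vl) (fun x : Vl => g x ^+ 2).
  exact: measurable_funX.
apply: (le_integrable (mobox ab)
    (g := (fun x : Vl => (cst 1 x)%:E + (g x ^+ 2)%:E)%E)) => //.
- exact/measurable_EFinP.
- move=> x _ /=; rewrite lee_fin [leRHS]ger0_norm ?addr_ge0 ?sqr_ge0//.
  rewrite -[g x ^+ 2]real_normK ?num_real//.
  have := sqr_ge0 (`|g x| - 1); rewrite sqrrB1; have := normr_ge0 (g x).
  by have := sqr_ge0 (`|g x|); lra.
- apply: integrableD => //.
    apply: (measurable_bounded_integrable (f := cst 1)) => //.
      exact: leb_obox_fin.
    by exists 1; split => // r r1 x _; rewrite /= normr1 ltW.
  apply/integrableP; split; first exact/measurable_EFinP.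
  apply: le_lt_trans g2; rewrite (eq_integral (fun x : Vl => (g x ^+ 2)%:E)).
    apply: ge0_subset_integral => //.
      by apply/measurable_EFinP; exact: measurable_funX.
    by move=> x _; rewrite lee_fin sqr_ge0.
  by move=> x _; rewrite /= ger0_norm ?sqr_ge0.
Qed.

Let box_zero ab : cbox ab `<=` O -> (\int[mu]_(x in obox ab) (g x)%:E = 0)%E.
Proof.
move=> abO; have gi := g_integrable abO.
have mb n : measurable_fun (obox ab : set Vl) (box_bump n ab : Vl -> R).
  apply: (measurable_continuous (@lebesgue_separated R d)).
  by apply: continuous_prod_fun => i; exact: bumpy_bump.
have mgab : measurable_fun (obox ab : set Vl) (g : Vl -> R).
  exact/measurable_EFinP/(measurable_int _ gi).
have mgb n : measurable_fun (obox ab : set Vl) (fun x : Vl => (g x * box_bump n ab x)%:E).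
  by apply/measurable_EFinP; exact: measurable_funM.
have le_g n x : (`|(g x * box_bump n ab x)%:E| <= `|(g x)%:E|)%E.
  rewrite lee_fin normrM ler_piMr// ger0_norm ?box_bump_ge0//.
  exact: box_bump_le1.
have intgb n : mu.-integrable (obox ab) (fun x : Vl => (g x * box_bump n ab x)%:E).
  by apply: (le_integrable _ _ _ gi).
have cvb : {ae mu, forall x : Vl, obox ab x ->
    (fun n => (g x * box_bump n ab x)%:E) @ \oo --> (g x)%:E}.
  apply: aeW => x xab; apply: cvg_EFin; first exact: nearW.
  by rewrite /= -[X in _ --> X]mulr1; apply: cvgMr; exact: box_bump_cvg.
have bdb : {ae mu, forall (x : Vl) n, obox ab x ->
    (`|(g x * box_bump n ab x)%:E| <= `|(g x)%:E|)%E}.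
  by apply: aeW => x n _; exact: le_g.
have [_ _] := dominated_convergence (mobox ab) mgb (measurable_int _ gi)
  cvb (integrable_abse gi) bdb.
rewrite (_ : (fun n => _) = cst 0%E); last first.
  apply/funext => n; rewrite -[LHS]fineK; last exact: integrable_fin_num.
  rewrite -[RHS]/(0%:E); congr _%:E; rewrite -[RHS](g0 (test_function_box_bump n abO)).
  rewrite -[in LHS](setIidr (subO abO)) -/(Rintegral _ _ _) Rintegral_mkcondr.
  apply: eq_Rintegral => x _; rewrite patchE; case: ifPn => //.
  by rewrite notin_setE => /(@box_bump_eq0 _ _ n) ->; rewrite mulr0.
by move/cvg_lim => <-//; rewrite lim_cst.
Qed.

Let boxes : set (set V) := range (@obox R d).

Let meet_box (ab ce : V * V) : V * V :=
  (\row_i Num.max (ab.1 0 i) (ce.1 0 i), \row_i Num.min (ab.2 0 i) (ce.2 0 i)).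

Let obox_setI ab ce : obox ab `&` obox ce = obox (meet_box ab ce).
Proof.
apply/seteqP; split=> [x [/= h1 h2] i|x /= h].
  by rewrite !mxE gt_max lt_min; have /andP[-> ->] := h1 i; have /andP[-> ->] := h2 i.
split=> i; have := h i; rewrite !mxE gt_max lt_min.
  by case/andP => /andP[-> _] /andP[].
by case/andP => /andP[_ ->] /andP[_].
Qed.

Let cbox_meet_box ab ce : cbox (meet_box ab ce) `<=` cbox ce.
Proof.
move=> x h i; have := h i; rewrite !mxE ge_max le_min.
by case/andP => /andP[_ ->] /andP[_].
Qed.

Let boxes_setI : setI_closed boxes.
Proof.
by move=> _ _ [ab _ <-] [ce _ <-]; rewrite obox_setI; exists (meet_box ab ce).
Qed.

(** By the pi-lambda theorem, the integrals over all Borel subsets of the box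
    vanish. *)
Let borel_zero ab : cbox ab `<=` O -> forall A, <<s boxes >> A ->
  measurable (A : set Vl) /\ (\int[mu]_(x in A `&` obox ab) (g x)%:E = 0)%E.
Proof.
move=> abO; have gi := g_integrable abO.
have giI A : measurable (A : set Vl) ->
    mu.-integrable (A `&` obox ab) (EFin \o (g : Vl -> R)).
  by move=> mA; apply: integrableS gi => //; exact: measurableI.
pose H : set (set V) := [set A | measurable (A : set Vl) /\
  (\int[mu]_(x in A `&` obox ab) (g x)%:E = 0)%E].
suff dH : dynkin H.
  have lH : lambda_system setT H by apply/dynkin_lambda_system.
  apply: (lambda_system_subset boxes_setI lH).
    move=> _ [ce _ <-]; split; first exact: mobox.
    by rewrite obox_setI box_zero//; exact: subset_trans (@cbox_meet_box _ _) abO.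
  by move=> A _; exact: subsetT.
split.
- split; first exact: measurableT.
  by rewrite setTI; exact: box_zero.
- move=> A [mA A0]; split; first exact: measurableC.
  have := box_zero abO; rewrite -{1}(setUIDK (obox ab) A) integral_setU.
  + by rewrite setIC A0 add0e setDE setIC.
  + exact: measurableI.
  + exact: measurableD.
  + by rewrite setUIDK; exact: (measurable_int _ gi).
  + by apply/disj_setPS => x [[_ Ax] [_]].
- move=> F tF HF; have mF k : measurable (F k : set Vl) by have [] := HF k.
  split; first exact: bigcupT_measurable.
  rewrite setI_bigcupl integral_bigcup.
  + by rewrite eseries0// => k _ _; have [] := HF k.
  + exact: trivIset_setIr.
  + by move=> k; exact: measurableI.
  + by rewrite -setI_bigcupl; apply: giI; exact: bigcupT_measurable.
Qed.

(** A measurable set is, up to a null set, a countable intersection of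
    countable unions of boxes, so that the integral over the part of the box
    where [g] is positive vanishes. *)
Lemma vanishing_on_box_le0 ab : cbox ab `<=` O ->
  {ae mu, forall x, obox ab x -> g x <= 0}.
Proof.
move=> abO; have gi := g_integrable abO.
pose A : set Vl := obox ab `&` [set x | 0 < g x].
have mA : measurable A.
  have /measurable_EFinP mgab := measurable_int _ gi.
  rewrite /A (_ : [set x | 0 < g x] = g @^-1` `]0, +oo[%classic); last first.
    by apply/seteqP; split=> x; rewrite /= in_itv/= andbT.
  exact: mgab.
have Afin : (mu A < +oo)%E.
  apply: (le_lt_trans _ (leb_obox_fin ab)); apply: le_outer_measure.
  exact: subIsetl.
have Afin' : mu A \is a fin_num by rewrite ge0_fin_numE.
have [U PU] : {U : nat -> set V & forall n, [/\ <<s boxes >> (U n), A `<=` U n &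
    (mu (U n) <= mu A + (n.+1%:R^-1)%:E)%E]}.
  apply: (@choice _ _ (fun n (U : set V) => [/\ <<s boxes >> U, A `<=` U &
    (mu U <= mu A + (n.+1%:R^-1)%:E)%E])) => n.
  have n0 : 0 < n.+1%:R^-1 :> R by rewrite invr_gt0.
  have [_ [E [admE covE] <-] hE] := lb_ereal_inf_adherent n0 Afin'.
  exists (\bigcup_k oapp (@obox R d) set0 (E k)); split=> //.
    have [_ _ sU] := smallest_sigma_algebra setT boxes.
    apply: sU => k; case: (E k) => [ce|]/=.
      by apply: sub_sigma_algebra; exists ce.
    by have [] := smallest_sigma_algebra setT boxes.
  apply: le_trans (ltW hE).
  apply: le_trans (outer_measure_sigma_subadditive _ _) _.
  apply: lee_nneseries => [k _ _|k _]; first exact: outer_measure_ge0.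
  case Ek : (E k) => [ce|]/=; last by rewrite outer_measure0.
  exact/leb_obox_le/(admE _ _ Ek).
pose W := \bigcap_n U n.
have sW : <<s boxes >> W.
  have sig := smallest_sigma_algebra setT boxes.
  have [_ sC sU] := sig.
  rewrite (_ : W = setT `\` \bigcup_n (setT `\` U n)).
    by apply: (sC); apply: sU => n; apply: (sC); case: (PU n).
  by rewrite setTD setC_bigcup; apply: eq_bigcapr => n _; rewrite setTD setCK.
have [mW W0] := borel_zero abO sW.
have AW : A `<=` W `&` obox ab.
  by move=> x Ax; split; [move=> n _; have [_ + _] := PU n; apply|case: Ax].
have mWab : measurable (W `&` obox ab : set Vl) by exact: measurableI.
pose N : set Vl := (W `&` obox ab) `\` A.
have WA : (mu (W `&` obox ab) <= mu A)%E.
  apply/lee_addgt0Pr => e e0; have [n] := ltr_add_invr e0; rewrite add0r => ne.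
  apply: (@le_trans _ _ (mu (U n))).
    by apply: le_outer_measure => x [Wx _]; exact: Wx.
  have [_ _ /le_trans] := PU n; apply; rewrite leeD2l// lee_fin ltW//.
have muN : mu N = 0%E.
  apply/eqP; rewrite eq_le measure_ge0 andbT /N measureD//; last first.
    exact: le_lt_trans WA Afin.
  by rewrite (setIidr AW) leeBlDr// add0e.
have : (\int[mu]_(x in A) (g x)%:E = 0)%E.
  rewrite -W0 [RHS](negligible_integral _ _ _ muN)//; last 2 first.
  - exact: measurableD.
  - by apply: integrableS gi => //; exact: measurableI.
  congr integral; rewrite /N setDD; apply/esym/setIidr; exact: AW.
move=> gA0.
have : (\int[mu]_(x in A) `|(g x)%:E| = 0)%E.
  rewrite -[RHS]gA0; apply: eq_integral => x; rewrite inE => -[_ /= g_gt0].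
  by rewrite ger0_norm// ltW.
have mgA : measurable_fun A (EFin \o (g : Vl -> R)).
  by apply: measurable_funS (measurable_int _ gi) => //; exact: subIsetl.
move=> /(ae_eq_integral_abs mu mA mgA); apply: filterS => x gx abx.
rewrite leNgt; apply/negP => gpos.
by have /eqP := gx (conj abx gpos); rewrite eqe gt_eqF.
Qed.

End vanishing_on_boxes.

(** The previous lemma applies to [g] and to [- g], on a countable family of
    boxes that covers [O]. *)
Lemma test_function_orthogonal_ae0 (g : V -> R) :
  measurable_fun (O : set Vl) (g : Vl -> R) ->
  (\int[mu]_(x in O) (g x ^+ 2)%:E < +oo)%E ->
  (forall phi, test_function O phi -> \int[mu]_(x in O) (g x * phi x) = 0) ->
  {ae mu, forall x, O x -> g x = 0}.
Proof.
move=> mg g2 g0.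
have box0 ab : cbox ab `<=` O -> {ae mu, forall x, obox ab x -> g x = 0}.
  move=> abO; have h1 := vanishing_on_box_le0 mg g2 g0 abO.
  have mNg : measurable_fun (O : set Vl) (- g : Vl -> R) by exact: measurable_funN.
  have Ng2 : (\int[mu]_(x in O) ((- g) x ^+ 2)%:E < +oo)%E.
    by under eq_integral do rewrite fctE sqrrN.
  have Ng0 phi : test_function O phi -> \int[mu]_(x in O) ((- g) x * phi x) = 0.
    move=> tphi; rewrite -oppr0 -(g0 _ tphi) -RintegralN.
    by apply: eq_Rintegral => x _; rewrite fctE mulNr.
  have h2 := vanishing_on_box_le0 mNg Ng2 Ng0 abO.
  apply: (ae_imply2 h1 h2) => x {}h1 {}h2 abx.
  by apply/eqP; rewrite eq_le h1// -oppr_le0 h2.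
pose F n : set Vl := if unpickle n is Some pq then
  (if `[< cbox (rational_box pq) `<=` O >]
   then [set x | ~ (obox (rational_box pq) x -> g x = 0)] else set0) else set0.
have nF : mu.-negligible (\bigcup_n F n).
  apply: negligible_bigcup => n; rewrite /F; case: unpickle => [pq|]; last exact: negligible_set0.
  by case: asboolP => [h|_]; [exact: box0|exact: negligible_set0].
apply: negligibleS nF => x /= /not_implyP[Ox gx].
have [pq [xpq pqO]] := open_rational_box oO Ox.
by exists (pickle pq) => //; rewrite /F pickleK; case: asboolP => // _ h; exact/gx/h.
Qed.

End fundamental_lemma.

(** * Semi-inner products and spaces of square integrable functions *)

Section semi_inner.
Context {R : realType} {V : lmodType R}.

(** Function spaces are handled through representatives: [P] is the set of
    admissible ones, and [B x x = 0] does not imply [x = 0]. *)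
Record semi_inner (P : set V) (B : V -> V -> R) : Prop := SemiInner {
  si_mem : forall a x y, P x -> P y -> P (a *: x + y);
  si_linear : forall a x y z, P x -> P y -> P z ->
    B (a *: x + y) z = a * B x z + B y z;
  si_sym : forall x y, P x -> P y -> B x y = B y x;
  si_ge0 : forall x, P x -> 0 <= B x x }.

Variables (P : set V) (B : V -> V -> R) (si : semi_inner P B).

Lemma si_linear_r a x y z : P x -> P y -> P z ->
  B z (a *: x + y) = a * B z x + B z y.
Proof.
move=> Px Py Pz; rewrite (si_sym si) ?(si_linear si)//; last exact: (si_mem si).
by rewrite (si_sym si Px Pz) (si_sym si Py Pz).
Qed.

Lemma si_mem0 x : P x -> P 0.
Proof. by move=> Px; rewrite -(addNr x) -scaleN1r; exact: (si_mem si). Qed.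

Lemma si_memZ a x : P x -> P (a *: x).
Proof.
by move=> Px; rewrite -[_ *: _]addr0; apply: (si_mem si) => //; exact: si_mem0 Px.
Qed.

Lemma si_memB x y : P x -> P y -> P (x - y).
Proof. by move=> Px Py; rewrite addrC -scaleN1r; exact: (si_mem si). Qed.

Lemma si_memD x y : P x -> P y -> P (x + y).
Proof. by move=> Px Py; rewrite -[x]scale1r; exact: (si_mem si). Qed.

Lemma siDl x y z : P x -> P y -> P z -> B (x + y) z = B x z + B y z.
Proof. by move=> Px Py Pz; rewrite -[x]scale1r (si_linear si)// mul1r scale1r. Qed.

Lemma si0l x y : P x -> P y -> B 0 y = 0.
Proof.
move=> Px Py; have := siDl (si_mem0 Px) (si_mem0 Px) Py; rewrite addr0.
by move=> h; apply: (addrI (B 0 y)); rewrite addr0 -h.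
Qed.

Lemma siZl a x y : P x -> P y -> B (a *: x) y = a * B x y.
Proof.
move=> Px Py; rewrite -[a *: x]addr0 (si_linear si)//; last exact: si_mem0 Px.
by rewrite (si0l Px Py) addr0.
Qed.

Lemma siBl x y z : P x -> P y -> P z -> B (x - y) z = B x z - B y z.
Proof.
move=> Px Py Pz; rewrite addrC -scaleN1r (si_linear si)//; ring.
Qed.

Lemma siBr x y z : P x -> P y -> P z -> B z (x - y) = B z x - B z y.
Proof.
move=> Px Py Pz; rewrite addrC -scaleN1r si_linear_r//; ring.
Qed.

Lemma siZr a x y : P x -> P y -> B y (a *: x) = a * B y x.
Proof.
by move=> Px Py; rewrite (si_sym si) ?siZl ?(si_sym si Px)//; exact: si_memZ.
Qed.

Lemma si_CauchySchwarz x y : P x -> P y -> B x y ^+ 2 <= B x x * B y y.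
Proof.
move=> Px Py.
have q t : 0 <= t ^+ 2 * B x x + 2 * t * B x y + B y y.
  have Pt := si_mem si t Px Py; have := si_ge0 si Pt.
  rewrite (si_linear si)// !si_linear_r// (si_sym si Py Px) => /le_trans; apply.
  by rewrite le_eqVlt; apply/orP; left; apply/eqP; ring.
have xx0 := si_ge0 si Px.
have [xx|xx] := eqVneq (B x x) 0.
  rewrite xx mul0r; have [->|xy] := eqVneq (B x y) 0; first by rewrite expr0n.
  have := q (- (B y y + 1) / (2 * B x y)); rewrite xx.
  rewrite (_ : _ + _ = -1); last by field.
  by rewrite oppr_ge0 ler10.
have {}xx0 : 0 < B x x by rewrite lt_neqAle eq_sym xx.
have := q (- B x y / B x x).
rewrite (_ : _ + _ = (B x x * B y y - B x y ^+ 2) / B x x); last by field.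
by rewrite pmulr_lge0 ?invr_gt0// subr_ge0.
Qed.

Lemma si_CauchySchwarz_sqrt x y : P x -> P y ->
  `|B x y| <= Num.sqrt (B x x) * Num.sqrt (B y y).
Proof.
move=> Px Py; rewrite -sqrtrM ?(si_ge0 si)// -sqrtr_sqr ler_wsqrtr//.
exact: si_CauchySchwarz.
Qed.

Lemma si_arith_geom x y : P x -> P y -> `|B x y| <= (B x x + B y y) / 2.
Proof.
move=> Px Py.
have hp : 0 <= B x x + 2 * B x y + B y y.
  have := si_ge0 si (si_mem si 1 Px Py).
  rewrite (si_linear si)// ?si_linear_r// ?(si_sym si Py Px); last exact: (si_mem si).
  by rewrite !mul1r; lra.
have hm : 0 <= B x x - 2 * B x y + B y y.
  have := si_ge0 si (si_mem si (-1) Px Py).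
  rewrite (si_linear si)// ?si_linear_r// ?(si_sym si Py Px); last exact: (si_mem si).
  by rewrite !mulN1r; lra.
by rewrite ler_norml; apply/andP; split; lra.
Qed.

End semi_inner.

Section mdot_theory.
Context {R : realType} {m n : nat}.
Implicit Types A B C : 'M[R]_(m, n).

Lemma mdotC A B : mdot A B = mdot B A.
Proof. by apply: eq_bigr => i _; apply: eq_bigr => j _; rewrite mulrC. Qed.

Lemma mdot_linear a A B C : mdot (a *: A + B) C = a * mdot A C + mdot B C.
Proof.
rewrite /mdot mulr_sumr -big_split/=; apply: eq_bigr => i _.
rewrite mulr_sumr -big_split/=; apply: eq_bigr => j _.
by rewrite !mxE; ring.
Qed.

Lemma mdot_si : semi_inner setT (@mdot R m n).
Proof.
split=> //; [by move=> a A B C _ _ _; exact: mdot_linear|..].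
  by move=> A B _ _; exact: mdotC.
by move=> A _; exact: mdot_ge0.
Qed.

Lemma mdotxx_eq0 A : mdot A A = 0 -> A = 0.
Proof.
move=> A0; apply/matrixP => i j; rewrite mxE; apply/eqP.
by rewrite -sqrf_eq0 eq_le sqr_ge0 andbT -A0 sqr_entry_le_mdot.
Qed.

Lemma enorm_sqr A : enorm A ^+ 2 = mdot A A.
Proof. by rewrite sqr_sqrtr// mdot_ge0. Qed.

Lemma mdotD_le A B : mdot (A + B) (A + B) <= 2 * mdot A A + 2 * mdot B B.
Proof.
have := mdot_ge0 (A - B).
have si := mdot_si.
rewrite (siBl si)// !(siBr si)// (mdotC B A).
rewrite (siDl si)// ![mdot _ (A + B)]mdotC !(siDl si)// (mdotC B A); lra.
Qed.

Lemma mdotZ a A : mdot (a *: A) (a *: A) = a ^+ 2 * mdot A A.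
Proof. by rewrite (siZl mdot_si)// (siZr mdot_si)// mulrA expr2. Qed.
End mdot_theory.

Section L2_theory.
Context {disp} {T : measurableType disp} {R : realType}.
Variables (mu : {measure set T -> \bar R}) (D : set T).
Hypothesis mD : measurable D.
Context {m n : nat}.
Local Notation X := (L2 mu D m n).
Implicit Types f g h : T -> 'M[R]_(m, n).

Lemma measurable_mdot f g :
  (forall i j, measurable_fun D (fun x => f x i j)) ->
  (forall i j, measurable_fun D (fun x => g x i j)) ->
  measurable_fun D (fun x => mdot (f x) (g x)).
Proof.
move=> mf mg; apply: measurable_sum => i; apply: measurable_sum => j.
exact: measurable_funM.
Qed.

Lemma integrable_mdot f g : sn_mem (s := X) f -> sn_mem (s := X) g ->
  mu.-integrable D (EFin \o (fun x => mdot (f x) (g x))).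
Proof.
move=> [mf f2] [mg g2].
have mff := measurable_mdot mf mf; have mgg := measurable_mdot mg mg.
apply: (le_integrable mD (g := (fun x =>
    (mdot (f x) (f x))%:E + (mdot (g x) (g x))%:E)%E)) => //.
- by apply/measurable_EFinP; exact: measurable_mdot.
- move=> x _ /=; rewrite lee_fin [leRHS]ger0_norm ?addr_ge0 ?mdot_ge0//.
  apply: le_trans (si_arith_geom mdot_si I I) _.
  by have := mdot_ge0 (f x); have := mdot_ge0 (g x); lra.
- apply: integrableD => //; apply/integrableP; split; try exact/measurable_EFinP.
    by under eq_integral do rewrite gee0_abs ?lee_fin ?mdot_ge0//.
  by under eq_integral do rewrite gee0_abs ?lee_fin ?mdot_ge0//.
Qed.

Lemma L2_lin a f g : sn_mem (s := X) f -> sn_mem (s := X) g ->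
  sn_mem (s := X) (a *: f + g).
Proof.
move=> Xf Xg; have [mf f2] := Xf; have [mg g2] := Xg.
have mafg i j : measurable_fun D (fun x => (a *: f + g) x i j).
  rewrite (_ : (fun x => _) = (fun x => a * f x i j + g x i j)); last first.
    by apply/funext => x; rewrite !fctE !mxE.
  by apply: measurable_funD => //; exact: measurable_funM.
split=> //; apply: (@le_lt_trans _ _
  (\int[mu]_(x in D) ((2 * a ^+ 2 * mdot (f x) (f x))%:E + (2 * mdot (g x) (g x))%:E)))%E.
  apply: ge0_le_integral => //.
  - by move=> x _; rewrite lee_fin mdot_ge0.
  - by apply/measurable_EFinP; exact: measurable_mdot.
  - by apply: emeasurable_funD; apply/measurable_EFinP;
      apply: measurable_funM => //; exact: measurable_mdot.
  - move=> x _; rewrite -EFinD lee_fin -mulrA -mdotZ; exact: mdotD_le.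
have p (h : T -> 'M[R]_(m, n)) c : 0 <= c ->
    forall x, D x -> (0 <= (c * mdot (h x) (h x))%:E)%E.
  by move=> c0 x _; rewrite lee_fin mulr_ge0// mdot_ge0.
have q (h : T -> 'M[R]_(m, n)) : forall x, D x -> (0 <= (mdot (h x) (h x))%:E)%E.
  by move=> x _; rewrite lee_fin mdot_ge0.
have mff : measurable_fun D (fun x => (mdot (f x) (f x))%:E).
  by apply/measurable_EFinP; exact: measurable_mdot.
have mgg : measurable_fun D (fun x => (mdot (g x) (g x))%:E).
  by apply/measurable_EFinP; exact: measurable_mdot.
have a0 : 0 <= 2 * a ^+ 2 by rewrite mulr_ge0// sqr_ge0.
rewrite ge0_integralD//; [|exact: p|by under eq_fun do rewrite EFinM;
  exact: measurable_funeM|exact: p|by under eq_fun do rewrite EFinM;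
  exact: measurable_funeM].
under eq_integral do rewrite EFinM.
under [X in (_ + X)%E]eq_integral do rewrite EFinM.
rewrite ge0_integralZl ?lee_fin//; last exact: q.
rewrite ge0_integralZl ?lee_fin//; last exact: q.
by rewrite lte_add_pinfty// lte_mul_pinfty// lee_fin mulr_ge0// sqr_ge0.
Qed.

Lemma L2dot_si : semi_inner (sn_mem (s := X)) (@L2dot _ _ R mu D m n).
Proof.
split; first exact: L2_lin.
- move=> a f g h Xf Xg Xh; rewrite /L2dot.
  under eq_Rintegral do rewrite [(_ + _) _]/(_ + _) [(_ *: _) _]/(_ *: _) mdot_linear.
  rewrite RintegralD//; last 2 first.
  - exact: (integrableZl mD a (integrable_mdot Xf Xh)).
  - exact: integrable_mdot.
  by rewrite RintegralZl//; exact: integrable_mdot.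
- by move=> f g _ _; apply: eq_Rintegral => x _; rewrite mdotC.
- by move=> f _; apply: Rintegral_ge0 => x _; exact: mdot_ge0.
Qed.

Lemma L2_normE f : sn_norm (s := X) f = Num.sqrt (L2dot mu D f f).
Proof. by []. Qed.

Lemma L2_norm_sqr f : sn_norm (s := X) f ^+ 2 = L2dot mu D f f.
Proof.
rewrite L2_normE sqr_sqrtr//; apply: Rintegral_ge0 => x _; exact: mdot_ge0.
Qed.

Lemma L2_CauchySchwarz f g : sn_mem (s := X) f -> sn_mem (s := X) g ->
  `|L2dot mu D f g| <= sn_norm (s := X) f * sn_norm (s := X) g.
Proof. by move=> Xf Xg; exact: si_CauchySchwarz_sqrt L2dot_si _ _ Xf Xg. Qed.

Lemma L2dot_ae f f' g g' :
  sn_mem (s := X) f -> sn_mem (s := X) f' -> sn_mem (s := X) g -> sn_mem (s := X) g' ->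
  {ae mu, forall x, D x -> f x = f' x} -> {ae mu, forall x, D x -> g x = g' x} ->
  L2dot mu D f g = L2dot mu D f' g'.
Proof.
move=> Xf Xf' Xg Xg' ff' gg'; rewrite /L2dot /Rintegral; congr fine.
apply: ae_eq_integral => //.
- exact: measurable_int (integrable_mdot Xf Xg).
- exact: measurable_int (integrable_mdot Xf' Xg').
- by apply: (ae_imply2 ff' gg') => x {}ff' {}gg' Dx; rewrite ff'// gg'.
Qed.

Lemma L2_norm_eq0 f : sn_mem (s := X) f -> sn_norm (s := X) f = 0 ->
  {ae mu, forall x, D x -> f x = 0}.
Proof.
move=> Xf f0; have iff := integrable_mdot Xf Xf.
have fin := integrable_fin_num mD iff.
have ff0 : (\int[mu]_(x in D) (mdot (f x) (f x))%:E = 0)%E.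
  rewrite -[LHS]fineK//; congr _%:E.
  transitivity (sn_norm (s := X) f ^+ 2); last by rewrite f0 expr0n.
  by rewrite L2_norm_sqr.
have : (\int[mu]_(x in D) `|(mdot (f x) (f x))%:E| = 0)%E.
  by rewrite -ff0; apply: eq_integral => x _; rewrite gee0_abs// lee_fin mdot_ge0.
have [h _] := ae_eq_integral_abs mu mD (measurable_int _ iff).
move=> {}/h; apply: filterS => x fx Dx.
by have [/mdotxx_eq0] := fx Dx.
Qed.

End L2_theory.

(** * The spaces of displacements *)

Section null_sets.
Context {R : realType} {d : nat}.
Local Notation V := 'rV[R]_d.
Local Notation Vl := (lebesgue_space R d).
Local Notation mu := (leb R d).
Variables (D K : set V) (K0 : leb R d K = 0%E).

Lemma measurable_null (A : set V) : A `<=` K -> measurable (A : set Vl).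
Proof.
move=> AK; apply: measure_is_complete_caratheodory.
apply/negligibleP.
  apply: le_caratheodory_measurable => X.
  have -> : lebesgue_om R d (X `&` A) = 0%E.
    apply/eqP; rewrite eq_le outer_measure_ge0 andbT -K0.
    by apply: le_outer_measure => x [_ /AK].
  by rewrite add0e; apply: le_outer_measure; exact: subIsetl.
apply/eqP; rewrite eq_le measure_ge0 andbT -K0; exact: le_outer_measure.
Qed.

Lemma measurable_fun_null (f : V -> R) : measurable (D : set Vl) ->
  measurable_fun (D `\` K : set Vl) (f : Vl -> R) ->
  measurable_fun (D : set Vl) (f : Vl -> R).
Proof.
move=> mD mf _ Y mY.
have mK : measurable (K : set Vl) by exact: measurable_null.
have mDK : measurable (D `\` K : set Vl) by exact: measurableD.
rewrite (_ : D `&` f @^-1` Y =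
    ((D `\` K) `&` f @^-1` Y) `|` (D `&` K `&` f @^-1` Y)).
  apply: measurableU; first exact: mf.
  by apply: measurable_null => x [[]].
apply/seteqP; split=> [x [Dx Yx]|x [[[Dx _] Yx]|[[Dx _] Yx]]]//.
by have [Kx|Kx] := pselect (K x); [right|left].
Qed.

Lemma ae_null (P : V -> Prop) : {ae mu, forall x, (D `\` K) x -> P x} ->
  {ae mu, forall x, D x -> P x}.
Proof.
have nK : {ae mu, forall x, ~ K x}.
  exists K; split=> //; first exact: measurable_null.
  by move=> x /= /contrapT.
by move=> h; apply: (ae_imply2 h nK) => x + Kx Dx; apply.
Qed.

(** Subsets of a null set are measurable, the measure being complete. *)
Lemma L2_null m n (f : V -> 'M[R]_(m, n)) : measurable (D : set Vl) ->
  sn_mem (s := L2 mu (D `\` K) m n) f -> sn_mem (s := L2 mu D m n) f.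
Proof.
move=> mD [mf f2].
have mK : measurable (K : set Vl) by exact: measurable_null.
have {}mf i j : measurable_fun (D : set Vl) (fun x : Vl => f x i j).
  exact: (measurable_fun_null mD (mf i j)).
split=> //; rewrite (@ge0_negligible_integral _ _ _ _ _ (K : set Vl))//.
  by apply/measurable_EFinP; exact: measurable_mdot.
by move=> x _; rewrite lee_fin mdot_ge0.
Qed.

End null_sets.

Section test_function_theory.
Context {R : realType} {d : nat}.
Local Notation V := 'rV[R]_d.

Lemma bounded_of_compact_support (psi : V -> R) (K : set V) : continuous psi ->
  compact K -> (forall x, ~ K x -> psi x = 0) -> exists M, forall x, `|psi x| <= M.
Proof.
move=> cpsi cK psi0.
have /compact_bounded[M [_ hM]] : compact (psi @` K).
  by apply: continuous_compact => //; exact: continuous_subspaceT.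
exists (`|M| + 1) => x; have [Kx|Kx] := pselect (K x).
  by apply: hM; [rewrite (le_lt_trans (ler_norm _))// ltrDl|exists x].
by rewrite psi0// normr0 addr_ge0.
Qed.

Lemma test_function_bounded (O : set V) phi : test_function O phi ->
  (exists M, forall x, `|phi x| <= M) /\
  forall j, exists M, forall x, `|'D_(ebase j) phi x| <= M.
Proof.
move=> [sphi [K [cK KO phi0]]]; split.
  by apply: bounded_of_compact_support phi0 => //; have [] := sphi [::].
move=> j; apply: (@bounded_of_compact_support _ K) => //.
  by have [] := sphi [:: j].
move=> x Kx; rewrite -[RHS](derive_cst (0 : R) x (ebase j)).
apply: near_eq_derive.
have : nbhs x (~` K).
  apply: open_nbhs_nbhs; split => //; apply: closed_openC.
  exact: compact_closed.
by apply: filterS => y; exact: phi0.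
Qed.

Lemma test_function_measurable (O D : set V) phi : test_function O phi ->
  measurable_fun (D : set (lebesgue_space R d)) (phi : lebesgue_space R d -> R) /\
  forall j, measurable_fun (D : set (lebesgue_space R d))
    ('D_(ebase j) phi : lebesgue_space R d -> R).
Proof.
move=> [sphi _]; split=> [|j]; apply: (measurable_continuous (@lebesgue_separated R d)).
  by have [] := sphi [::].
by have [] := sphi [:: j].
Qed.

Lemma iter_partial_linear s a (phi psi : V -> R) : smooth phi -> smooth psi ->
  iter_partial s (fun x => a * phi x + psi x) =
  (fun x => a * iter_partial s phi x + iter_partial s psi x).
Proof.
move=> sphi spsi; elim: s => [//|j s IH]; apply/funext => x /=; rewrite IH.
have [_ /(_ x j) d1] := sphi s; have [_ /(_ x j) d2] := spsi s.
have := is_deriveD (is_deriveZ a (derivableP d1)) (derivableP d2).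
by move=> h; rewrite -[LHS]/('D_(ebase j) (a \*: iter_partial s phi + iter_partial s psi) x) derive_val.
Qed.

Lemma smooth_linear a (phi psi : V -> R) : smooth phi -> smooth psi ->
  smooth (fun x => a * phi x + psi x).
Proof.
move=> sphi spsi s; rewrite iter_partial_linear//.
have [c1 d1] := sphi s; have [c2 d2] := spsi s; split.
  by move=> x; exact: cvgD (cvgM (cvg_cst a) (c1 x)) (c2 x).
move=> x j; apply: (derivableD (f := a \*: iter_partial s phi)) => //.
exact: derivableZ.
Qed.

End test_function_theory.

Section displacements.
Context {R : realType} {d : nat}.
Local Notation V := 'rV[R]_d.
Local Notation Vl := (lebesgue_space R d).
Local Notation mu := (leb R d).
Variables (Omega K : set V).
Hypotheses (bOmega : bounded_set Omega) (oOmega : open Omega) (cK : closed K)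
  (K0 : leb R d K = 0%E).
Local Notation O := (Omega `\` K).

Lemma open_cracked : open O.
Proof. by rewrite setDE; apply: openI => //; exact: closed_openC. Qed.

Lemma measurable_Omega : measurable (Omega : set Vl).
Proof. exact: (measurable_open (@lebesgue_separated R d)). Qed.

Lemma measurable_cracked : measurable (O : set Vl).
Proof. exact: (measurable_open (@lebesgue_separated R d) open_cracked). Qed.

Let mO := measurable_cracked.
Let mOmega := measurable_Omega.

Let O_fin : (mu O < +oo)%E.
Proof.
apply: le_lt_trans (leb_bounded bOmega); apply: le_outer_measure; exact: subDsetl.
Qed.

(** [|h x * phi x| <= M ^ 2 + h x ^ 2], and [O] has finite measure. *)
Lemma integrable_mul_bounded (h phi : V -> R) M :
  measurable_fun (O : set Vl) (h : Vl -> R) ->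
  (\int[mu]_(x in O) (h x ^+ 2)%:E < +oo)%E ->
  measurable_fun (O : set Vl) (phi : Vl -> R) -> (forall x, `|phi x| <= M) ->
  mu.-integrable O (EFin \o (fun x : Vl => h x * phi x)).
Proof.
move=> mh h2 mphi phiM.
have M0 : 0 <= M by exact: le_trans (phiM 0).
apply: (le_integrable mO
    (g := (fun x : Vl => (cst (M ^+ 2) x)%:E + (h x ^+ 2)%:E)%E)) => //.
- by apply/measurable_EFinP; exact: measurable_funM.
- move=> x _ /=; rewrite lee_fin [leRHS]ger0_norm ?addr_ge0 ?sqr_ge0//.
  rewrite normrM (@le_trans _ _ (`|h x| * M))//; first by rewrite ler_wpM2l.
  rewrite -[h x ^+ 2]real_normK ?num_real//.
  have := sqr_ge0 (`|h x| - M); rewrite sqrrB.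
  by have := sqr_ge0 (`|h x|); have := sqr_ge0 M; lra.
- apply: integrableD => //.
    apply: (measurable_bounded_integrable (f := cst (M ^+ 2))) => //.
    exists (M ^+ 2); split; first exact: num_real.
    by move=> r r1 x _; rewrite /= ger0_norm ?sqr_ge0// ltW.
  apply/integrableP; split.
    by apply/measurable_EFinP; exact: measurable_funX.
  by under eq_integral do rewrite gee0_abs ?lee_fin ?sqr_ge0//.
Qed.

Lemma L2_entry m n (f : V -> 'M[R]_(m, n)) i j :
  sn_mem (s := L2 mu O m n) f ->
  measurable_fun (O : set Vl) (fun x : Vl => f x i j) /\
  (\int[mu]_(x in O) (f x i j ^+ 2)%:E < +oo)%E.
Proof.
move=> [mf f2]; split; first exact: mf.
apply: (le_lt_trans _ f2); apply: ge0_le_integral.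
- exact: mO.
- by move=> x _; rewrite lee_fin sqr_ge0.
- by apply/measurable_EFinP; apply: measurable_funX; exact: mf.
- by apply/measurable_EFinP; exact: measurable_mdot.
- by move=> x _; rewrite lee_fin sqr_entry_le_mdot.
Qed.

Lemma L2_restrict m n (f : V -> 'M[R]_(m, n)) :
  sn_mem (s := L2 mu Omega m n) f -> sn_mem (s := L2 mu O m n) f.
Proof.
move=> [mf f2]; split=> [i j|].
  exact: (measurable_funS mOmega (@subDsetl _ _ _) (mf i j)).
apply: (le_lt_trans _ f2).
apply: ge0_subset_integral; [exact: mO|exact: mOmega| | |exact: subDsetl].
  by apply/measurable_EFinP; exact: measurable_mdot.
by move=> x _; rewrite lee_fin mdot_ge0.
Qed.

(** Two weak gradients of the same displacement agree, by the fundamental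
    lemma applied to the entries of their difference. *)
Lemma weak_gradient_unique u G G' : is_weak_gradient O u G ->
  is_weak_gradient O u G' -> {ae mu, forall x, Omega x -> G x = G' x}.
Proof.
move=> [G2 wG] [G'2 wG']; apply: (ae_null K0).
have entry i j : {ae mu, forall x, O x -> G x i j = G' x i j}.
  have GG' := si_memB (L2dot_si mu mO) G2 G'2.
  have [mg g2] := L2_entry i j GG'.
  have := @test_function_orthogonal_ae0 _ _ _ open_cracked _ mg g2.
  have hh : forall phi, test_function O phi ->
      \int[mu]_(x in O) ((G - G') x i j * phi x) = 0.
    move=> phi tphi; have [[M phiM] _] := test_function_bounded tphi.
    have [mphi _] := test_function_measurable O tphi.
    have [mG G2'] := L2_entry i j G2; have [mG' G'2'] := L2_entry i j G'2.
    transitivity (\int[mu]_(x in O) (G x i j * phi x - G' x i j * phi x)).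
      by apply: eq_Rintegral => x _; rewrite !fctE !mxE mulrBl.
    rewrite RintegralB//; [|exact: integrable_mul_bounded phiM|exact: integrable_mul_bounded phiM].
    by apply/eqP; rewrite subr_eq0 -eqr_opp -wG// wG'.
  move=> /(_ hh) h; apply: (ae_imply h) => x /[apply]; rewrite !fctE !mxE => /eqP.
  by rewrite subr_eq0 => /eqP.
have all_entries : {ae mu, forall x, forall ij : 'I_d * 'I_d,
    O x -> G x ij.1 ij.2 = G' x ij.1 ij.2}.
  by apply: ae_forall_fin => -[i j]; exact: entry.
apply: (ae_imply all_entries) => x h Ox; apply/matrixP => i j.
exact: (h (i, j) Ox).
Qed.

Lemma weak_gradientP u : (exists G, is_weak_gradient O u G) ->
  is_weak_gradient O u (weak_gradient O u).
Proof. by move=> [G wG]; exact: (xgetPex (fun=> 0) (ex_intro _ G wG)). Qed.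

Lemma is_weak_gradient_linear a u w G G' :
  sn_mem (s := Hspace Omega 1 d) u -> sn_mem (s := Hspace Omega 1 d) w ->
  is_weak_gradient O u G -> is_weak_gradient O w G' ->
  is_weak_gradient O (a *: u + w) (a *: G + G').
Proof.
move=> Hu Hw [G2 wG] [G'2 wG']; split; first exact: L2_lin.
move=> phi tphi i j; have [[M phiM] /(_ j)[M' dphiM]] := test_function_bounded tphi.
have [mphi /(_ j) mdphi] := test_function_measurable O tphi.
have int_entry (h : V -> 'M[R]_d) (h2 : sn_mem (s := L2 mu O d d) h) :
    mu.-integrable O (EFin \o (fun x : Vl => h x i j * phi x)).
  by have [mh hh] := L2_entry i j h2; exact: integrable_mul_bounded phiM.
have int_u (h : V -> V) (h2 : sn_mem (s := Hspace Omega 1 d) h) :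
    mu.-integrable O (EFin \o (fun x : Vl => h x 0 i * 'D_(ebase j) phi x)).
  have [mh hh] := L2_entry 0 i (L2_restrict h2).
  exact: integrable_mul_bounded dphiM.
transitivity (\int[mu]_(x in O) (a * (u x 0 i * 'D_(ebase j) phi x) +
    w x 0 i * 'D_(ebase j) phi x)).
  by apply: eq_Rintegral => x _; rewrite !fctE !mxE; ring.
rewrite RintegralD//; [|exact: (integrableZl mO a (int_u _ Hu))|exact: int_u].
rewrite RintegralZl//; last exact: int_u.
transitivity (- \int[mu]_(x in O) (a * (G x i j * phi x) + G' x i j * phi x));
  last by congr (- _); apply: eq_Rintegral => x _; rewrite !fctE !mxE; ring.
rewrite RintegralD//; [|exact: (integrableZl mO a (int_entry _ G2))|exact: int_entry].
rewrite RintegralZl//; last exact: int_entry.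
by rewrite wG// wG'//; ring.
Qed.

Local Notation U := (Uspace Omega K).
Local Notation Hd := (Hspace Omega d d).
Local Notation e := (strain O).

Lemma U_linear a u w : sn_mem (s := U) u -> sn_mem (s := U) w ->
  sn_mem (s := U) (a *: u + w).
Proof.
move=> [Hu [G wG]] [Hw [G' wG']]; split; first exact: L2_lin.
by exists (a *: G + G'); exact: is_weak_gradient_linear.
Qed.

Lemma weak_gradient_linear_ae a u w : sn_mem (s := U) u -> sn_mem (s := U) w ->
  {ae mu, forall x, Omega x -> weak_gradient O (a *: u + w) x =
     a *: weak_gradient O u x + weak_gradient O w x}.
Proof.
move=> Uu Uw; have [Hu gu] := Uu; have [Hw gw] := Uw.
apply: (weak_gradient_unique (u := a *: u + w)).
  by apply: weak_gradientP; case: (U_linear a Uu Uw).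
exact: (is_weak_gradient_linear a Hu Hw (weak_gradientP gu) (weak_gradientP gw)).
Qed.

Lemma strain_sym u x : symmx (e u x).
Proof. by rewrite /symmx /strain linearZ/= linearD/= trmxK addrC. Qed.

Lemma strain_mem u : sn_mem (s := U) u -> sn_mem (s := Hd) (e u).
Proof.
move=> [_ gu]; have [wG2 _] := weak_gradientP gu; apply: (L2_null K0 mOmega).
have [mG G2] := wG2.
have tG2 : sn_mem (s := L2 mu O d d) (fun x => (weak_gradient O u x)^T).
  split=> [i j|].
    by under eq_fun do rewrite mxE; exact: mG.
  apply: le_lt_trans G2; rewrite le_eqVlt; apply/orP; left; apply/eqP.
  apply: eq_integral => x _; congr _%:E; rewrite /mdot exchange_big/=.
  by apply: eq_bigr => i _; apply: eq_bigr => j _; rewrite !mxE.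
have := L2_lin mO 1 wG2 tG2 => h.
have := si_memZ (L2dot_si mu mO) 2^-1 h.
rewrite (_ : _ *: _ = e u)//.
by apply/funext => x; rewrite /strain !fctE scale1r.
Qed.

Lemma strain_linear_ae a u w : sn_mem (s := U) u -> sn_mem (s := U) w ->
  {ae mu, forall x, Omega x -> e (a *: u + w) x = (a *: e u + e w) x}.
Proof.
move=> Uu Uw; apply: (ae_imply (weak_gradient_linear_ae a Uu Uw)) => x h Ox.
rewrite /strain (h Ox); apply/matrixP => i j; rewrite !fctE !mxE; ring.
Qed.

(** The strain is linear up to null sets, so that forms on strains induce
    forms on displacements. *)
Lemma strain_si (B : (V -> 'M[R]_d) -> (V -> 'M[R]_d) -> R) :
  semi_inner (fun E => sn_mem (s := Hd) E /\ forall x, symmx (E x)) B ->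
  (forall E E' F, sn_mem (s := Hd) E -> sn_mem (s := Hd) E' -> sn_mem (s := Hd) F ->
     (forall x, symmx (E x)) -> (forall x, symmx (E' x)) -> (forall x, symmx (F x)) ->
     {ae mu, forall x, Omega x -> E x = E' x} -> B E F = B E' F) ->
  semi_inner (sn_mem (s := U)) (fun u w => B (e u) (e w)).
Proof.
move=> si ext.
have es u : sn_mem (s := U) u -> sn_mem (s := Hd) (e u) /\ forall x, symmx (e u x).
  by move=> Uu; split; [exact: strain_mem|exact: strain_sym].
split; first by move=> a x y; exact: U_linear.
- move=> a x y z Ux Uy Uz; have [hx sx] := es _ Ux; have [hy sy] := es _ Uy.
  have [hz sz] := es _ Uz; have [hxy sxy] := es _ (U_linear a Ux Uy).
  have [haxy saxy] := si_mem si a (es _ Ux) (es _ Uy).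
  transitivity (B (a *: e x + e y) (e z)).
    by apply: ext; [| | |exact: strain_sym| | |exact: strain_linear_ae].
  exact: (si_linear si a (es _ Ux) (es _ Uy) (es _ Uz)).
- by move=> x y Ux Uy; apply: (si_sym si); exact: es.
- by move=> x Ux; apply: (si_ge0 si); exact: es.
Qed.

End displacements.

Section traces.
Context {R : realType} {d : nat}.
Local Notation V := 'rV[R]_d.

(** [|a X + Y|^2 <= 2 a^2 |X|^2 + 2 |Y|^2], integrated on the intersection of
    the two domains. *)
Lemma cvg_integral_linear {disp} {T : measurableType disp}
    (mu : {measure set T -> \bar R}) (D D1 D2 : set T) {m n} a
    (X Y Z : (T -> 'M[R]_(m, n))^nat) :
  measurable D -> measurable D1 -> measurable D2 -> D `<=` D1 -> D `<=` D2 ->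
  (forall k i j, measurable_fun D1 (fun x => X k x i j)) ->
  (forall k i j, measurable_fun D2 (fun x => Y k x i j)) ->
  (forall k i j, measurable_fun D (fun x => Z k x i j)) ->
  (forall k, {ae mu, forall x, D x -> Z k x = a *: X k x + Y k x}) ->
  (fun k => (\int[mu]_(x in D1) (enorm (X k x) ^+ 2)%:E)%E) @ \oo --> (0 : \bar R) ->
  (fun k => (\int[mu]_(x in D2) (enorm (Y k x) ^+ 2)%:E)%E) @ \oo --> (0 : \bar R) ->
  (fun k => (\int[mu]_(x in D) (enorm (Z k x) ^+ 2)%:E)%E) @ \oo --> (0 : \bar R).
Proof.
move=> mD mD1 mD2 DD1 DD2 mX mY mZ ZXY X0 Y0.
have mm (E : set T) (f : T -> 'M[R]_(m, n)) :
    (forall i j, measurable_fun E (fun x => f x i j)) ->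
    measurable_fun E (fun x => (mdot (f x) (f x))%:E).
  by move=> mf; apply/measurable_EFinP; exact: measurable_mdot.
have pos (E : set T) (f : T -> 'M[R]_(m, n)) :
    forall x, E x -> (0 <= (mdot (f x) (f x))%:E)%E.
  by move=> x _; rewrite lee_fin mdot_ge0.
pose b : R := 2 * a ^+ 2.
have b0 : 0 <= b by rewrite mulr_ge0// sqr_ge0.
have lim0 : (fun k => b%:E * (\int[mu]_(x in D1) (enorm (X k x) ^+ 2)%:E) +
     2%:E * (\int[mu]_(x in D2) (enorm (Y k x) ^+ 2)%:E))%E @ \oo --> (0 : \bar R).
  rewrite [X in _ --> X](_ : _ = b%:E * 0 + 2%:E * 0)%E; last by rewrite !mule0 adde0.
  by apply: cvgeD; [rewrite !mule0|exact: cvgeZl|exact: cvgeZl].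
apply: squeeze_cvge lim0; last exact: cvg_cst.
apply: nearW => k; apply/andP; split.
  by apply: integral_ge0 => x _; rewrite lee_fin sqr_ge0.
under eq_integral do rewrite enorm_sqr.
under [in leRHS]eq_integral do rewrite enorm_sqr.
under [X in (_ <= _ + _ * X)%E]eq_integral do rewrite enorm_sqr.
have XD : forall i j, measurable_fun D (fun x => X k x i j).
  by move=> i j; exact: measurable_funS (mX k i j).
have YD : forall i j, measurable_fun D (fun x => Y k x i j).
  by move=> i j; exact: measurable_funS (mY k i j).
apply: (@le_trans _ _ (\int[mu]_(x in D)
    (b%:E * (mdot (X k x) (X k x))%:E + 2%:E * (mdot (Y k x) (Y k x))%:E))%E).
  apply: ae_ge0_le_integral => //.
  - exact: pos.
  - exact: mm.
  - by move=> x _; rewrite -!EFinM -EFinD lee_fin addr_ge0// mulr_ge0 ?mdot_ge0.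
  - by apply: emeasurable_funD; apply: measurable_funeM; exact: mm.
  - apply: (ae_imply (ZXY k)) => x h Dx; rewrite h//.
    by rewrite -!EFinM -EFinD lee_fin /b -mulrA -mdotZ mdotD_le.
rewrite ge0_integralD//; last 4 first.
- by move=> x _; rewrite -EFinM lee_fin mulr_ge0 ?mdot_ge0.
- by apply: measurable_funeM; exact: mm.
- by move=> x _; rewrite -EFinM lee_fin mulr_ge0 ?mdot_ge0.
- by apply: measurable_funeM; exact: mm.
rewrite ge0_integralZl ?lee_fin//; [|exact: mm|exact: pos].
rewrite ge0_integralZl ?lee_fin//; [|exact: mm|exact: pos].
apply: leeD; apply: lee_wpmul2l; rewrite ?lee_fin//.
- by apply: ge0_subset_integral => //; [exact: mm|exact: pos].
- by apply: ge0_subset_integral => //; [exact: mm|exact: pos].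
Qed.

Lemma jacobian_linear a (w1 w2 : V -> V) y :
  (forall i, smooth (fun y => w1 y 0 i)) -> (forall i, smooth (fun y => w2 y 0 i)) ->
  jacobian_matrix (a *: w1 + w2) y = a *: jacobian_matrix w1 y + jacobian_matrix w2 y.
Proof.
move=> s1 s2; apply/matrixP => i j; rewrite !mxE.
have [_ /(_ y j) d1] := s1 i [::]; have [_ /(_ y j) d2] := s2 i [::].
have h := is_deriveD (is_deriveZ a (derivableP d1)) (derivableP d2).
rewrite (_ : (fun y => _) = a \*: (fun y => w1 y 0 i) + (fun y => w2 y 0 i)).
  by rewrite derive_val.
by apply/funext => z; rewrite !fctE !mxE.
Qed.

Lemma measurable_jacobian (D : set V) (w : V -> V) i j :
  (forall i, smooth (fun y => w y 0 i)) ->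
  measurable_fun (D : set (lebesgue_space R d))
    (fun x : lebesgue_space R d => jacobian_matrix w x i j).
Proof.
move=> sw; apply: (measurable_continuous (@lebesgue_separated R d)).
under eq_fun do rewrite mxE.
by have [] := sw i [:: j].
Qed.

Local Notation Vh := (caratheodory_type (hausdorff_om R d d.-1)).
Variables (Omega K : set V).
Hypotheses (bOmega : bounded_set Omega) (oOmega : open Omega) (cK : closed K)
  (K0 : leb R d K = 0%E).
Local Notation O := (Omega `\` K).
Local Notation U := (Uspace Omega K).

Let mW W : open W -> measurable (W `&` Omega : set (lebesgue_space R d)).
Proof.
move=> oW; apply: (measurable_open (@lebesgue_separated R d)); exact: openI.
Qed.

(** The two approximating sequences are combined in the intersection of the two
    neighborhoods. *)
Lemma is_trace_linear a u w g g' : sn_mem (s := U) u -> sn_mem (s := U) w ->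
  is_trace Omega K u g -> is_trace Omega K w g' ->
  is_trace Omega K (a *: u + w) (a *: g + g').
Proof.
move=> Uu Uw [mg tu] [mg' tw].
have mgg i : measurable_fun (bd Omega : set (Vh))
    (fun x : Vh => (a *: g + g') x 0 i).
  rewrite (_ : (fun x => _) = (fun x => a * g x 0 i + g' x 0 i)); last first.
    by apply/funext => x; rewrite !fctE !mxE.
  have ma : measurable_fun (bd Omega : set Vh) (fun x : Vh => a * g x 0 i).
    exact: (measurable_funM (measurable_cst a) (mg i)).
  exact: (measurable_funD ma (mg' i)).
split; first exact: mgg.
move=> x bx Kx.
have [W1 [w1 [[oW1 W1x W1K] s1 L1 J1 T1]]] := tu x bx Kx.
have [W2 [w2 [[oW2 W2x W2K] s2 L2 J2 T2]]] := tw x bx Kx.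
have oW : open (W1 `&` W2) by exact: openI.
exists (W1 `&` W2), (fun n => a *: w1 n + w2 n); split.
- split; [exact: oW|by split|]; rewrite -subset0 -W1K => y [[W1y _] Ky].
  by split.
- move=> n i; rewrite (_ : (fun y => _) = (fun y => a * w1 n y 0 i + w2 n y 0 i)).
    exact: smooth_linear.
  by apply/funext => y; rewrite !fctE !mxE.
- have mwu (w' : (V -> V)^nat) (u' : V -> V) (s' : forall n i, smooth (fun y => w' n y 0 i))
      (Uu' : sn_mem (s := U) u') (W : set V) (oW' : open W) k (i : 'I_1) j :
      measurable_fun (W `&` Omega : set (lebesgue_space R d))
        (fun y : lebesgue_space R d => (w' k y - u' y) i j).
    rewrite ord1; under eq_fun do rewrite !mxE.
    apply: measurable_funB.
      apply: (measurable_continuous (@lebesgue_separated R d)).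
      by have [] := s' k j [::].
    have [[mu' _] _] := Uu'.
    apply: measurable_funS (mu' 0 j); [exact: measurable_Omega|exact: subIsetr].
  apply: (cvg_integral_linear (a := a) _ _ _ _ _ _ _ _ _ L1 L2).
  + exact: mW.
  + exact: mW.
  + exact: mW.
  + by move=> y [[]].
  + by move=> y [[]].
  + by move=> k i j; exact: (mwu w1 u s1 Uu W1 oW1).
  + by move=> k i j; exact: (mwu w2 w s2 Uw W2 oW2).
  + move=> k i j; apply: (mwu (fun n => a *: w1 n + w2 n) (a *: u + w)).
    * move=> n {}i; rewrite (_ : (fun y => _) = (fun y => a * w1 n y 0 i + w2 n y 0 i)).
        exact: smooth_linear.
      by apply/funext => y; rewrite !fctE !mxE.
    * exact: U_linear.
    * exact: oW.
  + move=> k; apply: aeW => y _; rewrite !fctE.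
    by apply/matrixP => i j; rewrite !mxE; ring.
- have mwg (w' : (V -> V)^nat) (u' : V -> V) (s' : forall n i, smooth (fun y => w' n y 0 i))
      (Uu' : sn_mem (s := U) u') (W : set V) (oW' : open W) (WK : W `&` K = set0) k i j :
      measurable_fun (W `&` Omega : set (lebesgue_space R d))
        (fun y : lebesgue_space R d => (jacobian_matrix (w' k) y - weak_gradient O u' y) i j).
    rewrite (_ : (fun y => _) = (fun y => jacobian_matrix (w' k) y i j - weak_gradient O u' y i j)); last first.
      by apply/funext => y; rewrite !mxE.
    apply: measurable_funB; first exact: measurable_jacobian.
    have [_ gu'] := Uu'; have [[mG _] _] := weak_gradientP gu'.
    apply: measurable_funS (mG i j); first exact: measurable_cracked.
    move=> y [Wy Oy]; split=> // Ky; suff : (W `&` K) y by rewrite WK.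
    by split.
  have WK : W1 `&` W2 `&` K = set0.
    by rewrite -subset0 -W1K => y [[W1y _] Ky].
  have sl n i : smooth (fun y => (a *: w1 n + w2 n) y 0 i).
    rewrite (_ : (fun y => _) = (fun y => a * w1 n y 0 i + w2 n y 0 i)).
      exact: smooth_linear.
    by apply/funext => y; rewrite !fctE !mxE.
  apply: (cvg_integral_linear (a := a) _ _ _ _ _ _ _ _ _ J1 J2).
  + exact: mW.
  + exact: mW.
  + exact: mW.
  + by move=> y [[]].
  + by move=> y [[]].
  + by move=> k i j; exact: (mwg w1 u s1 Uu W1 oW1 W1K).
  + by move=> k i j; exact: (mwg w2 w s2 Uw W2 oW2 W2K).
  + move=> k i j; apply: (mwg (fun n => a *: w1 n + w2 n) (a *: u + w)).
    * exact: sl.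
    * exact: U_linear.
    * exact: oW.
    * exact: WK.
  + move=> k.
    apply: (ae_imply (weak_gradient_linear_ae bOmega oOmega cK K0 a Uu Uw)) => y h [_ Oy].
    rewrite (h Oy) (jacobian_linear a y (s1 k) (s2 k)).
    by apply/matrixP => i j; rewrite !mxE; ring.
- have mb W : open W -> measurable (W `&` bd Omega : set (Vh)).
    move=> oW'; apply: measurableI.
      exact: (measurable_open (@hausdorff_separated R d d.-1)).
    exact: (measurable_bd (@hausdorff_separated R d d.-1)).
  have mwg (w' : (V -> V)^nat) (g0 : V -> V) (s' : forall n i, smooth (fun y => w' n y 0 i))
      (mg0 : forall i, measurable_fun (bd Omega : set (Vh))
        (fun x : Vh => g0 x 0 i))
      (W : set V) (oW' : open W) k (i : 'I_1) j :
      measurable_fun (W `&` bd Omega : set (Vh))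
        (fun y : Vh => (w' k y - g0 y) i j).
    rewrite ord1; under eq_fun do rewrite !mxE.
    apply: measurable_funB.
      apply: (measurable_continuous (@hausdorff_separated R d d.-1)).
      by have [] := s' k j [::].
    apply: measurable_funS (mg0 j); last exact: subIsetr.
    exact: (measurable_bd (@hausdorff_separated R d d.-1)).
  have sl n i : smooth (fun y => (a *: w1 n + w2 n) y 0 i).
    rewrite (_ : (fun y => _) = (fun y => a * w1 n y 0 i + w2 n y 0 i)).
      exact: smooth_linear.
    by apply/funext => y; rewrite !fctE !mxE.
  apply: (cvg_integral_linear (a := a) _ _ _ _ _ _ _ _ _ T1 T2).
  + exact: mb.
  + exact: mb.
  + exact: mb.
  + by move=> y [[]].
  + by move=> y [[]].
  + by move=> k i j; exact: (mwg w1 g s1 mg W1 oW1).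
  + by move=> k i j; exact: (mwg w2 g' s2 mg' W2 oW2).
  + by move=> k i j; exact: (mwg (fun n => a *: w1 n + w2 n) (a *: g + g') sl mgg _ oW).
  + move=> k; apply: aeW => y _; rewrite !fctE.
    by apply/matrixP => i j; rewrite !mxE; ring.
Qed.

Lemma UD_linear S a u w : sn_mem (s := UDspace Omega K S) u ->
  sn_mem (s := UDspace Omega K S) w -> sn_mem (s := UDspace Omega K S) (a *: u + w).
Proof.
move=> [Uu [g tg g0]] [Uw [g' tg' g'0]]; split; first exact: U_linear.
exists (a *: g + g'); first exact: is_trace_linear.
apply: (ae_imply2 g0 g'0) => x {}g0 {}g'0 Sx.
by rewrite !fctE g0// g'0// scaler0 addr0.
Qed.

End traces.

(** * Bounded fields of symmetric operators *)

Section operator_fields.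
Context {R : realType} {d : nat}.
Local Notation V := 'rV[R]_d.
Local Notation Vl := (lebesgue_space R d).
Local Notation mu := (leb R d).
Variables (Omega : set V) (oOmega : open Omega).
Local Notation B := (Bspace Omega).
Local Notation Hd := (Hspace Omega d d).

Let mOmega : measurable (Omega : set Vl).
Proof. exact: (measurable_open (@lebesgue_separated R d)). Qed.

(** Symmetry is required at every point, as it holds for strains: the operators
    are only constrained on symmetric matrices. *)
Definition symmetric_field (E : V -> 'M[R]_d) :=
  sn_mem (s := Hd) E /\ forall x, symmx (E x).

Lemma symmx_linear a (xi eta : 'M[R]_d) : symmx xi -> symmx eta ->
  symmx (a *: xi + eta).
Proof. by move=> sxi seta; rewrite /symmx linearP/= sxi seta. Qed.

Lemma symmx0 : symmx (0 : 'M[R]_d).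
Proof. by rewrite /symmx linear0. Qed.

Lemma symmetric_field_linear a E E' : symmetric_field E -> symmetric_field E' ->
  symmetric_field (a *: E + E').
Proof.
move=> [hE sE] [hE' sE']; split; first exact: (L2_lin mOmega).
by move=> x; exact: symmx_linear.
Qed.

Definition pointwise_linear (A : 'M[R]_d -> 'M[R]_d) :=
  [/\ (forall xi, symmx xi -> symmx (A xi)),
      (forall a xi eta, symmx xi -> symmx eta ->
          A (a *: xi + eta) = a *: A xi + A eta) &
      (forall xi eta, symmx xi -> symmx eta -> mdot (A xi) eta = mdot (A eta) xi)].

Lemma pointwise_linear_sum A I (r : seq I) (c : I -> R) (S : I -> 'M[R]_d) :
  pointwise_linear A -> (forall i, symmx (S i)) ->
  A (\sum_(i <- r) c i *: S i) = \sum_(i <- r) c i *: A (S i).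
Proof.
move=> [_ linA _] sS.
have A0 : A 0 = 0.
  have := linA (-1) 0 0 symmx0 symmx0.
  by rewrite scaler0 addr0 scaleN1r addNr.
suff : symmx (\sum_(i <- r) c i *: S i) /\
  A (\sum_(i <- r) c i *: S i) = \sum_(i <- r) c i *: A (S i) by case.
elim: r => [|i r [IH1 IH2]]; first by rewrite !big_nil; split => //; exact: symmx0.
by rewrite !big_cons -IH2 -linA//; split => //; exact: symmx_linear.
Qed.

(** These matrices span the symmetric ones. *)
Definition sym_delta (kl : 'I_d * 'I_d) : 'M[R]_d :=
  2^-1 *: (delta_mx kl.1 kl.2 + delta_mx kl.2 kl.1).

Lemma symmx_sym_delta kl : symmx (sym_delta kl).
Proof. by rewrite /symmx /sym_delta linearZ linearD/= !trmx_delta addrC. Qed.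

Lemma symmx_sum_sym_delta xi : symmx xi ->
  xi = \sum_(kl : 'I_d * 'I_d) xi kl.1 kl.2 *: sym_delta kl.
Proof.
move=> sxi.
have E : xi = \sum_(kl : 'I_d * 'I_d) xi kl.1 kl.2 *: delta_mx kl.1 kl.2.
  by rewrite {1}[xi]matrix_sum_delta pair_big.
have E' : xi = \sum_(kl : 'I_d * 'I_d) xi kl.1 kl.2 *: delta_mx kl.2 kl.1.
  rewrite -{1}sxi {1}E linear_sum; apply: eq_bigr => kl _.
  by rewrite linearZ/= trmx_delta.
transitivity (2^-1 *: (xi + xi)).
  by apply/matrixP => i j; rewrite !mxE; lra.
rewrite {1}E {2}E' -big_split/= scaler_sumr; apply: eq_bigr => kl _.
by rewrite -scalerDr /sym_delta !scalerA mulrC.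
Qed.

Lemma measurable_fun_ae (f g : V -> R) :
  {ae mu, forall x, Omega x -> f x = g x} ->
  measurable_fun (Omega : set Vl) (f : Vl -> R) ->
  measurable_fun (Omega : set Vl) (g : Vl -> R).
Proof.
move=> [N [mN N0 fgN]] mf.
apply: (@measurable_fun_null R d Omega N N0) => //.
apply: (@eq_measurable_fun _ _ _ _ (Omega `\` N : set Vl) (f : Vl -> R)); last first.
  by apply: measurable_funS mf => //; exact: subDsetl.
move=> x; rewrite inE => -[Ox Nx]; apply: contrapT => fg.
by apply: Nx; apply: fgN => /= /(_ Ox).
Qed.

(** The definition of [Bspace] gives the measurability of [A x xi] for a constant
    [xi] only, whence the decomposition of [E x] on [sym_delta]. *)
Lemma apply_field_mem A E : sn_mem (s := B) A -> symmetric_field E ->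
  sn_mem (s := Hd) (apply_field A E).
Proof.
move=> [aeA mA [M hM]] [[mE E2] sE].
have mAE i j : measurable_fun (Omega : set Vl) (fun x : Vl => apply_field A E x i j).
  apply: (measurable_fun_ae
    (f := fun x => \sum_(kl : 'I_d * 'I_d) E x kl.1 kl.2 * A x (sym_delta kl) i j)).
    apply: (ae_imply aeA) => x linA Ox.
    rewrite /apply_field {2}(symmx_sum_sym_delta (sE x)).
    rewrite (pointwise_linear_sum _ _ (linA Ox) symmx_sym_delta) summxE.
    by apply: eq_bigr => kl _; rewrite mxE.
  apply: measurable_sum => kl; apply: measurable_funM; first exact: mE.
  exact: (mA _ (symmx_sym_delta kl) i j).
split; first exact: mAE.
apply: (@le_lt_trans _ _ (\int[mu]_(x in Omega) ((M ^+ 2)%:E * (mdot (E x) (E x))%:E))%E).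
  apply: ae_ge0_le_integral; first exact: mOmega.
  - by move=> x _; rewrite lee_fin mdot_ge0.
  - by apply/measurable_EFinP; exact: measurable_mdot.
  - by move=> x _; rewrite -EFinM lee_fin mulr_ge0 ?sqr_ge0 ?mdot_ge0.
  - by apply: measurable_funeM; apply/measurable_EFinP; exact: measurable_mdot.
  - apply: (ae_imply hM) => x h Ox; have {}h := h Ox _ (sE x).
    rewrite -EFinM lee_fin -!enorm_sqr -exprMn ler_sqr ?nnegrE//.
      exact: sqrtr_ge0.
    by apply: le_trans h; exact: sqrtr_ge0.
rewrite ge0_integralZl.
- by rewrite lte_mul_pinfty// lee_fin sqr_ge0.
- exact: mOmega.
- by apply/measurable_EFinP; exact: measurable_mdot.
- by move=> x _; rewrite lee_fin mdot_ge0.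
- by rewrite lee_fin sqr_ge0.
Qed.

Definition field_form (A : V -> 'M[R]_d -> 'M[R]_d) (E E' : V -> 'M[R]_d) : R :=
  L2dot mu Omega (apply_field A E) E'.

Lemma field_form_linear A a E E' G : sn_mem (s := B) A ->
  symmetric_field E -> symmetric_field E' -> symmetric_field G ->
  field_form A (a *: E + E') G = a * field_form A E G + field_form A E' G.
Proof.
move=> BA hE hE' [hG _].
have AE := apply_field_mem BA hE; have AE' := apply_field_mem BA hE'.
have AEE' := apply_field_mem BA (symmetric_field_linear a hE hE').
have si := @L2dot_si _ _ _ mu Omega mOmega d d.
transitivity (L2dot mu Omega (a *: apply_field A E + apply_field A E') G).
  apply: (L2dot_ae mOmega AEE' (si_mem si a AE AE') hG hG); last exact: aeW.
  have [aeA _ _] := BA; apply: (ae_imply aeA) => x linA Ox.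
  have [_ lin _] := linA Ox; have [_ sE] := hE; have [_ sE'] := hE'.
  by rewrite /apply_field !fctE lin.
exact: (si_linear si a AE AE' hG).
Qed.

Lemma field_form_sym A E E' : sn_mem (s := B) A ->
  symmetric_field E -> symmetric_field E' ->
  field_form A E E' = field_form A E' E.
Proof.
move=> BA hE hE'.
have AE := apply_field_mem BA hE; have AE' := apply_field_mem BA hE'.
have [aeA _ _] := BA; have [hE0 sE] := hE; have [hE'0 sE'] := hE'.
rewrite /field_form /L2dot /Rintegral; congr fine; apply: ae_eq_integral.
- exact: mOmega.
- exact: measurable_int (integrable_mdot mOmega AE hE'0).
- exact: measurable_int (integrable_mdot mOmega AE' hE0).
- apply: (ae_imply aeA) => x linA Ox; have [_ _ symA] := linA Ox.
  by congr _%:E; exact: symA.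
Qed.

Lemma field_form_si A : sn_mem (s := B) A ->
  {ae mu, forall x, Omega x -> forall xi, symmx xi -> 0 <= mdot (A x xi) xi} ->
  semi_inner symmetric_field (field_form A).
Proof.
move=> BA Age0; split.
- exact: symmetric_field_linear.
- by move=> a E E' G; exact: field_form_linear.
- by move=> E E'; exact: field_form_sym.
- move=> E hE; have [hE0 sE] := hE; have AE := apply_field_mem BA hE.
  have iAE := measurable_int _ (integrable_mdot mOmega AE hE0).
  apply: fine_ge0.
  have -> : (\int[mu]_(x in Omega) (mdot (apply_field A E x) (E x))%:E =
      \int[mu]_(x in Omega) `|(mdot (apply_field A E x) (E x))%:E|)%E.
    apply: ae_eq_integral; [exact: mOmega|exact: iAE|exact: measurableT_comp|].
    apply: (ae_imply Age0) => x h Ox.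
    by rewrite gee0_abs// lee_fin; exact: h.
  by apply: integral_ge0 => x _.
Qed.

Lemma field_form_ae A E E' G : sn_mem (s := B) A ->
  symmetric_field E -> symmetric_field E' -> symmetric_field G ->
  {ae mu, forall x, Omega x -> E x = E' x} ->
  field_form A E G = field_form A E' G.
Proof.
move=> BA hE hE' [hG _] EE'.
apply: (L2dot_ae mOmega (apply_field_mem BA hE) (apply_field_mem BA hE') hG hG).
  by apply: (ae_imply EE') => x h Ox; rewrite /apply_field h.
exact: aeW.
Qed.

Lemma field_form_field_linear A A' a E G : sn_mem (s := B) A -> sn_mem (s := B) A' ->
  symmetric_field E -> symmetric_field G ->
  field_form (a *: A + A') E G = a * field_form A E G + field_form A' E G.
Proof.
move=> BA BA' hE [hG _].
have si := @L2dot_si _ _ _ mu Omega mOmega d d.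
have AE := apply_field_mem BA hE; have AE' := apply_field_mem BA' hE.
exact: (si_linear si a AE AE' hG).
Qed.

Lemma Linfty_bound_linear a A A' M M' : Linfty_bound Omega A M ->
  Linfty_bound Omega A' M' -> Linfty_bound Omega (a *: A + A') (`|a| * M + M').
Proof.
move=> hM hM'; apply: (ae_imply2 hM hM') => x h h' Ox xi sxi.
have {}h := h Ox xi sxi; have {}h' := h' Ox xi sxi.
rewrite !fctE mulrDl -mulrA.
apply: (@le_trans _ _ (`|a| * enorm (A x xi) + enorm (A' x xi))); last first.
  by apply: lerD => //; exact: ler_wpM2l.
have si := @mdot_si R d d.
have n0 (X : 'M[R]_d) : 0 <= enorm X := sqrtr_ge0 _.
rewrite -ler_sqr ?nnegrE ?addr_ge0 ?mulr_ge0// enorm_sqr.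
rewrite (si_linear si)// !(si_linear_r si)// -!enorm_sqr (mdotC (A' x xi)).
have := si_CauchySchwarz_sqrt si (x := A x xi) (y := A' x xi) I I.
rewrite -/(enorm _) -/(enorm _) => cs.
have : a * mdot (A x xi) (A' x xi) <= `|a| * (enorm (A x xi) * enorm (A' x xi)).
  by rewrite (le_trans (ler_norm _))// normrM ler_wpM2l.
rewrite sqrrD exprMn real_normK ?num_real//.
move: (mdot _ _) (enorm _) (enorm _) => p q r; lra.
Qed.

Lemma Bspace_linear a A A' : sn_mem (s := B) A -> sn_mem (s := B) A' ->
  sn_mem (s := B) (a *: A + A').
Proof.
move=> [aeA mA [M hM]] [aeA' mA' [M' hM']]; split.
- apply: (ae_imply2 aeA aeA') => x h h' Ox.
  have [sA lA mdA] := h Ox; have [sA' lA' mdA'] := h' Ox.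
  split=> [xi sxi|b xi eta sxi seta|xi eta sxi seta]; rewrite !fctE.
  + by apply: symmx_linear; [exact: sA|exact: sA'].
  + rewrite lA// lA'//; apply/matrixP => i j; rewrite !mxE; ring.
  + by rewrite !mdot_linear mdA// mdA'.
- move=> xi sxi i j.
  rewrite (_ : (fun x => _) = (fun x => a * A x xi i j + A' x xi i j)); last first.
    by apply/funext => x; rewrite !fctE !mxE.
  have m1 : measurable_fun (Omega : set Vl) (fun x : Vl => a * A x xi i j).
    exact: (measurable_funM (measurable_cst a) (mA xi sxi i j)).
  exact: (measurable_funD m1 (mA' xi sxi i j)).
- by exists (`|a| * M + M'); exact: Linfty_bound_linear.
Qed.

Lemma Bspace_norm_ge0 A : 0 <= sn_norm (s := B) A.
Proof.
have [[M [M0 hM]]|h] := pselect ([set M | 0 <= M /\ Linfty_bound Omega A M] !=set0).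
  by apply: lb_le_inf; [exists M|move=> y []].
rewrite /= (_ : [set M | _] = set0) ?inf0//.
by rewrite -subset0 => M hM; apply: h; exists M.
Qed.

Lemma Linfty_bound_le A M M' : M <= M' -> Linfty_bound Omega A M ->
  Linfty_bound Omega A M'.
Proof.
move=> MM' hM; apply: (ae_imply hM) => x h Ox xi sxi.
by apply: le_trans (h Ox xi sxi) _; rewrite ler_wpM2r// sqrtr_ge0.
Qed.

(** The infimum that defines the norm need not be attained a priori. *)
Lemma Linfty_bound_norm A e : sn_mem (s := B) A -> 0 < e ->
  Linfty_bound Omega A (sn_norm (s := B) A + e).
Proof.
move=> [_ _ [M hM]] e0.
have hi : has_inf [set M | 0 <= M /\ Linfty_bound Omega A M].
  split; last by exists 0 => y [].
  exists `|M|; split => //; exact: Linfty_bound_le (ler_norm M) hM.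
by have [y [y0 hy] yi] := inf_adherent e0 hi; exact: Linfty_bound_le (ltW yi) hy.
Qed.

Lemma Bspace_norm_le A M : 0 <= M -> Linfty_bound Omega A M ->
  sn_norm (s := B) A <= M.
Proof. by move=> M0 hM; apply: ge_inf; [exists 0 => y []|split]. Qed.

Lemma Bspace_norm_triangle a A A' : sn_mem (s := B) A -> sn_mem (s := B) A' ->
  sn_norm (s := B) (a *: A + A') <= `|a| * sn_norm (s := B) A + sn_norm (s := B) A'.
Proof.
move=> BA BA'; apply/ler_addgt0Pr => e e0.
have a1 : 0 < `|a| + 1 by rewrite ltr_wpDl.
have e1 : 0 < e / (`|a| + 1) / 2 by rewrite !divr_gt0.
have e2 : 0 < e / 2 by rewrite divr_gt0.
have n0 := Bspace_norm_ge0 A; have n0' := Bspace_norm_ge0 A'.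
have := Linfty_bound_linear a (Linfty_bound_norm BA e1) (Linfty_bound_norm BA' e2).
move=> /Bspace_norm_le h; apply: le_trans (h _) _.
  by rewrite addr_ge0 ?mulr_ge0// addr_ge0// ltW.
rewrite mulrDr -!addrA lerD2l addrCA lerD2l.
have : `|a| * (e / (`|a| + 1) / 2) <= e / 2.
  by rewrite mulrA ler_wpM2r// mulrA ler_pdivrMr// mulrC ler_wpM2l ?ltW// ltrDl.
lra.
Qed.

Lemma field_form_bound A E G : sn_mem (s := B) A -> symmetric_field E ->
  symmetric_field G -> `|field_form A E G| <=
    sn_norm (s := B) A * (sn_norm (s := Hd) E * sn_norm (s := Hd) G).
Proof.
move=> BA hE hG; have [hE0 sE] := hE; have [hG0 sG] := hG.
have AE := apply_field_mem BA hE.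
apply: (le_trans (L2_CauchySchwarz mOmega AE hG0)); rewrite mulrA.
apply: ler_wpM2r; first exact: sqrtr_ge0.
apply/ler_addgt0Pr => e e0.
pose n := sn_norm (s := Hd) E.
have n0 : 0 <= n by exact: sqrtr_ge0.
have n1 : 0 < n + 1 by rewrite ltr_wpDl.
have e1 : 0 < e / (n + 1) by rewrite divr_gt0.
have hM := Linfty_bound_norm BA e1.
pose M := sn_norm (s := B) A + e / (n + 1).
have M0 : 0 <= M by rewrite addr_ge0 ?Bspace_norm_ge0// ltW.
apply: (@le_trans _ _ (M * n)); last first.
  rewrite /M mulrDl lerD2l mulrAC ler_pdivrMr// ler_wpM2l ?(ltW e0)//.
  by rewrite lerDl.
rewrite -(@ler_sqr R) ?nnegrE ?mulr_ge0 ?sqrtr_ge0// exprMn.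
rewrite L2_norm_sqr /n L2_norm_sqr /L2dot -RintegralZl//; last exact: integrable_mdot.
rewrite /Rintegral fine_le//.
- exact: integrable_fin_num (integrable_mdot mOmega AE AE).
- exact: integrable_fin_num (integrableZl mOmega (M ^+ 2) (integrable_mdot mOmega hE0 hE0)).
apply: ae_ge0_le_integral; first exact: mOmega.
- by move=> x _; rewrite lee_fin mdot_ge0.
- exact: measurable_int (integrable_mdot mOmega AE AE).
- by move=> x _; rewrite lee_fin mulr_ge0 ?sqr_ge0 ?mdot_ge0.
- exact: measurable_int (integrableZl mOmega (M ^+ 2) (integrable_mdot mOmega hE0 hE0)).
- apply: (ae_imply hM) => x h Ox; have {}h := h Ox _ (sE x).
  rewrite lee_fin -!enorm_sqr -exprMn ler_sqr ?nnegrE//; first exact: sqrtr_ge0.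
  by apply: le_trans h; exact: sqrtr_ge0.
Qed.

End operator_fields.

(** * Calculus on an interval of times *)

Section calculus.
Context {R : realType}.
Local Notation lam := (@lebesgue_measure R).
Local Notation Rm := (measurableTypeR R).
Implicit Types (f h P q : R -> R) (a b c k t s e r : R).

Lemma Rdominated_cvg {disp} {T : measurableType disp}
    (mu : {measure set T -> \bar R}) (D : set T) (f_ : (T -> R)^nat)
    (f g : T -> R) : measurable D ->
  (forall n, measurable_fun D (f_ n)) -> measurable_fun D f ->
  {ae mu, forall x, D x -> (fun n => f_ n x) @ \oo --> f x} ->
  mu.-integrable D (EFin \o g) ->
  {ae mu, forall x, D x -> forall n, `|f_ n x| <= g x} ->
  mu.-integrable D (EFin \o f) /\
  (fun n => \int[mu]_(x in D) f_ n x) @ \oo --> \int[mu]_(x in D) f x.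
Proof.
move=> mD mf_ mf f_f ig f_g.
have mEf_ n : measurable_fun D (EFin \o f_ n) by exact/measurable_EFinP.
have mEf : measurable_fun D (EFin \o f) by exact/measurable_EFinP.
have ae1 : {ae mu, forall x, D x -> (fun n => (EFin \o f_ n) x) @ \oo --> (EFin \o f) x}.
  apply: (ae_imply f_f) => x h Dx; apply: cvg_EFin; first exact: nearW.
  exact: h.
have ae2 : {ae mu, forall x n, D x -> (`|(EFin \o f_ n) x| <= (EFin \o g) x)%E}.
  by apply: (ae_imply f_g) => x h n Dx; rewrite lee_fin; exact: h.
have [intf _ cv] := dominated_convergence mD mEf_ mEf ae1 ig ae2.
split=> //; apply: fine_cvg; rewrite fineK//; exact: integrable_fin_num.
Qed.

Lemma integrable_itv f a b : continuous f -> lam.-integrable `[a, b] (EFin \o f).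
Proof.
move=> cf; apply: continuous_compact_integrable; first exact: segment_compact.
exact: continuous_subspaceT.
Qed.

Lemma integrable_itvS f (D : set Rm) a b : continuous f -> measurable D ->
  D `<=` `[a, b] -> lam.-integrable D (EFin \o f).
Proof. by move=> cf mD Dab; apply: integrableS (integrable_itv a b cf). Qed.

Definition primitive f t := \int[lam]_(x in `[0, t]) f x.

Lemma primitive_linear f h c k t : continuous f -> continuous h ->
  primitive (fun x => c * f x + k * h x) t = c * primitive f t + k * primitive h t.
Proof.
move=> cf ch; rewrite /primitive.
have mI : measurable (`[0, t]%classic : set Rm) by exact: measurable_itv.
rewrite -(RintegralZl c mI (integrable_itv 0 t cf)).
rewrite -(RintegralZl k mI (integrable_itv 0 t ch)) -RintegralD//.
  by apply: integrable_itv => x; exact: cvgM (cvg_cst c) (cf x).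
by apply: integrable_itv => x; exact: cvgM (cvg_cst k) (ch x).
Qed.

Lemma primitiveB f a b : continuous f -> 0 <= a -> a <= b ->
  primitive f b - primitive f a = \int[lam]_(x in `]a, b]) f x.
Proof.
move=> cf a0 ab; rewrite /primitive Rintegral_itvB//; exact: integrable_itv.
Qed.

Lemma primitive_bound f a b c k : continuous f -> 0 <= a -> a <= b ->
  (forall x, a <= x <= b -> `|f x - c| <= k) ->
  `|primitive f b - primitive f a - (b - a) * c| <= (b - a) * k.
Proof.
move=> cf a0 ab fk; rewrite primitiveB//.
have mI : measurable (`]a, b]%classic : set Rm) by exact: measurable_itv.
have sI : `]a, b]%classic `<=` `[a, b].
  by move=> x; rewrite /= !in_itv/= => /andP[/ltW -> ->].
have cstI (r : R) : lam.-integrable `]a, b] (EFin \o cst r).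
  by apply: integrable_itvS sI => //; exact: cst_continuous.
have intc (r : R) : \int[lam]_(x in `]a, b]) (cst r x) = (b - a) * r.
  rewrite Rintegral_cst//.
  have E : lam `]a, b]%classic = (b - a)%:E.
    rewrite lebesgue_measure_itv/= lte_fin.
    by case: ltgtP ab => // -> _; rewrite subrr.
  have -> : fine (lam `]a, b]%classic) = b - a by rewrite E.
  exact: mulrC.
have fI : lam.-integrable `]a, b] (EFin \o f) by exact: integrable_itvS sI.
have cfc : continuous (fun x => f x - c).
  by move=> x; exact: cvgB (cf x) (cvg_cst c).
have fcI : lam.-integrable `]a, b] (EFin \o (fun x => f x - c)).
  by apply: integrable_itvS sI.
rewrite -intc -RintegralB// -(intc k).
apply: (le_trans (le_normr_Rintegral mI fcI)).
apply: le_Rintegral => //.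
  by apply: (integrable_itvS _ mI sI) => x; exact: cvg_norm (cfc x).
move=> x; rewrite /= in_itv/= => /andP[ax xb]; apply: fk.
by rewrite xb ltW.
Qed.

Lemma primitive0 f t : t <= 0 -> primitive f t = 0.
Proof.
rewrite /primitive le_eqVlt => /predU1P[->|t0].
  by rewrite set_itv1 Rintegral_set1.
by rewrite set_itv_ge ?Rintegral_set0// bnd_simp -ltNge.
Qed.

Lemma is_derive_primitive f t : continuous f -> 0 < t ->
  is_derive t 1 (primitive f) (f t).
Proof.
move=> cf t0.
have [d1 d2] := @continuous_FTC1_closed R f 0 t (t + 1) ltac:(by rewrite ltrDl)
  (integrable_itv 0 (t + 1) cf) t0 (cf t).
exact: (DeriveDef d1 (etrans (esym (derive1E _ _)) d2)).
Qed.

Lemma continuous_near f t k : continuous f -> 0 < k ->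
  exists2 e, 0 < e & forall x, `|x - t| < e -> `|f x - f t| <= k.
Proof.
move=> cf k0; have /cvgrPdist_le/(_ _ k0) := cf t.
move=> /nbhs_ballP[e /= e0 he]; exists e => // x xt.
by rewrite distrC; apply: he; rewrite /ball/= distrC.
Qed.

Lemma continuous_primitive f : continuous f -> continuous (primitive f).
Proof.
move=> cf t; have [t0|t0|->] := ltgtP t 0.
- suff : primitive f @ t --> (0 : R) by rewrite -(primitive0 f (ltW t0)).
  apply/cvgrPdist_le => e e0; near=> x.
  rewrite primitive0 ?subrr ?normr0 ?(ltW e0)// ltW//; near: x.
  exact: lt_nbhsl.
- apply/differentiable_continuous/derivable1_diffP.
  by have [] := is_derive_primitive cf t0.
- apply/cvgrPdist_le => e e0.
  have [a a0 ha] := continuous_near 0 cf ltr01.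
  pose M := `|f 0| + 1; have M0 : 0 < M by rewrite ltr_wpDl.
  apply/nbhs_ballP; exists (Num.min a (e / M)).
    by rewrite /= lt_min a0 divr_gt0.
  move=> x; rewrite /ball/= sub0r normrN lt_min => /andP[xa /ltW xM].
  rewrite (primitive0 f (lexx 0)) sub0r normrN.
  have [x0|x0] := leP x 0; first by rewrite primitive0// normr0 ltW.
  have := @primitive_bound f 0 x (f 0) 1 cf (lexx _) (ltW x0).
  rewrite (primitive0 f (lexx 0)) !subr0 mulr1 => h.
  apply: (@le_trans _ _ (x * M)).
    rewrite /M mulrDr mulr1 -[x in x * `|_|]gtr0_norm// -normrM addrC -lerBlDr.
    apply: le_trans (lerB_dist _ _) _; apply: h => y /andP[y0 yx].
    apply: ha; rewrite subr0 ger0_norm//.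
    by apply: le_lt_trans xa; apply: le_trans yx (ler_norm _).
  by rewrite -ler_pdivlMr// (le_trans (ler_norm _)).
Unshelve. all: by end_near. Qed.

Lemma primitive_le f a b : continuous f -> 0 <= a -> a <= b ->
  (forall x, a <= x <= b -> 0 <= f x) -> primitive f a <= primitive f b.
Proof.
move=> cf a0 ab f0; rewrite -subr_ge0 primitiveB//; apply: Rintegral_ge0 => x.
by rewrite /= in_itv/= => /andP[ax xb]; rewrite f0// xb ltW.
Qed.

Lemma primitive_gt0 f a b : continuous f -> 0 <= a -> a < b ->
  (forall x, 0 <= f x) -> 0 < f a -> 0 < primitive f b.
Proof.
move=> cf a0 ab f0 fa.
have [e e0 he] := continuous_near a cf (divr_gt0 fa (ltr0n _ 2)).
pose c := Num.min (e / 2) (b - a).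
have c0 : 0 < c by rewrite /c lt_min divr_gt0//= subr_gt0.
have cb : a + c <= b by rewrite -lerBrDl /c ge_min lexx orbT.
have ce : c <= e / 2 by rewrite /c ge_min lexx.
have ac : a <= a + c by rewrite lerDl ltW.
have := @primitive_bound f a (a + c) (f a) (f a / 2) cf a0 ac.
have -> : a + c - a = c by ring.
move=> /(_ _) h.
have {}h : `|primitive f (a + c) - primitive f a - c * f a| <= c * (f a / 2).
  apply: h => x /andP[ax xc]; apply: he; rewrite ger0_norm ?subr_ge0//; lra.
have p1 : 0 <= primitive f a.
  by rewrite -[leLHS](@primitive0 f 0)//; apply: primitive_le => // x _.
have p2 : primitive f (a + c) <= primitive f b.
  by apply: primitive_le => //; rewrite addr_ge0// ltW.
have p3 : 0 < c * (f a / 2) by rewrite mulr_gt0// divr_gt0.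
move: h; rewrite ler_norml => /andP[h _]; lra.
Qed.

Lemma continuous_FTC2' f F s : 0 < s -> continuous f -> continuous F ->
  (forall t, 0 < t < s -> is_derive t 1 F (f t)) ->
  \int[lam]_(x in `[0, s]) f x = F s - F 0.
Proof.
move=> s0 cf cF dF; rewrite /Rintegral (@continuous_FTC2 _ f F)//.
- exact: continuous_subspaceT.
- split.
  + by move=> x; rewrite in_itv/= => /dF[].
  + by apply: cvg_at_right_filter; exact: cF.
  + by apply: cvg_at_left_filter; exact: cF.
- by move=> x; rewrite in_itv/= => /dF[] *; rewrite derive1E.
Qed.

End calculus.

Section du_bois_reymond.
Context {R : realType}.
Local Notation lam := (@lebesgue_measure R).
Implicit Types (f P q : R -> R) (a b c k t s e x y : R).

Lemma test_function1_derive1_continuous a b (eta : R -> R) :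
  test_function1 a b eta -> continuous eta /\ continuous (derive1 eta).
Proof.
move=> [d _]; split=> t; apply/differentiable_continuous/derivable1_diffP.
  exact: (d 0%N t).
exact: (d 1%N t).
Qed.

Section primitive_test_function.
Variables (T c e : R) (f : R -> R).
Hypotheses (c0 : 0 < c) (ce : c <= e) (eT : e < T) (bf : bumpy f)
  (f0 : forall x, ~~ (c < x < e) -> f x = 0) (fT : primitive f T = 0).

Let cf : continuous f := bumpy_continuous bf.

Let prim_left x : x <= c -> primitive f x = 0.
Proof.
move=> xc; have [x0|x0] := leP x 0; first exact: primitive0.
have := @primitive_bound _ f 0 x 0 0 cf (lexx _) (ltW x0).
rewrite (primitive0 f (lexx 0)) !mulr0 !subr0 normr_le0 => h; apply/eqP/h => y.
move=> /andP[_ yx]; rewrite f0 ?subrr ?normr0// negb_and -!leNgt.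
by rewrite (le_trans yx xc).
Qed.

Let prim_right x : e <= x -> primitive f x = 0.
Proof.
have e0 : 0 <= e by rewrite (le_trans _ ce)// ltW.
suff h y : e <= y -> primitive f y = primitive f e.
  by move=> /h ->; rewrite -fT h// ltW.
move=> ey; have := @primitive_bound _ f e y 0 0 cf e0 ey.
rewrite !mulr0 subr0 normr_le0 subr_eq0 => h; apply/eqP/h => z.
move=> /andP[ez _]; rewrite f0 ?subrr ?normr0// negb_and -!leNgt.
by rewrite ez orbT.
Qed.

Let is_derive_prim x : is_derive x 1 (primitive f) (f x).
Proof.
have [x0|x0] := ltP 0 x; first exact: is_derive_primitive.
rewrite f0; last by rewrite negb_and -!leNgt (le_trans x0 (ltW c0)).
apply: (near_eq_is_derive (f := cst (0 : R))).
have xc : x < c by exact: le_lt_trans x0 c0.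
near=> y; rewrite /= prim_left// ltW//; near: y.
exact: lt_nbhsl.
Unshelve. all: by end_near. Qed.

Lemma derive1_primitive_bumpy : derive1 (primitive f) = f.
Proof.
by apply/funext => x; rewrite derive1E; have [_ ->] := is_derive_prim x.
Qed.

Lemma test_function_primitive : test_function1 0 T (primitive f).
Proof.
split.
  move=> [|n] t; first by have [] := is_derive_prim t.
  rewrite /derive1n iterSr derive1_primitive_bumpy.
  exact/bumpy_derivable/(bumpy_derive1n n).
exists c, e; split=> // t; rewrite in_itv/= negb_and -!ltNge.
by case/orP => h; [exact/prim_left/ltW|exact/prim_right/ltW].
Qed.

End primitive_test_function.

(** The mean of [f] with respect to a weight concentrated where [f] is close to
    [c]. *)
Lemma primitive_weight_bound f (w : R -> R) s c k : continuous f ->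
  continuous w -> 0 <= s -> (forall x, 0 <= w x) ->
  (forall x, w x != 0 -> `|f x - c| <= k) ->
  `|primitive (fun x => f x * w x) s - c * primitive w s| <= k * primitive w s.
Proof.
move=> cf cw s0 w0 fk; rewrite /primitive.
have mI : measurable (`[0, s]%classic : set (measurableTypeR R)) by exact: measurable_itv.
have iw := integrable_itv 0 s cw.
have cfw : continuous (fun x => f x * w x) by move=> x; exact: cvgM (cf x) (cw x).
have ccw r : continuous (fun x => r * w x).
  by move=> x; exact: cvgM (cvg_cst r) (cw x).
have ifw := integrable_itv 0 s cfw.
rewrite -!RintegralZl// -RintegralB//; last exact: (integrable_itv 0 s (ccw c)).
have cd : continuous (fun x => f x * w x - c * w x).
  by move=> x; exact: cvgB (cfw x) (ccw c x).
apply: (le_trans (le_normr_Rintegral mI (integrable_itv 0 s cd))).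
apply: (le_Rintegral mI _ (integrable_itv 0 s (ccw k))).
  by apply: integrable_itv => x; exact: cvg_norm (cd x).
move=> x _; rewrite -mulrBl normrM (ger0_norm (w0 x)).
have [->|wx] := eqVneq (w x) 0; first by rewrite !mulr0.
by rewrite ler_wpM2r// fk.
Qed.

Let subitv_notin a b c e x : a <= c -> e <= b -> ~~ (a < x < b) -> ~~ (c < x < e).
Proof.
move=> ac eb; apply: contra => /andP[cx xe].
by rewrite (le_lt_trans ac cx) (lt_le_trans xe eb).
Qed.

Let far_notin x a e s : s < e -> ~~ (`|x - a| < e) -> ~~ (a - s < x < a + s).
Proof.
move=> se; apply: contra => /andP[h1 h2]; apply: lt_trans se.
by rewrite ltr_norml ltrBrDr ltrBlDr addrC h1 addrC.
Qed.

(** The test functions are primitives of a combination, with vanishing total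
    mass, of two bumps concentrated at two given times. *)
Lemma orthogonal_derivatives_constant T f : 0 < T -> continuous f ->
  (forall eta, test_function1 0 T eta ->
     primitive (fun t => f t * derive1 eta t) T = 0) ->
  forall t, 0 <= t <= T -> f t = f 0.
Proof.
move=> T0 cf f0.
have inner a b : 0 < a -> a < b -> b < T -> f a = f b.
  move=> a0 ab bT; apply/eqP; rewrite -subr_eq0 -normr_le0; apply/ler_addgt0Pr => k k0.
  have k2 : 0 < k / 2 by rewrite divr_gt0.
  have [ea ea0 fa] := continuous_near a cf k2.
  have [eb eb0 fb] := continuous_near b cf k2.
  (* Half the distance to the constraints: [f] is nearly constant on the two
     supports, which stay inside [`]0, T[]. *)
  pose r := Num.min (Num.min ea eb) (Num.min a (T - b)) / 2.
  have r0 : 0 < r by rewrite divr_gt0// !lt_min ea0 eb0 a0 subr_gt0.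
  have [rea reb ra rb] : [/\ r < ea, r < eb, r < a & r < T - b].
    have h x : 0 < x -> Num.min (Num.min ea eb) (Num.min a (T - b)) <= x -> r < x.
      by rewrite /r; lra.
    by split; apply: h => //; rewrite ?subr_gt0// !ge_min lexx ?orbT.
  pose wa := bump 0 (a - r) (a + r); pose wb := bump 0 (b - r) (b + r).
  have cwa : continuous wa by apply: bumpy_continuous; exact: bumpy_bump.
  have cwb : continuous wb by apply: bumpy_continuous; exact: bumpy_bump.
  have [ma maE] : exists ma, ma = primitive wa T by eexists.
  have [mb mbE] : exists mb, mb = primitive wb T by eexists.
  have ma0 : 0 < ma.
    rewrite maE; apply: (@primitive_gt0 _ _ a) => //; [exact: ltW|exact: lt_trans bT|..].
      by move=> x; exact: bump_ge0.
    by apply: bump_gt0; rewrite ltrBlDr ltrDl r0.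
  have mb0 : 0 < mb.
    rewrite mbE; apply: (@primitive_gt0 _ _ b) => //; [by rewrite ltW// (lt_trans a0)|..].
      by move=> x; exact: bump_ge0.
    by apply: bump_gt0; rewrite ltrBlDr ltrDl r0.
  (* The masses are exchanged so that the total mass of [w] is zero. *)
  pose w x := mb * wa x + (- ma) * wb x.
  have bw : bumpy w by apply: bumpyD; apply: bumpyZ; exact: bumpy_bump.
  have lin (h : R -> R) : continuous h -> primitive (fun t => h t * w t) T =
      mb * primitive (fun t => h t * wa t) T - ma * primitive (fun t => h t * wb t) T.
    move=> ch; have ca : continuous (fun t => h t * wa t).
      by move=> x; exact: cvgM (ch x) (cwa x).
    have cb : continuous (fun t => h t * wb t).
      by move=> x; exact: cvgM (ch x) (cwb x).
    rewrite -[X in _ - X]opprK opprK -mulNr -primitive_linear//.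
    by congr (primitive _ T); apply/funext => t; rewrite /w; ring.
  have wT : primitive w T = 0.
    rewrite primitive_linear// -maE -mbE; ring.
  have c0 : 0 < a - r by rewrite subr_gt0.
  have ce : a - r <= b + r by rewrite lerBlDr -addrA (le_trans (ltW ab))// lerDl addr_ge0// ltW.
  have eT : b + r < T by rewrite addrC -ltrBrDr.
  have w0 x : ~~ (a - r < x < b + r) -> w x = 0.
    move=> h; rewrite /w /wa /wb !bump_eq0 ?mulr0 ?addr0//.
      by apply: subitv_notin h => //; rewrite lerD2r ltW.
    by apply: subitv_notin h => //; rewrite lerD2r ltW.
  have tw := test_function_primitive c0 ce eT bw w0 wT.
  have := f0 _ tw; rewrite (derive1_primitive_bumpy c0 bw w0) lin// => fw.
  have ha := @primitive_weight_bound f wa T (f a) (k / 2) cf cwa (ltW T0) (bump_ge0 _ _ _).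
  have hb := @primitive_weight_bound f wb T (f b) (k / 2) cf cwb (ltW T0) (bump_ge0 _ _ _).
  have {}ha : `|primitive (fun x => f x * wa x) T - f a * ma| <= k / 2 * ma.
    rewrite maE; apply: ha => x wx; apply: fa; apply: contraNT wx => h.
    by rewrite /wa bump_eq0//; exact: far_notin h.
  have {}hb : `|primitive (fun x => f x * wb x) T - f b * mb| <= k / 2 * mb.
    rewrite mbE; apply: hb => x wx; apply: fb; apply: contraNT wx => h.
    by rewrite /wb bump_eq0//; exact: far_notin h.
  set A := primitive _ _ in fw ha; set B := primitive _ _ in fw hb.
  clearbody A B.
  have mab : 0 < ma * mb by exact: mulr_gt0.
  have h1 : `|ma * (B - f b * mb)| <= ma * (k / 2 * mb).
    by rewrite normrM gtr0_norm// ler_wpM2l// ltW.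
  have h2 : `|mb * (A - f a * ma)| <= mb * (k / 2 * ma).
    by rewrite normrM gtr0_norm// ler_wpM2l// ltW.
  rewrite add0r -(ler_pM2l mab) -[ma * mb in leLHS](gtr0_norm mab) -normrM.
  have -> : ma * mb * (f a - f b) = ma * (B - f b * mb) - mb * (A - f a * ma).
    by rewrite -[LHS]subr0 -fw; ring.
  apply: (le_trans (ler_normB _ _)); apply: (le_trans (lerD h1 h2)).
  by rewrite le_eqVlt; apply/orP; left; apply/eqP; field.
have half : 0 < T / 2 < T by apply/andP; split; lra.
have [h0 hT] := andP half.
have mid t : 0 < t < T -> f t = f (T / 2).
  move=> /andP[t0 tT]; have [h|h|->//] := ltgtP t (T / 2); first exact: inner.
  by apply/esym; exact: inner.
have clos t : 0 <= t <= T -> f t = f (T / 2).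
  move=> /andP[t0 tT].
  apply/eqP; rewrite -subr_eq0 -normr_le0; apply/ler_addgt0Pr => k k0.
  have [e e0 fe] := continuous_near t cf k0; rewrite add0r.
  have [x [x0 xT xt]] : exists x, [/\ 0 < x, x < T & `|x - t| < e].
    have [tT2|tT2] := leP t (T / 2).
      exists (t + Num.min e T / 4).
      have m0 : 0 < Num.min e T by rewrite lt_min e0.
      have m1 : Num.min e T <= T by rewrite ge_min lexx orbT.
      have m2 : Num.min e T <= e by rewrite ge_min lexx.
      by split; [lra|lra|rewrite addrC addKr gtr0_norm; lra].
    exists (t - Num.min e T / 4).
    have m0 : 0 < Num.min e T by rewrite lt_min e0.
    have m1 : Num.min e T <= T by rewrite ge_min lexx orbT.
    have m2 : Num.min e T <= e by rewrite ge_min lexx.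
    by split; [lra|lra|rewrite addrC addKr normrN gtr0_norm; lra].
  by have := fe x xt; rewrite distrC (mid x)// x0.
by move=> t /clos ->; apply/esym/clos; rewrite lexx ltW.
Qed.

(** [P + primitive q] is orthogonal to the derivatives of test functions. *)
Lemma du_bois_reymond T P q : 0 < T -> continuous P -> continuous q ->
  (forall eta, test_function1 0 T eta ->
     primitive (fun t => P t * derive1 eta t) T = primitive (fun t => q t * eta t) T) ->
  forall t, 0 <= t <= T -> P t = P 0 - primitive q t.
Proof.
move=> T0 cP cq h t tT.
have cQ := continuous_primitive cq.
have cPQ : continuous (fun t => P t + primitive q t).
  by move=> x; exact: cvgD (cP x) (cQ x).
suff : P t + primitive q t = P 0 + primitive q 0.
  by rewrite (primitive0 q (lexx 0)); lra.
apply: (orthogonal_derivatives_constant T0 cPQ) tT => eta teta.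
have [ceta cdeta] := test_function1_derive1_continuous teta.
have [deta [c [e [c0 eT eta0]]]] := teta.
have mI : measurable (`[0, T]%classic : set (measurableTypeR R)) by exact: measurable_itv.
have cPd : continuous (fun t => P t * derive1 eta t).
  by move=> x; exact: cvgM (cP x) (cdeta x).
have cQd : continuous (fun t => primitive q t * derive1 eta t).
  by move=> x; exact: cvgM (cQ x) (cdeta x).
have cqe : continuous (fun t => q t * eta t).
  by move=> x; exact: cvgM (cq x) (ceta x).
have cF : continuous (fun x => primitive q x * eta x).
  by move=> x; exact: cvgM (cQ x) (ceta x).
have cdF : continuous (fun t => q t * eta t + primitive q t * derive1 eta t).
  by move=> x; exact: cvgD (cqe x) (cQd x).
have dF x : 0 < x < T -> is_derive x 1 (fun x => primitive q x * eta x)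
    (q x * eta x + primitive q x * derive1 eta x).
  move=> /andP[x0 _]; have d1 := is_derive_primitive cq x0.
  have d2 : is_derive x 1 eta (derive1 eta x).
    by apply: DeriveDef; [exact: (deta 0%N x)|rewrite derive1E].
  have dM := is_deriveM d1 d2.
  by apply: is_derive_eq; rewrite /GRing.scale/=; ring.
have eta_out t0 : t0 <= 0 \/ T <= t0 -> eta t0 = 0.
  move=> h0; apply: eta0; rewrite in_itv/= negb_and -!ltNge.
  by case: h0 => h0; [rewrite (le_lt_trans h0 c0)|rewrite (lt_le_trans eT h0) orbT].
have FTC := continuous_FTC2' T0 cdF cF dF.
have e0 : eta 0 = 0 by apply: eta_out; left.
have eT' : eta T = 0 by apply: eta_out; right.
rewrite e0 eT' !mulr0 subrr -/(primitive _ T) in FTC.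
transitivity (1 * primitive (fun t => P t * derive1 eta t) T +
    1 * primitive (fun t => primitive q t * derive1 eta t) T).
  rewrite -primitive_linear//; congr (primitive _ T).
  by apply/funext => x; ring.
rewrite h// -primitive_linear// -[RHS]FTC; congr (primitive _ T).
by apply/funext => x; ring.
Qed.

End du_bois_reymond.

Section reflection.
Context {R : realType}.
Local Notation lam := (@lebesgue_measure R).
Local Notation Rm := (measurableTypeR R).
Implicit Types (t a b : R).

Lemma measurable_reflect t : measurable_fun setT (fun x : Rm => t - x : Rm).
Proof.
apply: (measurability _ (RGenInftyO.measurableE R)) => _ [_ [c ->] <-].
rewrite setTI (_ : _ @^-1` _ = `]t - c, +oo[%classic).
  exact: measurable_itv.
by apply/seteqP; split=> x /=; rewrite !in_itv/= ?andbT ltrBlDr ltrBlDl addrC.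
Qed.

(** A reflection maps intervals to intervals of the same length, and this
    characterizes the Lebesgue measure. *)
Lemma lebesgue_reflect t (A : set Rm) : measurable A ->
  pushforward lam ((fun x => t - x) : Rm -> Rm) A = lam A.
Proof.
move=> mA; have mr := measurable_reflect t.
apply/esym/lebesgue_measure_unique; last exact: mA.
move=> _ [[a b] _ <-]; rewrite /= /pushforward.
rewrite (_ : (fun x : Rm => t - x) @^-1` _ = `[t - b, t - a[%classic); last first.
  by apply/seteqP; split=> x; rewrite /= !in_itv/= => /andP[h1 h2];
    apply/andP; split; lra.
rewrite !lebesgue_measure_itv/= !lte_fin ltrD2l ltrN2.
by case: ltP => // _; congr (_%:E); ring.
Qed.

Lemma integral_reflect t (D : set Rm) (f : Rm -> \bar R) : measurable D ->
  measurable_fun D f ->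
  (\int[lam]_(x in D) f x =
   \int[lam]_(x in (fun x => (t - x)%R) @^-1` D) f (t - x)%R)%E.
Proof.
move=> mD mf; have mr := measurable_reflect t.
have ge0 (h : Rm -> \bar R) : measurable_fun D h -> (forall x, 0 <= h x)%E ->
    (\int[lam]_(x in D) h x =
     \int[lam]_(x in (fun x => (t - x)%R) @^-1` D) h (t - x)%R)%E.
  move=> mh h0.
  rewrite -(@ge0_integral_pushforward _ _ _ _ R _ mr lam D h)//.
  by apply: eq_measure_integral => A mA _; exact/esym/(lebesgue_reflect t mA).
rewrite integralE [RHS]integralE; congr (_ - _)%E.
  rewrite (ge0 (f^\+)%E); first by apply: eq_integral => x _; rewrite !funeposE.
    exact: measurable_funepos.
  by move=> x; exact: funepos_ge0.
rewrite (ge0 (f^\-)%E); first by apply: eq_integral => x _; rewrite !funenegE.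
  exact: measurable_funeneg.
by move=> x; exact: funeneg_ge0.
Qed.

Lemma preimage_reflect_itv t :
  ((fun x : R => t - x) @^-1` `]0, t] = `[0, t[)%classic.
Proof.
by apply/seteqP; split=> x; rewrite /= !in_itv/= => /andP[h1 h2]; apply/andP; split; lra.
Qed.

Lemma integrable_reflect t (h : R -> R) :
  lam.-integrable `]0, t] (EFin \o h) ->
  lam.-integrable `[0, t[ (EFin \o (fun x => h (t - x))) /\
  \int[lam]_(x in `[0, t[) h (t - x) = \int[lam]_(x in `]0, t]) h x.
Proof.
move=> /integrableP[mh hoo]; have mr := measurable_reflect t.
have mI : measurable (`]0, t]%classic : set Rm) by exact: measurable_itv.
split; last by rewrite /Rintegral (integral_reflect t mI mh) preimage_reflect_itv.
apply/integrableP; split.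
  rewrite -(preimage_reflect_itv t).
  have sub : (fun x : Rm => t - x : Rm) @` ((fun x : R => t - x) @^-1` `]0, t])
      `<=` `]0, t] by move=> _ [x /= xt <-].
  apply: (measurable_comp mI sub mh); apply: measurable_funS mr => //.
rewrite (integral_reflect t mI) in hoo; last exact: measurableT_comp.
by rewrite preimage_reflect_itv in hoo.
Qed.

End reflection.

Lemma cvg_sequential {R : realType} (f : R -> R) (p l : R) :
  (forall u : R^nat, u @ \oo --> p -> (fun n => f (u n)) @ \oo --> l) ->
  f @ p --> l.
Proof.
move=> fu; apply: contrapT => /cvgrPdist_le/existsNP[e /not_implyP[e0 ne]].
have /choice[u hu] : forall n : nat, exists x, `|p - x| < n.+1%:R^-1 /\ ~ `|l - f x| <= e.
  move=> n; apply: contrapT => h; apply: ne; apply/nbhs_ballP.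
  exists n.+1%:R^-1 => [|x px]; first by rewrite /= invr_gt0.
  by apply: contrapT => lx; apply: h; exists x.
have up : u @ \oo --> p.
  apply/cvgrPdist_lt => k k0; near=> n; have [h _] := hu n.
  apply: (lt_trans h); near: n.
  exact: near_infty_natSinv_lt (PosNum k0).
have /cvgrPdist_le/(_ e e0)[N _ hN] := fu u up.
by have [_] := hu N; apply; apply: hN => /=.
Unshelve. all: by end_near. Qed.

Section convolution.
Context {R : realType}.
Local Notation lam := (@lebesgue_measure R).
Local Notation Rm := (measurableTypeR R).

(** Paths that are only controlled on [[0, T]] are extended by their values at
    the ends, so that continuity can be used on the whole line. *)
Definition clamp (T t : R) : R := Num.min (Num.max t 0) T.

Lemma clamp_itv T t : 0 <= T -> 0 <= clamp T t <= T.
Proof.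
by move=> T0; rewrite /clamp le_min le_max lexx T0 orbT/= ge_min lexx orbT.
Qed.

Lemma clampE T t : 0 <= t <= T -> clamp T t = t.
Proof. by move=> /andP[t0 tT]; rewrite /clamp (max_idPl t0) (min_idPl tT). Qed.

Lemma continuous_clamp T : continuous (clamp T).
Proof.
move=> t; have h1 : {for t, continuous (fun x : R => Num.max x 0)}.
  by apply: continuous_max; [exact: cvg_id|exact: cvg_cst].
have h2 : {for t, continuous (cst T)} by exact: cvg_cst.
exact: (continuous_min h1 h2).
Qed.

Variables (T L : R) (g : R -> R) (j : R -> R -> R).
Hypotheses (T0 : 0 < T) (TL : T < L)
  (gi : lam.-integrable `]0, L[ (EFin \o g))
  (jb : forall tau r, 0 < tau < L -> `|j tau r| <= g tau)
  (jr : forall tau, 0 < tau < L -> continuous (j tau))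
  (jtau : forall tau k, 0 < tau < L -> 0 < k -> exists2 e, 0 < e &
     forall tau', `|tau' - tau| < e -> 0 < tau' < L ->
     forall r, `|j tau' r - j tau r| <= k).

Definition convolution (t : R) := \int[lam]_(r in `[0, t]) j (t - r) r.

Let diag t tau := j tau (t - tau).

Let diag_continuous t tau : 0 < tau < L -> {for tau, continuous (diag t)}.
Proof.
move=> tL; apply/cvgrPdist_le => k k0.
have k2 : 0 < k / 2 by rewrite divr_gt0.
have [e e0 he] := jtau tL k2.
have [e' e'0 he'] := continuous_near (t - tau) (jr tL) k2.
have /andP[t0 tL'] := tL.
pose m := Num.min (Num.min e e') (Num.min tau (L - tau)).
have m0 : 0 < m by rewrite !lt_min e0 e'0 t0 subr_gt0.
apply/nbhs_ballP; exists m => // x; rewrite /ball/= !lt_min distrC.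
move=> /andP[/andP[xe xe'] /andP[xt xL]].
have x0L : 0 < x < L.
  move: xt xL; rewrite !ltr_norml => /andP[h1 h2] /andP[h3 h4].
  by apply/andP; split; lra.
rewrite distrC /diag.
have -> : j x (t - x) - j tau (t - tau) =
   (j x (t - x) - j tau (t - x)) + (j tau (t - x) - j tau (t - tau)) by ring.
rewrite (le_trans (ler_normD _ _))// [leRHS](splitr k) lerD//.
  exact: he.
apply: he'; have -> : t - x - (t - tau) = - (x - tau) by ring.
by rewrite normrN.
Qed.

Let mT : measurable (`]0, T]%classic : set Rm). Proof. exact: measurable_itv. Qed.

Let subTL : `]0, T]%classic `<=` `]0, L[%classic.
Proof.
by move=> x; rewrite /= !in_itv/= => /andP[-> h]; exact: le_lt_trans h TL.
Qed.

Let giT : lam.-integrable `]0, T] (EFin \o g).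
Proof.
exact: integrableS gi.
Qed.

Let diag_measurable t : measurable_fun (`]0, T]%classic : set Rm) (diag t).
Proof.
apply: (@measurable_funS _ _ _ _ (`]0, L[%classic : set Rm)) => //.
apply: open_continuous_measurable_fun; first exact: interval_open.
by move=> x; rewrite inE/= in_itv/= => h; exact: diag_continuous.
Qed.

Let diag_integrable t : lam.-integrable `]0, T] (EFin \o diag t).
Proof.
apply: (le_integrable mT _ _ giT); first exact/measurable_EFinP.
move=> x /subTL; rewrite /= in_itv/= => h; rewrite lee_fin.
by rewrite (le_trans (jb _ h))// ler_norm.
Qed.

Let diag_integrable_sub t : 0 <= t <= T -> lam.-integrable `]0, t] (EFin \o diag t).
Proof.
move=> /andP[t0 tT]; apply: integrableS (diag_integrable t).
- exact: mT.
- exact: measurable_itv.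
- by move=> x; rewrite /= !in_itv/= => /andP[-> h]; exact: le_trans h tT.
Qed.

Lemma convolution_integrable t : 0 <= t <= T ->
  lam.-integrable `[0, t[ (EFin \o (fun r => j (t - r) r)).
Proof.
move=> tT; have [h _] := integrable_reflect (diag_integrable_sub tT).
suff -> : (fun r => j (t - r) r) = (fun x => diag t (t - x)) by [].
by apply/funext => x; rewrite /diag; congr (j _ _); ring.
Qed.

Lemma convolution_open t : 0 <= t <= T ->
  convolution t = \int[lam]_(r in `[0, t[) j (t - r) r.
Proof.
by move=> /convolution_integrable h; rewrite /convolution -Rintegral_itv_bndo_bndc.
Qed.

Let convolution_diag t : 0 <= t <= T ->
  convolution t = \int[lam]_(tau in `]0, T]) (diag t \_ `]0, t]) tau.
Proof.
move=> tT; rewrite convolution_open//.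
have [_ h] := integrable_reflect (diag_integrable_sub tT).
rewrite -Rintegral_mkcondr (_ : `]0, T] `&` `]0, t] = `]0, t]%classic); last first.
  apply/setIidr => x; rewrite /= !in_itv/= => /andP[-> xt].
  by case/andP: tT => _; exact: le_trans xt.
rewrite -h; apply: eq_Rintegral => x _; rewrite /diag; congr (j _ _); ring.
Qed.

(** After the reflection [tau = t - r] the singularity of the kernel sits at
    the fixed time [tau = 0], so that dominated convergence applies. *)
Lemma continuous_convolution : continuous (fun t => convolution (clamp T t)).
Proof.
move=> t; apply: cvg_sequential => u ut.
have T0' := ltW T0.
have cu n := clamp_itv (u n) T0'; have ct := clamp_itv t T0'.
have cut : clamp T (u n) @[n --> \oo] --> clamp T t.
  exact: (cvg_comp _ _ ut (@continuous_clamp T t)).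
set s := clamp T t; have sT : 0 <= s <= T by exact: ct.
pose v n := clamp T (u n); have vT n : 0 <= v n <= T by exact: cu.
have {cut}vs : v n @[n --> \oo] --> s by exact: cut.
have mp s' : measurable_fun (`]0, T]%classic : set Rm) (diag s' \_ `]0, s']).
  apply/measurable_restrict; [exact: measurable_itv|exact: mT|].
  by apply: measurable_funS (diag_measurable s').
rewrite convolution_diag// (_ : (fun n => _) = (fun n =>
    \int[lam]_(tau in `]0, T]) (diag (v n) \_ `]0, v n]) tau)); last first.
  by apply/funext => n; rewrite -/(v n) convolution_diag.
have ae1 : {ae lam, forall x, `]0, T]%classic x ->
    (fun n => (diag (v n) \_ `]0, v n]) x) @ \oo --> (diag s \_ `]0, s]) x}.
  exists [set s]; split; [exact: measurable_set1|exact: lebesgue_measure_set1|].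
  move=> x /= /not_implyP[xT ncv]; apply: contrapT => xs; apply: ncv.
  have := subTL xT; rewrite /= in_itv/= => x0L; have /andP[x0 _] := x0L.
  have [xls|slx|//] := ltgtP x s.
  + rewrite patchE mem_set/= ?in_itv/= ?x0 ?(ltW xls)//.
    have : diag (v n) x @[n --> \oo] --> diag s x.
      have cc : v n - x @[n --> \oo] --> s - x by apply: cvgB => //; exact: cvg_cst.
      have jx : j x @ (s - x) --> j x (s - x) by exact: jr.
      exact: (@cvg_comp _ _ _ (fun n => v n - x) (j x) _ _ _ cc jx).
    apply: cvg_trans; apply: near_eq_cvg; near=> n.
    rewrite patchE mem_set//= in_itv/= x0/= ltW//; near: n.
    by have /cvgr_gt := vs; apply.
  + rewrite patchE memNset/= ?in_itv/= ?x0/=; last by apply/negP; rewrite -ltNge.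
    apply: (@cvg_trans _ (nbhs (0 : R))); last by [].
    apply/cvgrPdist_le => e e0; near=> n.
    rewrite patchE memNset/= ?subrr ?normr0 ?(ltW e0)//.
    rewrite in_itv/= x0/=; apply/negP; rewrite -ltNge; near: n.
    by have /cvgr_lt := vs; apply.
have ae2 : {ae lam, forall x, `]0, T]%classic x ->
    forall n, `|(diag (v n) \_ `]0, v n]) x| <= g x}.
  apply: aeW => x xT n; have := subTL xT; rewrite /= in_itv/= => x0L.
  rewrite patchE; case: ifP => _; first exact: jb.
  by rewrite normr0 (le_trans _ (jb 0 x0L)).
exact: (Rdominated_cvg mT (fun n => mp (v n)) (mp s) ae1 giT ae2).2.
Unshelve. all: by end_near. Qed.

End convolution.

(** * Kernels of positive type *)

Section quadratic_forms_on_lists.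
Context {R : comPzRingType} {I : Type}.
Implicit Types (k S : I -> I -> R) (l : seq (R * I)).

(** The value of the bilinear form of kernel [k] on two finitely supported
    measures, given as lists of weights and points; points may be repeated, and
    the sum of two measures is the concatenation of the lists. *)
Definition pairing k l l' : R :=
  \sum_(p <- l) \sum_(q <- l') p.1 * q.1 * k p.2 q.2.

Lemma pairing_catl k l1 l2 l : pairing k (l1 ++ l2) l = pairing k l1 l + pairing k l2 l.
Proof. by rewrite /pairing big_cat. Qed.

Lemma pairing_catr k l1 l2 l : pairing k l (l1 ++ l2) = pairing k l l1 + pairing k l l2.
Proof. by rewrite /pairing -big_split/=; apply: eq_bigr => p _; rewrite big_cat. Qed.

Lemma pairing_sym k l l' : (forall i j, k i j = k j i) -> pairing k l l' = pairing k l' l.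
Proof.
move=> ks; rewrite /pairing exchange_big; apply: eq_bigr => q _.
by apply: eq_bigr => p _; rewrite ks [p.1 * _]mulrC.
Qed.

Lemma pairing_linear a k k' l l' :
  pairing (fun i j => a * k i j + k' i j) l l' = a * pairing k l l' + pairing k' l l'.
Proof.
rewrite /pairing mulr_sumr -big_split/=; apply: eq_bigr => p _.
by rewrite mulr_sumr -big_split/=; apply: eq_bigr => q _; ring.
Qed.

Lemma pairing_sum (J : Type) (r : seq J) (k : J -> I -> I -> R) l l' :
  pairing (fun i j => \sum_(a <- r) k a i j) l l' = \sum_(a <- r) pairing (k a) l l'.
Proof.
rewrite /pairing [RHS]exchange_big/=; apply: eq_bigr => p _.
by rewrite [RHS]exchange_big/=; apply: eq_bigr => q _; rewrite mulr_sumr.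
Qed.

Lemma pairing_filter k (a : pred I) l :
  pairing (fun i j => (a i)%:R * (a j)%:R * k i j) l l =
  pairing k [seq p <- l | a p.2] [seq p <- l | a p.2].
Proof.
rewrite /pairing big_filter [RHS]big_mkcond/=; apply: eq_bigr => p _.
case: (a p.2); last first.
  by rewrite big1// => q _; rewrite !mul0r mulr0.
rewrite big_filter [RHS]big_mkcond/=; apply: eq_bigr => q _.
by case: (a q.2); rewrite ?mul1r ?mul0r ?mulr0.
Qed.

End quadratic_forms_on_lists.

Section convex_sequences.
Context {R : realFieldType}.

Lemma eq_pairing_in (k k' : nat -> nat -> R) (l l' : seq (R * nat)) :
  (forall p q, p \in l -> q \in l' -> k p.2 q.2 = k' p.2 q.2) ->
  pairing k l l' = pairing k' l l'.
Proof.
move=> kk'; rewrite /pairing big_seq [RHS]big_seq; apply: eq_bigr => p pl.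
by rewrite big_seq [RHS]big_seq; apply: eq_bigr => q ql; rewrite kk'.
Qed.

Lemma sum_window b lo hi : (hi <= b)%N ->
  (\sum_(a <- iota 0 b) ((lo <= a) && (a < hi))%N%:R = (hi - lo)%N%:R :> R).
Proof.
elim: b hi => [|b IH] hi hb.
  by rewrite big_nil; have -> : (hi - lo = 0)%N by lia.
rewrite -addn1 iotaD big_cat/= big_cons big_nil addr0 add0n.
have [hib|hib] := leqP hi b.
  by rewrite IH// andbF addr0.
have {hib}{hb}-> : hi = b.+1 by lia.
rewrite (eq_big_seq (fun a => ((lo <= a) && (a < b))%N%:R)); last first.
  by move=> a; rewrite mem_iota => ab; have -> : (a < b.+1)%N = (a < b)%N by lia.
rewrite IH// andbT -natrD; congr (_%:R).
by case: leqP => /= h; lia.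
Qed.

Definition dist (i j : nat) : nat := ((i - j) + (j - i))%N.

(** The triangle kernel counts the windows of length [m] containing both
    indices, hence it preserves positivity. *)
Lemma pairing_triangle_ge0 (S : nat -> nat -> R) m l :
  (forall l, 0 <= pairing S l l) ->
  0 <= pairing (fun i j => (m - dist i j)%N%:R * S i j) l l.
Proof.
move=> S0.
have [b hb] : exists b, forall p, p \in l -> (p.2 + m <= b)%N.
  elim: l => [|p l [b hb]]; first by exists 0%N.
  by exists (b + (p.2 + m))%N => q; rewrite inE => /predU1P[->|/hb h]; [exact: leq_addl|rewrite (leq_trans h)// leq_addr].
pose win a i := ((i <= a) && (a < i + m))%N.
rewrite (@eq_pairing_in _
  (fun i j => \sum_(a <- iota 0 b) (win a i)%:R * (win a j)%:R * S i j)).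
  rewrite pairing_sum; apply: sumr_ge0 => a _.
  by rewrite (pairing_filter S (win a)).
move=> p q /hb pb /hb qb; rewrite -mulr_suml; congr (_ * _).
have -> : (m - dist p.2 q.2 = (minn p.2 q.2 + m) - maxn p.2 q.2)%N.
  by rewrite /dist; lia.
rewrite -(@sum_window b (maxn p.2 q.2) (minn p.2 q.2 + m)); last first.
  by rewrite (leq_trans _ pb)// leq_add2r geq_minl.
apply: eq_bigr => a _; rewrite -natrM mulnb; congr (nat_of_bool _)%:R.
by rewrite /win; lia.
Qed.

(** Summation by parts, twice. *)
Lemma convex_decomposition (f : nat -> R) N k : (k <= N)%N ->
  f k = f N + (N - k)%N%:R * (f N - f N.+1) +
    \sum_(m < N) (m.+1 - k)%N%:R * (f m - 2 * f m.+1 + f m.+2).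
Proof.
elim: N => [|N IH] kN.
  by move: kN; rewrite leqn0 => /eqP ->; rewrite big_ord0 subnn mul0r !addr0.
have [{}kN|kN'] := leqP k N.
  rewrite IH// big_ord_recr/= subSn// -natr1; ring.
have -> : k = N.+1 by lia.
rewrite big1 ?subnn; first by rewrite mul0r !addr0.
move=> [i /= iN] _; have -> : (i.+1 - N.+1 = 0)%N by lia.
by rewrite mul0r.
Qed.

(** A convex, nonincreasing and nonnegative sequence of forms is a positive
    combination of triangle kernels. *)
Lemma pairing_convex_ge0 (A : nat -> nat -> nat -> R) n l : (0 < n)%N ->
  (forall m l, (m <= n)%N -> 0 <= pairing (A m) l l) ->
  (forall m l, (m < n)%N -> pairing (A m.+1) l l <= pairing (A m) l l) ->
  (forall m l, (m.+1 < n)%N ->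
     0 <= pairing (A m) l l - 2 * pairing (A m.+1) l l + pairing (A m.+2) l l) ->
  (forall p, p \in l -> (p.2 < n)%N) ->
  0 <= pairing (fun i j => A (dist i j) i j) l l.
Proof.
case: n => // N _ A0 A1 A2 ln.
pose D i j := (-1) * A N.+1 i j + A N i j.
pose S m i j := (-2) * A m.+1 i j + (A m i j + A m.+2 i j).
have pD l' : 0 <= pairing D l' l'.
  by rewrite pairing_linear mulN1r addrC subr_ge0; apply: A1.
have pS m l' : (m < N)%N -> 0 <= pairing (S m) l' l'.
  move=> mN; rewrite pairing_linear.
  rewrite [X in _ + X](_ : _ = 1 * pairing (A m) l' l' + pairing (A m.+2) l' l').
    by have := A2 m l' mN; lra.
  by rewrite -pairing_linear; congr (pairing _ _ _); apply/funext => i;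
    apply/funext => j; rewrite mul1r.
rewrite (@eq_pairing_in _ (fun i j => 1 * A N i j +
    (1 * ((N - dist i j)%N%:R * D i j) +
     \sum_(m <- index_iota 0 N) (m.+1 - dist i j)%N%:R * S m i j))).
  rewrite pairing_linear pairing_linear !mul1r addr_ge0//; first by exact: A0.
  rewrite addr_ge0//; first exact: pairing_triangle_ge0.
  rewrite pairing_sum big_seq; apply: sumr_ge0 => m.
  rewrite mem_index_iota => /andP[_ mN].
  by apply: (@pairing_triangle_ge0 (S m)) => l'; exact: pS.
move=> p q /ln pN /ln qN.
rewrite [LHS](@convex_decomposition (fun m => A m p.2 q.2) N); last first.
  by rewrite /dist; move: (p.2) (q.2) pN qN => a b; lia.
rewrite big_mkord !mul1r addrA; congr (_ + _ + _); first by rewrite /D; ring.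
by apply: eq_bigr => m _; rewrite /S; ring.
Qed.

End convex_sequences.

(** * Double integrals of positive kernels *)

Section riemann_sums.
Context {R : realType}.
Implicit Types (f : R -> R) (s t : R).

Definition riemann_grid s n : seq (R * nat) :=
  [seq (s / (2 ^ n)%:R, i) | i <- iota 0 (2 ^ n)].

Definition grid_points s n (l : seq (R * nat)) : seq (R * R) :=
  [seq (p.1, s / (2 ^ n)%:R * p.2%:R) | p <- l].

Lemma continuous_uniform_itv f s k : continuous f -> 0 < k ->
  exists2 e, 0 < e & forall x y, 0 <= x <= s -> `|x - y| < e -> `|f y - f x| <= k.
Proof.
move=> cf k0; have := @segment_compact R 0 s.
move=> /compact_near_coveringP/(_ R (0^'+) (fun e x => forall y, `|x - y| < e -> `|f y - f x| <= k)) [].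
  move=> x _; have [e e0 he] := continuous_near x cf (divr_gt0 k0 (ltr0n _ 2)).
  have e2 : 0 < e / 2 by rewrite divr_gt0.
  exists (ball x (e / 2), [set e' | 0 < e' < e / 2]) => /=.
    split; first exact: nbhsx_ballx.
    by near=> z; apply/andP; split; [near: z; exact: nbhs_right_gt|near: z; exact: nbhs_right_lt].
  move=> [z e'] [/=]; rewrite /ball/= => xz /andP[_ e'e] y zy.
  have -> : f y - f z = (f y - f x) - (f z - f x) by ring.
  rewrite (le_trans (ler_normB _ _))// [leRHS](splitr k) lerD// he//.
    have -> : y - x = - ((x - z) + (z - y)) by ring.
    rewrite normrN (le_lt_trans (ler_normD _ _))// [ltRHS](splitr e) ltrD//.
    exact: lt_trans zy e'e.
  by rewrite distrC (lt_trans xz)// ltr_pdivrMr// ltr_pMr// ltr1n.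
move=> e /= e0 he; exists (e / 2); first by rewrite divr_gt0.
have e2 : 0 < e / 2 by rewrite divr_gt0.
have be : ball (0 : R) e (e / 2).
  by rewrite /ball/= sub0r normrN gtr0_norm// ltr_pdivrMr// ltr_pMr// ltr1n.
by move=> x y xs xy; have := he (e / 2) be e2 x; rewrite /= in_itv/=; apply.
Unshelve. all: by end_near. Qed.

Lemma riemann_sum_error f s k e N : continuous f -> 0 <= s ->
  (forall x y, 0 <= x <= s -> `|x - y| < e -> `|f y - f x| <= k) ->
  s < e * N.+1%:R -> forall n, (n <= N.+1)%N ->
  `|primitive f (s / N.+1%:R * n%:R) -
    \sum_(i <- iota 0 n) s / N.+1%:R * f (s / N.+1%:R * i%:R)| <= s / N.+1%:R * n%:R * k.
Proof.
move=> cf s0 fk sN; set w := s / N.+1%:R.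
have w0 : 0 <= w by rewrite divr_ge0.
have we : w < e by rewrite /w ltr_pdivrMr.
elim=> [|n IH] nN; first by rewrite big_nil mulr0 primitive0// subr0 normr0 mul0r.
have -> : iota 0 n.+1 = iota 0 n ++ [:: n] by rewrite -addn1 iotaD.
rewrite big_cat/= big_cons big_nil addr0.
set A := \sum_(_ <- _) _; set x := w * n%:R.
have -> : w * n.+1%:R = x + w by rewrite -natr1 mulrDr mulr1.
have -> : primitive f (x + w) - (A + w * f x) = (primitive f x - A) +
  (primitive f (x + w) - primitive f x - (x + w - x) * f x) by ring.
rewrite [leRHS]mulrDl (le_trans (ler_normD _ _))// lerD//; first by apply: IH; exact: ltnW.
have x0 : 0 <= x by rewrite mulr_ge0.
have xs : x <= s.
  by rewrite /x /w mulrAC ler_pdivrMr// ler_wpM2l// ler_nat ltnW.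
rewrite (le_trans (@primitive_bound _ f x (x + w) (f x) k cf x0 _ _))//.
- by rewrite lerDl.
- move=> y /andP[xy yw]; apply: fk; first by rewrite x0.
  rewrite distrC ger0_norm ?subr_ge0//; apply: le_lt_trans we.
  by rewrite lerBlDl.
- by rewrite addrAC subrr add0r.
Qed.

Lemma riemann_cvg f s : continuous f -> 0 <= s ->
  (fun n => \sum_(p <- grid_points s n (riemann_grid s n)) p.1 * f p.2) @ \oo -->
  primitive f s.
Proof.
move=> cf s0; apply/cvgrPdist_le => k k0.
have k1 : 0 < k / (s + 1) by rewrite divr_gt0// ltr_wpDl.
have [e e0 he] := continuous_uniform_itv s cf k1.
near=> n; rewrite big_map big_map/=.
have n2 : (0 < 2 ^ n)%N by rewrite expn_gt0.
have := @riemann_sum_error f s _ e (2 ^ n).-1 cf s0 he; rewrite prednK// => h.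
have := h _ (2 ^ n)%N (leqnn _).
rewrite divfK ?pnatr_eq0 -?lt0n// => /(_ _)/le_trans; apply.
  rewrite mulrC -ltr_pdivrMr//; apply: (@lt_le_trans _ _ n%:R).
    near: n; exact: nbhs_infty_gtr.
  by rewrite ler_nat ltnW// ltn_expl.
rewrite mulrCA ler_piMr ?(ltW k0)// ler_pdivrMr ?ltr_wpDl// mul1r lerDl//.
Unshelve. all: by end_near. Qed.

(** Dyadic grids, because two of them have a common refinement: concatenations
    of Riemann sums stay on a grid. *)
Definition gridded s (l : seq (R * R)) := exists n (l' : seq (R * nat)),
  l = grid_points s n l' /\ forall p, p \in l' -> (p.2 < 2 ^ n)%N.

Lemma gridded_riemann s n : gridded s (grid_points s n (riemann_grid s n)).
Proof.
exists n, (riemann_grid s n); split=> // p /mapP[i]; rewrite mem_iota => iI -> /=.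
by case/andP: iI.
Qed.

Let grid_refine s n m (l : seq (R * nat)) :
  grid_points s n l = grid_points s (n + m) [seq (p.1, (p.2 * 2 ^ m)%N) | p <- l].
Proof.
rewrite /grid_points -map_comp; apply: eq_map => p /=; congr (_, _).
have h j : (2 ^ j)%:R != 0 :> R by rewrite pnatr_eq0 -lt0n expn_gt0.
have := h m; have := h n.
by rewrite expnD !natrM => h1 h2; field; rewrite h1 h2.
Qed.

Lemma gridded_cat s l1 l2 : gridded s l1 -> gridded s l2 -> gridded s (l1 ++ l2).
Proof.
move=> [n [l [-> ln]]] [m [l' [-> lm]]].
rewrite (@grid_refine s n m) (@grid_refine s m n) [(m + n)%N]addnC /grid_points -map_cat.
eexists; eexists; split; first by reflexivity.
move=> p; rewrite mem_cat => /orP[] /mapP[q /= ql ->] /=.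
  by rewrite expnD ltn_pmul2r ?expn_gt0// ln.
by rewrite addnC expnD ltn_pmul2r ?expn_gt0// lm.
Qed.

End riemann_sums.

Section positive_double_integral.
Context {R : realType}.
Variables (k : R -> R -> R) (s M : R).
Hypotheses (s0 : 0 <= s) (ksym : forall x y, k x y = k y x)
  (kc : forall x, continuous (k x)) (kM : forall x y, `|k x y| <= M).

Let S n : seq (R * R) := grid_points s n (riemann_grid s n).
Let G x := primitive (k x) s.

Lemma bounded_cvg_primitive (f_ : (R -> R)^nat) (f : R -> R) (c : R) : (forall n, continuous (f_ n)) ->
  continuous f -> (forall n x, `|f_ n x| <= c) ->
  (forall x : R, 0 <= x <= s -> (fun n => f_ n x) @ \oo --> f x) ->
  (fun n => primitive (f_ n) s) @ \oo --> primitive f s.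
Proof.
move=> cf_ cf fc ff.
have mI : measurable (`[0, s]%classic : set (measurableTypeR R)) by exact: measurable_itv.
have mc (h : R -> R) : continuous h -> measurable_fun (`[0, s]%classic : set (measurableTypeR R)) h.
  by move=> /continuous_measurable_fun ch; apply: measurable_funS ch.
have ae1 : {ae (@lebesgue_measure R), forall x, `[0, s]%classic x ->
    (fun n => f_ n x) @ \oo --> f x}.
  by apply: aeW => x; rewrite /= in_itv/= => xI; exact: ff.
have ae2 : {ae (@lebesgue_measure R), forall x, `[0, s]%classic x ->
    forall n, `|f_ n x| <= cst c x} by apply: aeW => x _ n; exact: fc.
have ci : (@lebesgue_measure R).-integrable `[0, s] (EFin \o cst c).
  by apply: integrable_itv => x; exact: cvg_cst.
exact: (Rdominated_cvg mI (fun n => mc _ (cf_ n)) (mc _ cf) ae1 ci ae2).2.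
Qed.

Lemma continuous_partial_integral : continuous (fun t => primitive (k t) s).
Proof.
move=> t; apply: cvg_sequential => u ut.
apply: (@bounded_cvg_primitive (fun n => k (u n)) (k t) M) => // x _.
have kx : k x @ t --> k x t by exact: kc.
have := @cvg_comp _ _ _ u (k x) _ _ _ ut kx.
by rewrite ksym (_ : (fun n => k (u n) x) = k x \o u)//; apply/funext => n; exact: ksym.
Qed.

Let pairing_S_cvg l : (fun n => pairing k l (S n)) @ \oo --> \sum_(p <- l) p.1 * G p.2.
Proof.
rewrite /pairing; elim: l => [|p l IH].
  by under eq_fun do rewrite big_nil; rewrite big_nil; exact: cvg_cst.
under eq_fun do rewrite big_cons; rewrite big_cons; apply: cvgD IH.
have -> : (fun n => \sum_(q <- S n) p.1 * q.1 * k p.2 q.2) =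
    (fun n => p.1 * \sum_(q <- S n) q.1 * k p.2 q.2).
  by apply/funext => n; rewrite mulr_sumr; apply: eq_bigr => q _; rewrite mulrA.
have h := riemann_cvg (@kc p.2) s0.
by apply: cvgM; [exact: cvg_cst|exact: h].
Qed.

Lemma riemann_weights n : \sum_(p <- S n) `|p.1| = s.
Proof.
rewrite big_map big_map/= big_const_seq count_predT size_iota iter_addr_0.
by rewrite ger0_norm ?divr_ge0// -[LHS]mulr_natr divfK// pnatr_eq0 -lt0n expn_gt0.
Qed.

Let pairing_SS n : pairing k (S n) (S n) <= s ^+ 2 * M.
Proof.
rewrite (le_trans (ler_norm _))//.
have sS := riemann_weights n.
have -> : s ^+ 2 * M = \sum_(p <- S n) \sum_(q <- S n) `|p.1| * (`|q.1| * M).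
  rewrite expr2 -mulrA -{1}sS mulr_suml; apply: eq_bigr => p _.
  by rewrite -mulr_sumr -mulr_suml sS.
rewrite (le_trans (ler_norm_sum _ _ _))//; apply: ler_sum => p _.
rewrite (le_trans (ler_norm_sum _ _ _))//; apply: ler_sum => q _.
by rewrite !normrM -mulrA ler_wpM2l// ler_wpM2l.
Qed.

(** Were the integral equal to [- a < 0], concatenating [K] Riemann sums chosen
    one after the other would give a list on which the quadratic form is at most
    [K * (s ^+ 2 * M + a / 2) - 3 / 4 * a * K * (K - 1)], where the first term
    bounds the [K] diagonal blocks and the errors. *)
Lemma double_integral_ge0 :
  (forall l, gridded s l -> 0 <= pairing k l l) ->
  0 <= primitive (fun t => primitive (k t) s) s.
Proof.
move=> k0; rewrite leNgt; apply/negP => A0.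
set A := primitive _ s in A0; pose a := - A; have a0 : 0 < a by rewrite oppr_gt0.
pose L (l : seq (R * R)) := \sum_(p <- l) p.1 * G p.2.
have LS : (fun n => L (S n)) @ \oo --> A.
  exact: (riemann_cvg continuous_partial_integral s0).
have [T hT] : exists T : nat -> seq (R * R), forall K : nat,
    [/\ gridded s (T K), L (T K) <= - (3 / 4 * K%:R * a) &
        pairing k (T K) (T K) <= K%:R * (s ^+ 2 * M + a / 2) - 3 / 4 * a * K%:R * (K%:R - 1)].
  suff h (K : nat) : exists l, [/\ gridded s l, L l <= - (3 / 4 * K%:R * a) &
      pairing k l l <= K%:R * (s ^+ 2 * M + a / 2) - 3 / 4 * a * K%:R * (K%:R - 1)].
    by have [T hT] := choice h; exists T.
  elim: K => [|K [l [gl Ll Ql]]].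
    exists [::]; split.
    - by exists 0%N, [::].
    - by rewrite /L big_nil mulr0 mul0r oppr0.
    - by rewrite /pairing big_nil !(mul0r, mulr0) subr0.
  have [n [nL nQ]] : exists n, L (S n) <= - (3 / 4 * a) /\
      pairing k l (S n) <= L l + a / 4.
    have h1 : A < - (3 / 4 * a) by rewrite /a in a0 *; lra.
    have h2 : \sum_(p <- l) p.1 * G p.2 < L l + a / 4 by rewrite ltrDl divr_gt0.
    near \oo => n; exists n; split; apply: ltW; near: n.
      by have /cvgr_lt := LS; apply.
    by have /cvgr_lt := @pairing_S_cvg l; apply.
  exists (l ++ S n); split.
  - by apply: gridded_cat => //; exact: gridded_riemann.
  - by rewrite /L big_cat/= -/(L l) -/(L (S n)) -natr1; lra.
  - rewrite pairing_catl !pairing_catr (pairing_sym (S n) l ksym) -natr1.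
    have := pairing_SS n; move: (s ^+ 2 * M) Ql => C.
    move: (pairing k l l) (pairing k l (S n)) nQ Ll => x y.
    move: (pairing k (S n) (S n)) (L l) => z w h1 h2 h3 h4.
    have : y <= - (3 / 4 * K%:R * a) + a / 4 by rewrite (le_trans h1)// lerD2r.
    nra.
(* For a large number of blocks the upper bound is negative. *)
pose C := s ^+ 2 * M + a / 2; pose q := C / (3 / 4 * a) + 1.
have [K hK] : exists K : nat, q < K%:R.
  near \oo => n; exists n; near: n; exact: nbhs_infty_gtr.
have [gT _] := hT K; apply/negP; rewrite -ltNge; apply: lt_le_trans (k0 _ gT).
have M0 : 0 <= M by exact: le_trans (normr_ge0 _) (kM 0 0).
have C0 : 0 <= C.
  by apply: addr_ge0; [exact: mulr_ge0 (sqr_ge0 s) M0|exact: ltW (divr_gt0 a0 (ltr0n _ 2))].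
have X0 : 0 < 3 / 4 * a by rewrite mulr_gt0// divr_gt0.
have K1 : 0 < K%:R - 1 - C / (3 / 4 * a) by move: hK; rewrite /q; lra.
have KC : C < (K%:R - 1) * (3 / 4 * a) by rewrite -ltr_pdivrMr//; lra.
have Kpos : 0 < K%:R :> R by apply: le_lt_trans hK; rewrite addr_ge0// divr_ge0// ltW.
have -> : 3 / 4 * a * K%:R * (K%:R - 1) = K%:R * ((K%:R - 1) * (3 / 4 * a)) by ring.
by rewrite subr_lt0 ltr_pM2l.
Unshelve. all: by end_near. Qed.

End positive_double_integral.

Section triangle.
Context {R : realType}.
Implicit Types (f : R -> R).

Lemma primitive_lipschitz f M a b : continuous f -> (forall x, `|f x| <= M) ->
  `|primitive f b - primitive f a| <= M * `|b - a|.
Proof.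
move=> cf fM; have M0 : 0 <= M by exact: le_trans (normr_ge0 _) (fM 0).
wlog ab : a b / a <= b => [wh|].
  by have [/wh//|/ltW/wh] := leP a b; rewrite distrC [`|a - b|]distrC.
have pos x y : 0 <= x -> x <= y -> `|primitive f y - primitive f x| <= M * `|y - x|.
  move=> x0 xy; have := @primitive_bound _ f x y 0 M cf x0 xy.
  rewrite mulr0 subr0 [`|y - x|]ger0_norm ?subr_ge0// mulrC; apply => z _.
  by rewrite subr0.
have [a0|/ltW a0] := leP 0 a; first exact: pos.
have [b0|/ltW b0] := leP 0 b; last first.
  by rewrite !primitive0// subrr normr0 mulr_ge0.
rewrite [primitive f a]primitive0// -(primitive0 f (lexx 0)).
rewrite (le_trans (pos _ _ _ b0))// ler_wpM2l// !ger0_norm ?subr_ge0//.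
by rewrite lerD2l lerN2.
Qed.

Lemma primitive_bound_sym f a b c k : continuous f -> 0 <= a -> 0 <= b ->
  (forall x, `|x - a| <= `|b - a| -> `|f x - c| <= k) ->
  `|primitive f b - primitive f a - (b - a) * c| <= `|b - a| * k.
Proof.
move=> cf a0 b0 fk; have [ab|/ltW ba] := leP a b.
  rewrite [`|b - a|]ger0_norm ?subr_ge0//; apply: primitive_bound => // x /andP[ax xb].
  by apply: fk; rewrite !ger0_norm ?subr_ge0// lerD2r.
have -> : primitive f b - primitive f a - (b - a) * c =
  - (primitive f a - primitive f b - (a - b) * c) by ring.
rewrite normrN [`|b - a|]distrC [`|a - b|]ger0_norm ?subr_ge0//.
apply: primitive_bound => // x /andP[bx xa].
by apply: fk; rewrite distrC [`|b - a|]distrC !ger0_norm ?subr_ge0// lerD2l lerN2.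
Qed.

Lemma is_derive_linear_approximation f (t l : R) :
  (forall e : R, 0 < e -> exists2 r : R, 0 < r & forall u, `|u - t| < r ->
     `|f u - f t - (u - t) * l| <= e * `|u - t|) -> is_derive t 1 f l.
Proof.
move=> fl; apply: is_derive_cvg; apply/cvgrPdist_le => e e0.
have [r r0 hr] := fl e e0; near=> h.
have h0 : h != 0 by near: h; exact: nbhs_dnbhs_neq.
rewrite [h *: 1]mulr1 /GRing.scale/= distrC.
have -> : h^-1 * (f (h + t) - f t) - l = h^-1 * (f (h + t) - f t - h * l).
  by field.
rewrite normrM normfV -ler_pdivlMl ?invr_gt0 ?normr_gt0// invrK [leRHS]mulrC.
have := hr (h + t); rewrite addrK; apply; near: h; exact: dnbhs0_lt.
Unshelve. all: by end_near. Qed.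

Variables (k : R -> R -> R) (M : R).
Hypotheses (ksym : forall x y, k x y = k y x)
  (kc : forall x, continuous (k x)) (kM : forall x y, `|k x y| <= M).

Let G a t := primitive (k t) a.

Let G_continuous a : continuous (G a).
Proof.
exact: (@continuous_partial_integral R k a M ksym kc kM).
Qed.

Let M0 : 0 <= M. Proof. exact: le_trans (normr_ge0 _) (kM 0 0). Qed.

Let G_lipschitz a b t : `|G b t - G a t| <= M * `|b - a|.
Proof. exact: primitive_lipschitz. Qed.

Let primitive_sum (l : seq (R * R)) a :
  continuous (fun x => \sum_(p <- l) p.1 * k p.2 x) /\
  primitive (fun x => \sum_(p <- l) p.1 * k p.2 x) a =
  \sum_(p <- l) p.1 * primitive (k p.2) a.
Proof.
elim: l => [|p l [IH1 IH2]].
  split; first by under eq_fun do rewrite big_nil; move=> x; exact: cvg_cst.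
  under eq_fun do rewrite big_nil.
  by rewrite big_nil /primitive /Rintegral integral0_eq.
split.
  under eq_fun do rewrite big_cons.
  by move=> x; exact: cvgD (cvgM (cvg_cst _) (@kc p.2 x)) (IH1 x).
under eq_fun do rewrite big_cons -[\sum_(_ <- _) _]mul1r.
by rewrite (primitive_linear p.1 1 a (@kc p.2) IH1) IH2 big_cons mul1r.
Qed.

(** Fubini's theorem on a rectangle, by Riemann sums in one of the variables. *)
Lemma rectangle_swap (a b : R) : 0 <= a -> 0 <= b ->
  primitive (G a) b = primitive (G b) a.
Proof.
move=> a0 b0.
pose S n := grid_points b n (riemann_grid b n).
have h1 : (fun n => \sum_(p <- S n) p.1 * G a p.2) @ \oo --> primitive (G a) b.
  exact: (riemann_cvg (@G_continuous a) b0).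
have h2 : (fun n => primitive (fun x => \sum_(p <- S n) p.1 * k p.2 x) a) @ \oo -->
    primitive (G b) a.
  apply: (@bounded_cvg_primitive _ _ (fun n x => \sum_(p <- S n) p.1 * k p.2 x) (G b) (b * M)).
  - by move=> n; exact: (primitive_sum _ _).1.
  - exact: G_continuous.
  - move=> n x; rewrite (le_trans (ler_norm_sum _ _ _))//.
    rewrite -(riemann_weights b0 n) mulr_suml; apply: ler_sum => p _.
    by rewrite normrM ler_wpM2l.
  - move=> x _; have := riemann_cvg (@kc x) b0.
    rewrite (_ : (fun n => \sum_(p <- S n) p.1 * k p.2 x) =
      (fun n => \sum_(p <- S n) p.1 * k x p.2))//.
    by apply/funext => n; apply: eq_bigr => p _; rewrite ksym.
rewrite (_ : (fun n => _) = (fun n => \sum_(p <- S n) p.1 * G a p.2)) in h2; last first.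
  by apply/funext => n; rewrite (primitive_sum _ _).2.
by rewrite -(cvg_lim _ h1)// -(cvg_lim _ h2).
Qed.

Let D t := G t t.

Lemma continuous_triangle : continuous (fun t => primitive (k t) t).
Proof.
move=> t; apply/cvgrPdist_le => e e0.
have [r r0 hr] := continuous_near t (@G_continuous t) (divr_gt0 e0 (ltr0n _ 2)).
have M1 : 0 < 2 * (M + 1) by rewrite mulr_gt0// ltr_wpDl.
apply/nbhs_ballP; exists (Num.min r (e / (2 * (M + 1)))) => [|u].
  by rewrite /= lt_min r0 divr_gt0.
rewrite /ball/= lt_min distrC => /andP[ur ue].
rewrite -/(D t) -/(D u).
have -> : D t - D u = - ((D u - G t u) + (G t u - G t t)) by rewrite /D; ring.
rewrite normrN (le_trans (ler_normD _ _))// [leRHS](splitr e) lerD//; last exact: hr.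
rewrite (le_trans (G_lipschitz _ _ _))// ltW//.
move: ue; rewrite ltr_pdivlMr// => ue; rewrite ltr_pdivlMr//.
apply: le_lt_trans ue; have := normr_ge0 (u - t); lra.
Qed.

Let square a := primitive (G a) a.

Let square_derive (t : R) : 0 < t -> is_derive t 1 square (2 * D t).
Proof.
move=> t0; apply: is_derive_linear_approximation => e e0.
have [r r0 hr] := continuous_near t (@G_continuous t) (divr_gt0 e0 (ltr0n _ 4)).
have M1 : 0 < 4 * (M + 1) by rewrite mulr_gt0// ltr_wpDl.
exists (Num.min (Num.min r t) (e / (4 * (M + 1)))) => [|u].
  by rewrite !lt_min r0 t0 divr_gt0.
rewrite !lt_min => /andP[/andP[ur ut] ue].
have u0 : 0 <= u by move: ut; rewrite ltr_norml => /andP[h _]; lra.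
have Mu : M * `|u - t| <= e / 4.
  rewrite ltW//; move: ue; rewrite !ltr_pdivlMr// => ue.
  apply: le_lt_trans ue; have := normr_ge0 (u - t); lra.
have -> : square u - square t - (u - t) * (2 * D t) =
    (primitive (G u) u - primitive (G u) t - (u - t) * D t) +
    (primitive (G t) u - primitive (G t) t - (u - t) * D t).
  have sw := @rectangle_swap u t u0 (ltW t0).
  rewrite /square sw; move: (primitive (G u) u) (primitive (G t) u) (primitive (G t) t).
  by move: (D t) => w x y z; ring.
have -> : e * `|u - t| = `|u - t| * (e / 2) + `|u - t| * (e / 2) by field.
have near_D x : `|x - t| <= `|u - t| -> `|G t x - D t| <= e / 4.
  by move=> xu; apply: hr; exact: le_lt_trans xu ur.
have e42 : e / 4 + e / 4 = e / 2 by field.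
rewrite (le_trans (ler_normD _ _))// lerD//; apply: primitive_bound_sym => //.
- exact: ltW.
- move=> x /near_D xt; have -> : G u x - D t = (G u x - G t x) + (G t x - D t) by ring.
  rewrite (le_trans (ler_normD _ _))// -e42 lerD//.
  exact: le_trans (G_lipschitz _ _ _) Mu.
- exact: ltW.
- by move=> x /near_D xt; rewrite (le_trans xt)// -e42 lerDl divr_ge0// ltW.
Qed.

Let square_continuous : continuous square.
Proof.
have G_bound a x : `|G a x| <= M * `|a|.
  by have := G_lipschitz 0 a x; rewrite /G [primitive _ 0]primitive0// !subr0.
move=> t; apply/cvgrPdist_le => e e0.
have C0 : 0 < M * (2 * `|t| + 1) + 1 by rewrite ltr_wpDl// mulr_ge0// addr_ge0// mulr_ge0.
apply/nbhs_ballP; exists (Num.min 1 (e / (M * (2 * `|t| + 1) + 1))) => [|u].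
  by rewrite /= lt_min ltr01 divr_gt0.
rewrite /ball/= lt_min distrC => /andP[u1 ue].
have ut : `|u| <= `|t| + 1.
  have -> : u = t + (u - t) by ring.
  by rewrite (le_trans (ler_normD _ _))// lerD2l ltW.
have h1 : `|primitive (G u) u - primitive (G u) t| <= M * `|u| * `|u - t|.
  by apply: primitive_lipschitz => // x; exact: G_bound.
have h2 : `|primitive (G u) t - primitive (G t) t| <= M * `|u - t| * `|t|.
  have := primitive_linear 1 (-1) t (@G_continuous u) (@G_continuous t).
  rewrite mul1r mulN1r => <-.
  have cc : continuous (fun x => 1 * G u x + -1 * G t x).
    move=> x; exact: cvgD (cvgM (cvg_cst _) (@G_continuous u x))
      (cvgM (cvg_cst _) (@G_continuous t x)).
  have := @primitive_lipschitz _ (M * `|u - t|) 0 t cc.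
  rewrite [primitive _ 0]primitive0// !subr0; apply => x.
  by rewrite mul1r mulN1r.
have -> : square t - square u = - ((primitive (G u) u - primitive (G u) t) +
  (primitive (G u) t - primitive (G t) t)).
  rewrite /square; move: (primitive (G u) u) (primitive (G u) t) (primitive (G t) t).
  by move=> x y z; ring.
rewrite normrN (le_trans (ler_normD _ _))// (le_trans (lerD h1 h2))//.
move: ue; rewrite ltr_pdivlMr// => /ltW; apply: le_trans.
have := normr_ge0 (u - t); have := normr_ge0 t; move: `|t| `|u| `|u - t| ut => x y w yx x0 w0.
have h : M * y * w <= M * (x + 1) * w by rewrite ler_wpM2r// ler_wpM2l.
have -> : w * (M * (2 * x + 1) + 1) = M * (x + 1) * w + (M * w * x + w) by ring.
by rewrite lerD// lerDl.
Qed.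

(** Both sides vanish at zero and, by [rectangle_swap], have the same derivative. *)
Lemma square_triangle (s : R) : 0 < s ->
  primitive (fun t => primitive (k t) s) s = 2 * primitive (fun t => primitive (k t) t) s.
Proof.
move=> s0.
have cD2 : continuous (fun t => 2 * D t) by move=> x; exact: cvgM (cvg_cst _) (@continuous_triangle x).
have h := @continuous_FTC2' R (fun t => 2 * D t) square s s0 cD2 square_continuous.
transitivity (square s - square 0).
  by rewrite [square 0]primitive0// subr0.
have dsq t : 0 < t < s -> is_derive t 1 square (2 * D t).
  by move=> /andP[t0 _]; exact: square_derive.
rewrite -(h dsq).
have mI : measurable (`[0, s]%classic : set (measurableTypeR R)) by exact: measurable_itv.
exact: (RintegralZl 2 mI (integrable_itv 0 s continuous_triangle)).
Qed.

End triangle.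

(** * Convolution kernels of positive type *)

Section convolution_positive.
Context {R : realType}.
Local Notation lam := (@lebesgue_measure R).
Local Notation Rm := (measurableTypeR R).
Variables (T L : R) (g : R -> R) (K : R -> R -> R -> R).
Hypotheses (T0 : 0 < T) (TL : T < L)
  (gi : lam.-integrable `]0, L[ (EFin \o g))
  (Ksym : forall tau r t : R, 0 < tau < L -> K tau r t = K tau t r)
  (Kb : forall tau r t : R, 0 < tau < L -> `|K tau r t| <= g tau)
  (Kr : forall tau t : R, 0 < tau < L -> continuous (K tau t))
  (Ktau : forall tau e : R, 0 < tau < L -> 0 < e -> exists2 a : R, 0 < a &
     forall tau', `|tau' - tau| < a -> 0 < tau' < L ->
     forall r t, `|K tau' r t - K tau r t| <= e)
  (K0 : forall (tau : R) l, 0 < tau < L -> 0 <= pairing (K tau) l l)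
  (K1 : forall (tau tau' : R) l, 0 < tau -> tau <= tau' -> tau' < L ->
     pairing (K tau') l l <= pairing (K tau) l l)
  (K2 : forall (tau h : R) l, 0 < tau -> 0 < h -> tau + 2 * h < L ->
     0 <= pairing (K tau) l l - 2 * pairing (K (tau + h)) l l +
          pairing (K (tau + 2 * h)) l l).

Let K_diag tau r : pairing (K tau) [:: (1, r)] [:: (1, r)] = K tau r r.
Proof. by rewrite /pairing !big_seq1 !mul1r. Qed.

Let K_polar tau r t : 0 < tau < L -> `|K tau r t| <= (K tau r r + K tau t t) / 2.
Proof.
move=> tL.
have h (c : R) : 0 <= K tau r r + 2 * c * K tau r t + c ^+ 2 * K tau t t.
  have := K0 [:: (1, r); (c, t)] tL.
  by rewrite /pairing !big_cons !big_nil/= (Ksym t r tL) => /le_trans; apply; lra.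
have := h 1; have := h (-1); rewrite ler_norml => h1 h2.
by apply/andP; split; lra.
Qed.

(** A positive form is controlled by its diagonal, and the diagonal decreases
    with the lag: the bound [g tau] holds for all later lags. *)
Let K_dominated tau tau' r t : 0 < tau -> tau <= tau' -> tau' < L ->
  `|K tau' r t| <= g tau.
Proof.
move=> t0 tt tL.
have h x : K tau' x x <= g tau.
  have := K1 [:: (1, x)] t0 tt tL; rewrite !K_diag => /le_trans; apply.
  by rewrite (le_trans (ler_norm _))// Kb// t0 (le_lt_trans tt).
rewrite (le_trans (@K_polar _ r t _)) ?(lt_le_trans t0)//.
by have := h r; have := h t; lra.
Qed.

(** The lag is shifted by [e > 0] away from the singularity of [K], and made
    symmetric in the two times. *)
Let shifted s e x y := K (`|clamp s y - clamp s x| + e) x y.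

Section shift.
Variables (s e : R).
Hypotheses (s0 : 0 < s) (sT : s <= T) (e0 : 0 < e) (eL : e < L - T).

Let lag_itv x y : e <= `|clamp s y - clamp s x| + e < L.
Proof.
have /andP[x0 xs] := clamp_itv x (ltW s0); have /andP[y0 ys] := clamp_itv y (ltW s0).
rewrite lerDr normr_ge0/=.
have : `|clamp s y - clamp s x| <= s by rewrite ler_norml; apply/andP; split; lra.
by move: eL sT; lra.
Qed.

Lemma shifted_sym x y : shifted s e x y = shifted s e y x.
Proof.
have /andP[h1 h2] := lag_itv x y.
by rewrite /shifted Ksym 1?distrC// distrC (lt_le_trans e0 h1).
Qed.

Lemma shifted_bound x y : `|shifted s e x y| <= g e.
Proof. by have /andP[h1 h2] := lag_itv x y; apply: K_dominated. Qed.

Lemma shifted_continuous x : continuous (shifted s e x).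
Proof.
move=> y; apply/cvgrPdist_le => k k0.
have k2 : 0 < k / 2 by rewrite divr_gt0.
have lagL z : 0 < `|clamp s z - clamp s x| + e < L.
  by have /andP[h1 ->] := lag_itv x z; rewrite (lt_le_trans e0 h1).
have [a a0 ha] := Ktau (lagL y) k2.
have [b b0 hb] := continuous_near y (@Kr _ x (lagL y)) k2.
have [c c0 hc] := continuous_near y (@continuous_clamp R s) (divr_gt0 a0 (ltr0n _ 2)).
apply/nbhs_ballP; exists (Num.min b c) => [|z]; first by rewrite /= lt_min b0.
rewrite /ball/= lt_min distrC => /andP[zb zc].
rewrite distrC /shifted.
set u := `|clamp s z - _| + e; set v := `|clamp s y - _| + e.
have -> : K u x z - K v x y = (K u x z - K v x z) + (K v x z - K v x y) by ring.
rewrite (le_trans (ler_normD _ _))// [leRHS](splitr k) lerD//; last exact: hb.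
apply: ha; last exact: lagL.
have -> : u - v = `|clamp s z - clamp s x| - `|clamp s y - clamp s x|.
  by rewrite /u /v; ring.
rewrite (le_lt_trans (ler_dist_dist _ _))//.
have -> : clamp s z - clamp s x - (clamp s y - clamp s x) = clamp s z - clamp s y by ring.
by rewrite (le_lt_trans (hc _ zc))// ltr_pdivrMr// ltr_pMr// ltr1n.
Qed.

(** On a grid the lags are multiples of the step, where the forms [K] make a
    convex and nonincreasing sequence. *)
Let shifted_positive l : gridded s l -> 0 <= pairing (shifted s e) l l.
Proof.
case=> N [l1 [-> lN]]; clear l.
set h := s / (2 ^ N)%:R; have N0 : (0 < 2 ^ N)%N by rewrite expn_gt0.
have h0 : 0 < h by rewrite divr_gt0// ltr0n.
have hN m : (m <= 2 ^ N)%N -> h * m%:R <= s.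
  move=> mN; rewrite -[leRHS](@divfK _ (2 ^ N)%:R) ?pnatr_eq0 -?lt0n//.
  by rewrite ler_wpM2l ?ler_nat// ltW.
have pg k (l : seq (R * nat)) : pairing k (grid_points s N l) (grid_points s N l) =
    pairing (fun i j => k (h * i%:R) (h * j%:R)) l l.
  by rewrite /pairing big_map; apply: eq_bigr => p _; rewrite big_map.
pose A m (i j : nat) := K (h * m%:R + e) (h * i%:R) (h * j%:R).
have pA m l : pairing (A m) l l = pairing (K (h * m%:R + e)) (grid_points s N l) (grid_points s N l).
  by rewrite pg.
have hm m : 0 <= h * m%:R by rewrite mulr_ge0// ltW.
rewrite pg (@eq_pairing_in _ _ (fun i j => A (dist i j) i j)).
  apply: (@pairing_convex_ge0 _ A (2 ^ N)) => //.
  - move=> m l mN; rewrite pA; apply: K0; rewrite ltr_wpDl//=.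
    by have := hN m mN; move: eL sT; lra.
  - move=> m l mN; rewrite !pA; apply: K1.
    + by rewrite ltr_wpDl.
    + by rewrite lerD2r ler_wpM2l ?ler_nat// ltW.
    + by have := hN _ mN; move: eL sT; lra.
  - move=> m l mN; rewrite !pA.
    have -> : h * m.+1%:R + e = h * m%:R + e + h by rewrite -natr1; ring.
    have e2 : h * m.+2%:R + e = h * m%:R + e + 2 * h by rewrite -!natr1; ring.
    rewrite e2; apply: K2; [by rewrite ltr_wpDl|by []|rewrite -e2].
    by have := hN _ mN; move: eL sT; lra.
move=> p q /lN pN /lN qN; rewrite /shifted /A !clampE ?hm ?hN ?(ltnW pN) ?(ltnW qN)//.
congr (K (_ + e) _ _); rewrite -mulrBr normrM (gtr0_norm h0); congr (_ * _).
move: (p.2) (q.2) => i j; rewrite /dist; have [ij|/ltnW ij] := leqP i j.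
  by rewrite ger0_norm ?subr_ge0 ?ler_nat// -natrB//; congr (_%:R); lia.
by rewrite distrC ger0_norm ?subr_ge0 ?ler_nat// -natrB//; congr (_%:R); lia.
Qed.

Lemma shifted_triangle_ge0 : 0 <= primitive (fun t => primitive (shifted s e t) t) s.
Proof.
have := @double_integral_ge0 R (shifted s e) s (g e) (ltW s0) shifted_sym
  shifted_continuous shifted_bound shifted_positive.
rewrite (@square_triangle R _ (g e) shifted_sym shifted_continuous shifted_bound s s0).
by rewrite pmulr_rge0.
Qed.

End shift.

Let triangular t := \int[lam]_(r in `[0, t]) K (t - r) r t.

Let mI a b : measurable (`]a, b]%classic : set Rm). Proof. exact: measurable_itv. Qed.
Let mJ a b : measurable (`[a, b[%classic : set Rm). Proof. exact: measurable_itv. Qed.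
Let mC a b : measurable (`[a, b]%classic : set Rm). Proof. exact: measurable_itv. Qed.

Let g_integrable t : 0 <= t <= T -> lam.-integrable `]0, t] (EFin \o g).
Proof.
move=> /andP[t0 tT]; apply: integrableS gi => //.
by move=> x; rewrite /= !in_itv/= => /andP[-> h]; apply: le_lt_trans h _; apply: le_lt_trans TL.
Qed.

Let g_ge0 tau : 0 < tau < L -> 0 <= g tau.
Proof. by move=> tL; exact: le_trans (normr_ge0 _) (Kb 0 0 tL). Qed.

Section limit.
Variables (s : R).
Hypotheses (s0 : 0 < s) (sT : s <= T).

Let e n : R := (L - T) / n.+2%:R.

Let e_gt0 n : 0 < e n. Proof. by rewrite divr_gt0// subr_gt0. Qed.

Let e_lt n : e n < L - T.
Proof. by rewrite /e ltr_pdivrMr// ltr_pMr ?subr_gt0// ltr1n. Qed.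

Let e_cvg : e @ \oo --> (0 : R).
Proof.
apply/cvgr0Pnorm_lt => a a0; near=> n; rewrite gtr0_norm// /e ltr_pdivrMr//.
rewrite mulrC -ltr_pdivrMr//; apply: (@lt_trans _ _ n%:R); last by rewrite ltr_nat.
by near: n; exact: nbhs_infty_gtr.
Unshelve. all: by end_near. Qed.

Let time_lag t r n : 0 <= t <= s -> 0 <= r < t ->
  [/\ shifted s (e n) t r = K (t - r + e n) r t, 0 < t - r < L & t - r + e n < L].
Proof.
move=> /andP[t0 ts] /andP[r0 rt]; have := e_lt n; move: TL sT => h1 h2 h3.
split; [|by apply/andP; split; lra|by lra].
rewrite /shifted !clampE ?t0 ?r0//=; last by lra.
have -> : `|r - t| = t - r by rewrite distrC ger0_norm// subr_ge0 ltW.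
by have h0 := e_gt0 n; apply: Ksym; apply/andP; split; lra.
Qed.

Let primitive_shifted t n : 0 <= t <= s ->
  primitive (shifted s (e n) t) t = \int[lam]_(r in `[0, t[) shifted s (e n) t r /\
  `|primitive (shifted s (e n) t) t| <= \int[lam]_(r in `]0, T]) g r.
Proof.
move=> /[dup] ts /andP[t0 tls]; have tT : 0 <= t <= T by rewrite t0 (le_trans tls).
have cs := shifted_continuous s0 sT (e_gt0 n) (e_lt n) (x := t).
have iJ : lam.-integrable `[0, t[ (EFin \o shifted s (e n) t).
  apply: (@integrable_itvS _ _ _ 0 t cs) => //.
  by move=> x; rewrite /= !in_itv/= => /andP[-> /ltW].
have eJ : primitive (shifted s (e n) t) t = \int[lam]_(r in `[0, t[) shifted s (e n) t r.
  by rewrite /primitive -Rintegral_itv_bndo_bndc.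
split=> //; rewrite eJ.
have [gJ eg] := integrable_reflect (g_integrable tT).
apply: (le_trans (le_normr_Rintegral (mJ 0 t) iJ)).
apply: (@le_trans _ _ (\int[lam]_(r in `[0, t[) g (t - r))).
  apply: le_Rintegral => //; first exact: (integrable_abse iJ).
  move=> r; rewrite /= in_itv/= => rt; have [-> h1 h2] := time_lag n ts rt.
  by case/andP: h1 => h1 _; apply: K_dominated => //; rewrite lerDl ltW.
have gT : lam.-integrable `]0, T] (EFin \o g).
  by apply: g_integrable; rewrite lexx ltW.
rewrite eg; apply: fine_le.
- exact: integrable_fin_num (g_integrable tT).
- exact: integrable_fin_num gT.
- apply: ge0_subset_integral => //.
  + by case/integrableP: gT.
  + move=> x; rewrite /= in_itv/= lee_fin => /andP[x0 xT].
    by apply: g_ge0; rewrite x0 (le_lt_trans xT).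
  + by move=> x; rewrite /= !in_itv/= => /andP[-> xt]; case/andP: tT => _; exact: le_trans xt.
Qed.

(** After the domination by [g] of the shifted kernels, dominated convergence. *)
Let primitive_shifted_cvg t : 0 <= t <= s ->
  (fun n => primitive (shifted s (e n) t) t) @ \oo --> triangular t.
Proof.
move=> /[dup] ts /andP[t0 tls]; have tT : 0 <= t <= T by rewrite t0 (le_trans tls).
have [gJ eg] := integrable_reflect (g_integrable tT).
have jr tau : 0 < tau < L -> continuous (fun r => K tau r t).
  move=> tL; rewrite (_ : (fun r => K tau r t) = K tau t); first exact: Kr.
  by apply/funext => r; rewrite Ksym.
have jt tau k : 0 < tau < L -> 0 < k -> exists2 a, 0 < a & forall tau',
    `|tau' - tau| < a -> 0 < tau' < L -> forall r, `|K tau' r t - K tau r t| <= k.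
  by move=> tL k0; have [a a0 ha] := Ktau tL k0; exists a => // tau' h1 h2 r; exact: ha.
have iK := @convolution_integrable R T L g (fun tau r => K tau r t) TL gi
  (fun tau r => @Kb tau r t) jr jt t tT.
have -> : triangular t = \int[lam]_(r in `[0, t[) K (t - r) r t.
  by rewrite /triangular -Rintegral_itv_bndo_bndc.
rewrite (_ : (fun n => _) = (fun n => \int[lam]_(r in `[0, t[) shifted s (e n) t r)); last first.
  by apply/funext => n; have [] := primitive_shifted n ts.
have mf n : measurable_fun (`[0, t[%classic : set Rm) (shifted s (e n) t).
  have cs := shifted_continuous s0 sT (e_gt0 n) (e_lt n) (x := t).
  by apply: measurable_funS (continuous_measurable_fun cs).
have mK : measurable_fun (`[0, t[%classic : set Rm) (fun r => K (t - r) r t).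
  by apply/measurable_EFinP; case/integrableP: iK.
have ae1 : {ae lam, forall r, `[0, t[%classic r ->
    (fun n => shifted s (e n) t r) @ \oo --> K (t - r) r t}.
  apply: aeW => r; rewrite /= in_itv/= => rt; apply/cvgrPdist_le => k k0.
  have [_ tauL _] := time_lag 0 ts rt.
  have [a a0 ha] := Ktau tauL k0; near=> n.
  have [-> _ h] := time_lag n ts rt; rewrite distrC; apply: ha.
    rewrite addrAC subrr add0r gtr0_norm//; near: n.
    by have /cvgr_lt := e_cvg; apply.
  by rewrite h andbT addr_gt0//; case/andP: tauL.
have ae2 : {ae lam, forall r, `[0, t[%classic r -> forall n, `|shifted s (e n) t r| <= g (t - r)}.
  apply: aeW => r; rewrite /= in_itv/= => rt n; have [-> h1 h2] := time_lag n ts rt.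
  by case/andP: h1 => h1 _; apply: K_dominated => //; rewrite lerDl ltW.
exact: (Rdominated_cvg (mJ 0 t) mf mK ae1 gJ ae2).2.
Unshelve. all: by end_near. Qed.

(** The kernels shifted by [e > 0] are bounded, so that discrete positivity
    applies to them; dominated convergence removes the shift. *)
Lemma convolution_form_ge0 :
  0 <= \int[lam]_(t in `[0, s]) \int[lam]_(r in `[0, t]) K (t - r) r t.
Proof.
pose f n t := primitive (shifted s (e n) t) t.
pose c := \int[lam]_(r in `]0, T]) g r.
have mf n : measurable_fun (`[0, s]%classic : set Rm) (f n).
  have cs := shifted_continuous s0 sT (e_gt0 n) (e_lt n).
  have ct := @continuous_triangle R _ (g (e n)) (shifted_sym s0 sT (e_gt0 n) (e_lt n)) cs
    (shifted_bound s0 sT (e_gt0 n) (e_lt n)).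
  by apply: measurable_funS (continuous_measurable_fun ct).
have fc t : `[0, s]%classic t -> (fun n => f n t) @ \oo --> triangular t.
  by rewrite /= in_itv/=; exact: primitive_shifted_cvg.
have mt : measurable_fun (`[0, s]%classic : set Rm) triangular.
  exact: (measurable_fun_cvg mf fc).
have ic : lam.-integrable `[0, s] (EFin \o cst c).
  by apply: integrable_itv => x; exact: cvg_cst.
have fb : {ae lam, forall t, `[0, s]%classic t -> forall n, `|f n t| <= cst c t}.
  apply: aeW => t; rewrite /= in_itv/= => ts n.
  by have [] := primitive_shifted n ts.
have fa : {ae lam, forall t, `[0, s]%classic t -> (fun n => f n t) @ \oo --> triangular t}.
  by apply: aeW.
have [_ h] := Rdominated_cvg (mC 0 s) mf mt fa ic fb.
rewrite -[X in 0 <= X](cvg_lim _ h)//; apply: limr_ge; first by apply/cvg_ex; eexists; exact: h.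
apply: nearW => n.
exact: (shifted_triangle_ge0 s0 sT (e_gt0 n) (e_lt n)).
Qed.

End limit.

End convolution_positive.

(** * Boundedness of weakly continuous functions *)

(** Sokal's elementary proof of the uniform boundedness principle: a functional
    that is unbounded along a sequence of vectors of norm [4 ^ n] is built as a
    series with coefficients [3 ^ - n]. *)
Section gliding_hump.
Context {R : realType} (X : snspace R).

Definition contraction (l : X -> R) :=
  (forall a (x y : X), sn_mem x -> sn_mem y -> l (a *: x + y) = a * l x + l y) /\
  forall x : X, sn_mem x -> `|l x| <= sn_norm x.

Variables (xs : nat -> X) (ls : nat -> X -> R).
Hypotheses (xsP : forall n, sn_mem (xs n)) (lsc : forall n, contraction (ls n))
  (lsx : forall n, ls n (xs n) = sn_norm (xs n)).

Let sn_norm_ge0 (x : X) : sn_mem x -> 0 <= sn_norm x.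
Proof. by move=> xP; have [_ /(_ _ xP)] := lsc 0; apply: le_trans. Qed.

(** The signs make the [n]-th increment reinforce, at the point [xs n], the sum
    of the previous ones. *)
Fixpoint hump_sum n : X -> R := match n with
  | 0%N => fun=> 0
  | m.+1 => fun x =>
      hump_sum m x + (if 0 <= hump_sum m (xs m) then 1 else -1) * 3^-1 ^+ m * ls m x
  end.

Definition hump_limit (x : X) : R := limn (fun n => hump_sum n x).

Let hump_linear n a x y : sn_mem x -> sn_mem y ->
  hump_sum n (a *: x + y) = a * hump_sum n x + hump_sum n y.
Proof.
move=> xP yP; elim: n => [|n IH]/=; first by rewrite mulr0 addr0.
by rewrite IH (lsc n).1//; ring.
Qed.

Let hump_step n x : sn_mem x ->
  `|hump_sum n.+1 x - hump_sum n x| <= 3^-1 ^+ n * sn_norm x.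
Proof.
move=> xP /=; rewrite addrAC subrr add0r -mulrA normrM.
rewrite (_ : `|if _ then 1 else -1 : R| = 1); last by case: ifP; rewrite ?normrN normr1.
rewrite mul1r normrM ger0_norm ?exprn_ge0// ler_wpM2l ?exprn_ge0//.
exact: (lsc n).2.
Qed.

Let hump_dist n m x : sn_mem x -> `|hump_sum (n + m) x - hump_sum n x| <=
  3 / 2 * (3^-1 ^+ n - 3^-1 ^+ (n + m)) * sn_norm x.
Proof.
move=> xP; elim: m => [|m IH]; first by rewrite addn0 !subrr normr0 mulr0 mul0r.
rewrite addnS; have h := hump_step (n + m) xP.
have -> : hump_sum (n + m).+1 x - hump_sum n x = (hump_sum (n + m).+1 x -
  hump_sum (n + m) x) + (hump_sum (n + m) x - hump_sum n x) by ring.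
rewrite (le_trans (ler_normD _ _))// (le_trans (lerD h IH))//.
have -> : 3^-1 ^+ (n + m).+1 = 3^-1 * 3^-1 ^+ (n + m) :> R by rewrite exprS.
rewrite le_eqVlt; apply/orP; left; apply/eqP.
by move: (3^-1 ^+ (n + m)) (3^-1 ^+ n) (sn_norm x) => a b c; field.
Qed.

Let hump_cvg x : sn_mem x -> (fun n => hump_sum n x) @ \oo --> hump_limit x.
Proof.
move=> xP; have N0 := sn_norm_ge0 xP.
pose v n := hump_sum n x - 3 / 2 * 3^-1 ^+ n * sn_norm x.
have vcvg : cvgn v.
  apply: nondecreasing_is_cvgn.
    apply/nondecreasing_seqP => n; rewrite /v.
    have := hump_step n xP; rewrite ler_norml => /andP[h _]; rewrite exprS.
    by move: h; move: (hump_sum n.+1 x) (hump_sum n x) (3^-1 ^+ n) => a b c; lra.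
  exists (3 / 2 * sn_norm x) => _ [n _ <-]; rewrite /v.
  have := hump_dist 0 n xP; rewrite add0n/= subr0 expr0 ler_norml => /andP[_].
  have : 0 <= 3^-1 ^+ n * sn_norm x by rewrite mulr_ge0// exprn_ge0.
  by move: (hump_sum n x) (3^-1 ^+ n) (sn_norm x) => a b c; lra.
suff h : cvgn (fun n => hump_sum n x) by [].
rewrite (_ : (fun n => _) = v \+ (fun n => 3^-1 ^+ n * (3 / 2 * sn_norm x))).
  apply: is_cvgD => //; apply: is_cvgMl; apply/cvg_ex; exists 0.
  by apply: cvg_expr; rewrite gtr0_norm// invf_lt1// ltr1n.
by apply/funext => n /=; rewrite /v; ring.
Qed.

Let hump_limit_dist n x : sn_mem x ->
  `|hump_limit x - hump_sum n x| <= 3 / 2 * 3^-1 ^+ n * sn_norm x.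
Proof.
move=> xP; have N0 := sn_norm_ge0 xP.
have h : (fun m => `|hump_sum m x - hump_sum n x|) @ \oo --> `|hump_limit x - hump_sum n x|.
  by apply: cvg_norm; apply: cvgB; [exact: hump_cvg|exact: cvg_cst].
rewrite -(cvg_lim _ h)//; apply: limr_le; first by apply/cvg_ex; eexists; exact: h.
near=> m; have nm : (n <= m)%N by near: m; exact: nbhs_infty_ge.
rewrite -(subnKC nm) (le_trans (hump_dist _ _ xP))// ler_wpM2r// ler_wpM2l ?divr_ge0//.
by rewrite gerBl exprn_ge0.
Unshelve. all: by end_near. Qed.

Lemma dual_element_hump_limit : dual_element hump_limit.
Proof.
split=> [a x y xP yP|].
  have h1 := hump_cvg xP; have h2 := hump_cvg yP.
  have h : (fun n => a * hump_sum n x + hump_sum n y) @ \oo -->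
      a * hump_limit x + hump_limit y.
    exact: cvgD (cvgM (cvg_cst a) h1) h2.
  rewrite /hump_limit -/(hump_limit x) -/(hump_limit y) -(cvg_lim _ h)//.
  by congr (lim (_ @ \oo)); apply/funext => n; rewrite hump_linear.
exists (3 / 2) => x xP; have := hump_limit_dist 0 xP.
by rewrite /= subr0 expr0 mulr1.
Qed.

(** The increment of index [n] contributes [3 ^ - n] times the norm at [xs n], and
    all the later ones at most half of it. *)
Lemma hump_limit_large n : sn_norm (xs n) * 3^-1 ^+ n <= 2 * `|hump_limit (xs n)|.
Proof.
have xP := xsP n; have N0 := sn_norm_ge0 xP.
have h := hump_limit_dist n.+1 xP; rewrite exprS in h.
have c0 : 0 <= 3^-1 ^+ n * sn_norm (xs n) :> R by rewrite mulr_ge0 ?exprn_ge0.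
have : 3^-1 ^+ n * sn_norm (xs n) <= `|hump_sum n.+1 (xs n)|.
  rewrite /= lsx; have [s0|s0] := leP 0 (hump_sum n (xs n)).
    by rewrite mul1r ger0_norm ?addr_ge0// lerDr.
  by rewrite !mulN1r mulNr ltr0_norm; lra.
have := ler_dist_dist (hump_limit (xs n)) (hump_sum n.+1 (xs n)).
rewrite ler_norml => /andP[h1 h2].
move: h c0 h1 h2; move: (hump_sum n.+1 _) (hump_limit _) => a b.
move: (3^-1 ^+ n) (sn_norm _) => c e; move: `|a| `|b| `|b - a|.
by move=> x y z; lra.
Qed.

End gliding_hump.

Lemma weakly_continuous_bounded {R : realType} (X : snspace R) (T : R) (f : R -> X) :
  0 <= T ->
  (forall x : X, sn_mem x -> exists2 l, contraction l & l x = sn_norm x) ->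
  weakly_continuous `[0, T]%classic f ->
  exists M, forall t, 0 <= t <= T -> sn_norm (f t) <= M.
Proof.
move=> T0 norming [fP fc]; apply: contrapT => /forallNP unb.
have fP' t : 0 <= t <= T -> sn_mem (f t) by move=> tT; apply: fP; rewrite /= in_itv.
have /choice[t ht] n : exists t, (0 <= t <= T) /\ 4 ^+ n < sn_norm (f t).
  have /existsNP[t /not_implyP[tT /negP]] := unb (4 ^+ n); rewrite -ltNge => h.
  by exists t.
have /choice[l hl] n : exists l, contraction l /\ l (f (t n)) = sn_norm (f (t n)).
  by have [l lc lx] := norming _ (fP' _ (ht n).1); exists l.
pose xs n := f (t n).
have xsP n : sn_mem (xs n) by exact: fP' (ht n).1.
have lc n := (hl n).1; have lx n := (hl n).2.
have dL := dual_element_hump_limit xs lc.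
have cL := fc _ dL; set L := hump_limit xs l in dL cL.
have [c1 _ h1] := EVT_max T0 cL; have [c2 _ h2] := EVT_min T0 cL.
pose M := `|L (f c1)| + `|L (f c2)|.
have LM n : `|L (xs n)| <= M.
  have tI : t n \in `[0, T] by rewrite in_itv/=; exact: (ht n).1.
  have := h1 _ tI; have := h2 _ tI; rewrite /= /M => g2 g1; rewrite ler_norml.
  have := ler_norm (L (f c1)); have := ler_norm (- L (f c2)); rewrite normrN.
  have := normr_ge0 (L (f c1)); have := normr_ge0 (L (f c2)).
  rewrite -/(xs n) in g1 g2.
  by move=> *; apply/andP; split; lra.
have [n hn] : exists n, 2 * M < (4 / 3) ^+ n :> R.
  have [N hN] : exists N : nat, 2 * M < N%:R / 3.
    near \oo => N; exists N; rewrite ltr_pdivlMr//; near: N; exact: nbhs_infty_gtr.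
  exists N; apply: (lt_le_trans hN); apply: (@le_trans _ _ (1 + N%:R / 3)).
    by rewrite lerDr.
  elim: N {hN} => [|N IH]; first by rewrite mul0r addr0 expr0.
  have := ler0n R N; rewrite exprS -natr1; lra.
have := hump_limit_large xsP lc lx n; apply/negP; rewrite -ltNge.
apply: (@le_lt_trans _ _ (2 * M)); first by rewrite ler_wpM2l.
apply: (lt_trans hn); rewrite exprMn mulrC [ltRHS]mulrC ltr_pM2l ?exprn_gt0//.
exact: (ht n).2.
Unshelve. all: by end_near. Qed.

(** * Nonincreasing and convex relaxation kernels *)

Section relaxation.
Context {R : realType} {d : nat}.
Local Notation V := 'rV[R]_d.
Local Notation Rm := (measurableTypeR R).
Local Notation lam := (@lebesgue_measure R).
Variables (Omega : set V) (oOmega : open Omega).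
Local Notation B := (Bspace Omega).
Local Notation Hd := (Hspace Omega d d).
Local Notation form := (field_form Omega).
Local Notation symfield := (@symmetric_field R d Omega).
Variables (L : R).

Lemma Bspace_mem0 (A : B) : sn_mem A -> sn_mem (0 : B).
Proof. by move=> BA; have := Bspace_linear (-1) BA BA; rewrite scaleN1r addNr. Qed.

Lemma Bspace_memB (A A' : B) : sn_mem A -> sn_mem A' -> sn_mem (A - A').
Proof. by move=> BA BA'; rewrite -scaleN1r addrC; exact: Bspace_linear. Qed.

Lemma Bspace_memZ a (A : B) : sn_mem A -> sn_mem (a *: A).
Proof. by move=> BA; have := Bspace_linear a BA (Bspace_mem0 BA); rewrite addr0. Qed.

Lemma Bspace_norm0 : sn_norm (0 : B) = 0.
Proof.
apply/eqP; rewrite eq_le Bspace_norm_ge0 andbT.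
apply: Bspace_norm_le => //; apply: aeW => x _ xi _.
by rewrite /enorm (si0l mdot_si (x := xi))// sqrtr0 mul0r.
Qed.

Lemma Bspace_normZ_le a (A : B) : sn_mem A -> sn_norm (a *: A) <= `|a| * sn_norm A.
Proof.
move=> BA; have := Bspace_norm_triangle a BA (Bspace_mem0 BA).
by rewrite addr0 Bspace_norm0 addr0.
Qed.

Lemma Bspace_normB_le (A A' : B) : sn_mem A -> sn_mem A' ->
  sn_norm A <= sn_norm (A - A') + sn_norm A'.
Proof.
move=> BA BA'; have := Bspace_norm_triangle 1 (Bspace_memB BA BA') BA'.
by rewrite scale1r subrK normr1 mul1r.
Qed.

Lemma field_formB A A' E G : sn_mem (s := B) A -> sn_mem (s := B) A' ->
  symfield E -> symfield G -> form (A - A') E G = form A E G - form A' E G.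
Proof.
move=> BA BA' sE sG; have := field_form_field_linear oOmega (-1) BA' BA sE sG.
by rewrite scaleN1r addrC mulN1r => ->; rewrite addrC.
Qed.

Lemma field_formZ a A E G : sn_mem (s := B) A ->
  symfield E -> symfield G -> form (a *: A) E G = a * form A E G.
Proof.
move=> BA sE sG; have := field_form_field_linear oOmega a BA (Bspace_mem0 BA) sE sG.
rewrite addr0 => ->; rewrite (_ : form 0 E G = 0) ?addr0//.
by rewrite -(subrr A) (field_formB BA BA sE sG) subrr.
Qed.

Section derivative.
Variables (f g : R -> B).
Hypothesis fg : strong_derivative (X := B) `]0, L[%classic f g.

Let fgP t : 0 < t < L -> [/\ sn_mem (f t), sn_mem (g t) &
    (fun h => sn_norm (h^-1 *: (f (t + h) - f t) - g t)) @ 0^' --> (0 : R)].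
Proof. by move=> tL; apply: fg; rewrite /= in_itv. Qed.

Let quotient_near t k : 0 < t < L -> 0 < k -> exists2 e : R, 0 < e &
  forall h, h != 0 -> `|h| < e -> 0 < t + h < L /\
    sn_norm (h^-1 *: (f (t + h) - f t) - g t) < k.
Proof.
move=> tL k0; have [_ _ /cvgrPdist_lt/(_ _ k0)/nbhs_ballP[e e0 he]] := fgP tL.
case/andP: (tL) => t0 tL'.
exists (Num.min e (Num.min t (L - t))) => [|h h0]; first by rewrite !lt_min e0 t0 subr_gt0.
rewrite !lt_min => /andP[hE /andP[]]; rewrite !ltr_norml => /andP[h1 h2] /andP[h3 h4].
split; first by apply/andP; split; lra.
have hb : ball (0 : R) e h by rewrite /ball/= sub0r normrN.
have : `|0 - sn_norm (h^-1 *: (f (t + h) - f t) - g t)| < k by exact: he.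
by rewrite sub0r normrN; apply: le_lt_trans; exact: ler_norm.
Qed.

Lemma strong_derivative_lipschitz t : 0 < t < L ->
  exists2 e : R, 0 < e & forall u, `|u - t| < e -> 0 < u < L ->
    sn_norm (f u - f t) <= `|u - t| * (1 + sn_norm (g t)).
Proof.
move=> tL; have [e e0 he] := quotient_near tL ltr01.
exists e => // u ue uL; have [Bt Bg _] := fgP tL; have [Bu _ _] := fgP uL.
have [->|ut] := eqVneq u t; first by rewrite !subrr normr0 mul0r Bspace_norm0.
have h0 : u - t != 0 by rewrite subr_eq0.
have [_ hq] := he _ h0 ue; set Q := _ - g t in hq.
have tu : t + (u - t) = u by ring.
have Bf : sn_mem (f u - f t : B) by exact: (Bspace_memB Bu Bt).
have BQ : sn_mem (Q : B).
  by rewrite /Q tu; exact: (Bspace_memB (Bspace_memZ _ Bf) Bg).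
have -> : f u - f t = (u - t) *: (1 *: Q + g t).
  by rewrite scale1r /Q subrK tu scalerA divff// scale1r.
have BQg : sn_mem (1 *: Q + g t : B) by exact: (Bspace_linear 1 BQ Bg).
rewrite (le_trans (Bspace_normZ_le _ BQg))// ler_wpM2l//.
rewrite (le_trans (Bspace_norm_triangle _ BQ Bg))// normr1 mul1r lerD2r.
exact: ltW.
Qed.

Lemma field_form_derive E t : symfield E -> 0 < t < L ->
  is_derive t 1 (fun t => form (f t) E E) (form (g t) E E).
Proof.
move=> sE tL; apply: is_derive_cvg; apply/cvgrPdist_le => k k0.
have [Bt Bg _] := fgP tL.
pose N := sn_norm (s := Hd) E * sn_norm (s := Hd) E.
have N0 : 0 <= N by rewrite mulr_ge0// sqrtr_ge0.
have N1 : 0 < k / (N + 1) by rewrite divr_gt0// ltr_wpDl.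
have [e e0 he] := quotient_near tL N1; near=> h.
have h0 : h != 0 by near: h; exact: nbhs_dnbhs_neq.
have [hL hq] : 0 < t + h < L /\ sn_norm (h^-1 *: (f (t + h) - f t) - g t) < k / (N + 1).
  by apply: he => //; near: h; exact: dnbhs0_lt.
have [Bh _ _] := fgP hL.
rewrite [h *: 1]mulr1 [h + t]addrC distrC.
have BD : sn_mem (f (t + h) - f t : B) by exact: (Bspace_memB Bh Bt).
have BQ : sn_mem (h^-1 *: (f (t + h) - f t) : B) by exact: (Bspace_memZ _ BD).
have -> : h^-1 *: (form (f (t + h)) E E - form (f t) E E) - form (g t) E E =
    form (h^-1 *: (f (t + h) - f t) - g t) E E.
  by rewrite (field_formB BQ Bg sE sE) (field_formZ _ BD sE sE) (field_formB Bh Bt sE sE).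
have := field_form_bound oOmega (Bspace_memB BQ Bg) sE sE.
move=> /le_trans; apply; rewrite -/N.
apply: (@le_trans _ _ (k / (N + 1) * N)); first by rewrite ler_wpM2r// ltW.
by rewrite mulrAC ler_pdivrMr ?ltr_wpDl// ler_pM2l// lerDl.
Unshelve. all: by end_near. Qed.

End derivative.

Section kernel.
Variables (F F1 F2 : R -> V -> 'M[R]_d -> 'M[R]_d).
Hypotheses (F_C2 : C2_with (X := B) 0 L F F1 F2)
  (F_L1 : bochner_Lp (X := B) 1 `]0, L[%classic F).

Let FP t : 0 < t < L -> sn_mem (s := B) (F t) /\ sn_mem (s := B) (F1 t).
Proof. by move=> tL; have [h _ _] := F_C2; have [] := h t; rewrite ?/= ?in_itv. Qed.

(** Differentiability in norm gives continuity, uniformly on bounded sets of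
    fields. *)
Lemma kernel_uniform_continuity N t k : 0 < t < L -> 0 <= N -> 0 < k ->
  exists2 e : R, 0 < e & forall u, `|u - t| < e -> 0 < u < L ->
    forall E G, symfield E -> symfield G ->
      sn_norm (s := Hd) E * sn_norm (s := Hd) G <= N ->
      `|form (F u) E G - form (F t) E G| <= k.
Proof.
move=> tL N0 k0; have [dF _ _] := F_C2.
have [e e0 he] := strong_derivative_lipschitz dF tL.
have c0 : 0 <= 1 + sn_norm (s := B) (F1 t) by rewrite addr_ge0// Bspace_norm_ge0.
have c1 : 0 < (1 + sn_norm (s := B) (F1 t)) * N + 1 by rewrite ltr_wpDl// mulr_ge0.
exists (Num.min e (k / ((1 + sn_norm (s := B) (F1 t)) * N + 1))).
  by rewrite lt_min e0 divr_gt0.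
move=> u; rewrite lt_min => /andP[ue uk] uL E G sE sG EG.
have Bu := (FP uL).1; have Bt := (FP tL).1.
rewrite -(field_formB Bu Bt sE sG).
have := field_form_bound oOmega (Bspace_memB Bu Bt) sE sG.
move=> /le_trans; apply.
have hu := he u ue uL.
apply: (@le_trans _ _ (`|u - t| * (1 + sn_norm (s := B) (F1 t)) * N)).
  apply: ler_pM => //; first exact: Bspace_norm_ge0.
  by rewrite mulr_ge0// sqrtr_ge0.
move: uk; rewrite ltr_pdivlMr// => /ltW; apply: le_trans.
by rewrite -mulrA ler_wpM2l// lerDl.
Qed.

Lemma kernel_norm_integrable : lam.-integrable `]0, L[ (EFin \o (fun t => sn_norm (s := B) (F t))).
Proof.
apply/integrableP; split; last first.
  have [_] := F_L1; apply: le_lt_trans; rewrite le_eqVlt; apply/orP; left; apply/eqP.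
  by apply: eq_integral => t _; rewrite /= ger0_norm ?Bspace_norm_ge0.
apply/measurable_EFinP; apply: open_continuous_measurable_fun; first exact: interval_open.
move=> t; rewrite inE/= in_itv/= => tL; apply/cvgrPdist_le => k k0.
have [dF _ _] := F_C2; have [e e0 he] := strong_derivative_lipschitz dF tL.
set c := 1 + sn_norm (s := B) (F1 t) in he.
have c0 : 0 < c by rewrite /c ltr_pwDl// Bspace_norm_ge0.
have /andP[t0 tL'] := tL.
apply/nbhs_ballP; exists (Num.min (Num.min e (k / c)) (Num.min t (L - t))) => [|u].
  by rewrite /= !lt_min e0 divr_gt0//= t0 subr_gt0.
rewrite /ball/= !lt_min distrC => /andP[/andP[ue uk] /andP[ut uL]].
have uI : 0 < u < L.
  by move: ut uL; rewrite !ltr_norml => /andP[? ?] /andP[? ?]; apply/andP; split; lra.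
have [Bu _] := FP uI; have [Bt _] := FP tL.
have h1 := Bspace_normB_le Bu Bt; have h2 := Bspace_normB_le Bt Bu.
have h3 : sn_norm (s := B) (F t - F u) <= sn_norm (s := B) (F u - F t).
  rewrite -opprB -scaleN1r (le_trans (Bspace_normZ_le _ (Bspace_memB Bu Bt)))//.
  by rewrite normrN1 mul1r.
have hc : `|u - t| * c <= k by rewrite -ler_pdivlMr// ltW.
have h4 := le_trans (he u ue uI) hc.
suff : `|sn_norm (s := B) (F t) - sn_norm (s := B) (F u)| <= k by [].
move: h1 h2 h3 h4; move: (sn_norm (s := B) (F t)) (sn_norm (s := B) (F u)).
move: (sn_norm (s := B) (F u - F t)) (sn_norm (s := B) (F t - F u)) => a b x y h1 h2 h3 h4.
by rewrite ler_norml; apply/andP; split; clear -h1 h2 h3 h4; lra.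
Qed.

Variables (T : R) (C : V -> 'M[R]_d -> 'M[R]_d).
Hypotheses (T0 : 0 < T) (TL : T < L) (BC : sn_mem (s := B) C)
  (C_ge0 : {ae leb R d, forall x, Omega x ->
     forall xi, symmx xi -> 0 <= mdot (C x xi) xi})
  (F_ge0 : forall t, 0 < t < L -> {ae leb R d, forall x, Omega x ->
     forall xi, symmx xi -> 0 <= mdot (F t x xi) xi})
  (F1_le0 : forall t, 0 < t < L -> {ae leb R d, forall x, Omega x ->
     forall xi, symmx xi -> mdot (F1 t x xi) xi <= 0})
  (F2_ge0 : forall t, 0 < t < L -> {ae leb R d, forall x, Omega x ->
     forall xi, symmx xi -> 0 <= mdot (F2 t x xi) xi}).

Let form_sign A E : sn_mem (s := B) A -> symfield E ->
  {ae leb R d, forall x, Omega x -> forall xi, symmx xi -> 0 <= mdot (A x xi) xi} ->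
  0 <= form A E E.
Proof. by move=> BA sE /(field_form_si oOmega BA) si; exact: (si_ge0 si sE). Qed.

Section quadratic.
Variable E : V -> 'M[R]_d.
Hypothesis sE : symfield E.
Let q t := form (F t) E E.
Let q1 t := form (F1 t) E E.

Let q_derive t : 0 < t < L -> is_derive t 1 q (q1 t).
Proof. by have [h _ _] := F_C2; exact: (field_form_derive h sE). Qed.

Let q1_derive t : 0 < t < L -> is_derive t 1 q1 (form (F2 t) E E).
Proof. by have [_ h _] := F_C2; exact: (field_form_derive h sE). Qed.

Let mean_value (f f' : R -> R) a b : (forall t : R, 0 < t < L -> is_derive t 1 f (f' t)) ->
  0 < a -> a < b -> b < L -> exists2 c, a < c < b & f b - f a = f' c * (b - a).
Proof.
move=> df a0 ab bL.
have dI x : x \in `]a, b[ -> is_derive x 1 f (f' x).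
  rewrite in_itv/= => /andP[ax xb]; apply: df.
  by rewrite (lt_trans a0 ax) (lt_trans xb bL).
have cf : {within `[a, b], continuous f}.
  apply: derivable_within_continuous => x; rewrite in_itv/= => /andP[ax xb].
  have : is_derive x 1 f (f' x) by apply: df; rewrite (lt_le_trans a0 ax) (le_lt_trans xb bL).
  by case.
by have [c + ->] := MVT ab dI cf; rewrite in_itv/=; exists c.
Qed.

Lemma kernel_form_nonincreasing a b : 0 < a -> a <= b -> b < L -> q b <= q a.
Proof.
move=> a0; rewrite le_eqVlt => /predU1P[->//|ab] bL.
have [c /andP[ac cb] h] := mean_value q_derive a0 ab bL.
rewrite -subr_le0 h pmulr_lle0 ?subr_gt0//.
have cL : 0 < c < L by rewrite (lt_trans a0 ac) (lt_trans cb bL).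
have B1 := (FP cL).2; rewrite -oppr_ge0 -mulN1r -(field_formZ _ B1 sE sE).
apply: form_sign (Bspace_memZ _ B1) sE _; apply: (ae_imply (F1_le0 cL)) => x h1 Ox xi sxi.
have := h1 Ox xi sxi; rewrite -oppr_ge0.
have -> : ((-1 *: F1 c) : V -> 'M[R]_d -> 'M[R]_d) x xi = -1 *: F1 c x xi by [].
by rewrite (siZl mdot_si)// mulN1r.
Qed.

(** The mean value theorem is applied to the two increments of [q], then to its
    derivative between the two intermediate points. *)
Lemma kernel_form_convex a h : 0 < a -> 0 < h -> a + 2 * h < L ->
  0 <= q a - 2 * q (a + h) + q (a + 2 * h).
Proof.
move=> a0 h0 aL.
have [c1 /andP[ac1 c1h] e1] : exists2 c, a < c < a + h & q (a + h) - q a = q1 c * (a + h - a).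
  by apply: mean_value q_derive _ _ _; lra.
have [c2 /andP[ac2 c2h] e2] : exists2 c, a + h < c < a + 2 * h &
    q (a + 2 * h) - q (a + h) = q1 c * (a + 2 * h - (a + h)).
  by apply: mean_value q_derive _ _ _; lra.
have [c /andP[cc1 cc2] e3] : exists2 c, c1 < c < c2 & q1 c2 - q1 c1 = form (F2 c) E E * (c2 - c1).
  by apply: mean_value q1_derive _ _ _; lra.
have cL : 0 < c < L by apply/andP; split; lra.
have [_ dF1 _] := F_C2.
have cI : `]0, L[%classic c by rewrite /= in_itv.
have [_ B2 _] := dF1 c cI.
have F20 := form_sign B2 sE (F2_ge0 cL).
have : 0 <= (q1 c2 - q1 c1) * h.
  by rewrite e3 !mulr_ge0// ?subr_ge0 ltW//; lra.
have -> : q a - 2 * q (a + h) + q (a + 2 * h) = q (a + 2 * h) - q (a + h) - (q (a + h) - q a) by ring.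
rewrite e1 e2; lra.
Qed.

End quadratic.

Section paths.
Variables (E : R -> V -> 'M[R]_d) (M : R).
Hypotheses (sE : forall t, symfield (E t)) (EM : forall t, sn_norm (s := Hd) (E t) <= M)
  (Ec : forall A G, sn_mem (s := B) A -> symfield G -> continuous (fun t => form A (E t) G)).

Let M0 : 0 <= M. Proof. exact: le_trans (sqrtr_ge0 _) (EM 0). Qed.

Let product_bound r t : sn_norm (s := Hd) (E r) * sn_norm (s := Hd) (E t) <= M * M.
Proof. by apply: ler_pM (sqrtr_ge0 _) (sqrtr_ge0 _) (EM r) (EM t). Qed.

Section against_field.
Variables (G : V -> 'M[R]_d).
Hypothesis sG : symfield G.
Let N := sn_norm (s := Hd) G.
Let N0 : 0 <= N. Proof. exact: sqrtr_ge0. Qed.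
Let j tau r := form (F tau) (E r) G.
Let g tau := sn_norm (s := B) (F tau) * (M * N).

Let gi : lam.-integrable `]0, L[ (EFin \o g).
Proof.
have mI : measurable (`]0, L[%classic : set Rm) by exact: measurable_itv.
have := integrableZr mI (M * N) kernel_norm_integrable.
by congr (_.-integrable _ _); apply/funext => x; rewrite /= EFinM.
Qed.

Let jb tau r : 0 < tau < L -> `|j tau r| <= g tau.
Proof.
move=> tL; have [BF _] := FP tL.
apply: (le_trans (field_form_bound oOmega BF (sE r) sG)).
by apply: ler_wpM2l (Bspace_norm_ge0 _) _ _ _; apply: ler_wpM2r.
Qed.

Let jr tau : 0 < tau < L -> continuous (j tau).
Proof. by move=> tL; have [BF _] := FP tL; exact: Ec. Qed.

Let jtau tau k : 0 < tau < L -> 0 < k -> exists2 e : R, 0 < e &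
  forall tau', `|tau' - tau| < e -> 0 < tau' < L -> forall r, `|j tau' r - j tau r| <= k.
Proof.
move=> tL k0; have MN : 0 <= M * N by exact: mulr_ge0.
have [e e0 he] := kernel_uniform_continuity tL MN k0; exists e => // u ue uL r.
by apply: (he u ue uL _ _ (sE r) sG); apply: ler_wpM2r.
Qed.

Lemma path_convolution_integrable t : 0 <= t <= T ->
  lam.-integrable `[0, t[ (EFin \o (fun r => form (F (t - r)) (E r) G)).
Proof. exact: (convolution_integrable TL gi jb jr jtau). Qed.

Lemma continuous_path_convolution :
  continuous (fun t => convolution (fun tau r => form (F tau) (E r) G) (clamp T t)).
Proof. exact: (continuous_convolution T0 TL gi jb jr jtau). Qed.

End against_field.

Let K tau r t := form (F tau) (E r) (E t) + form C (E r) (E t).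
Let g tau := (sn_norm (s := B) (F tau) + sn_norm (s := B) C) * (M * M).

Let gi : lam.-integrable `]0, L[ (EFin \o g).
Proof.
have mI : measurable (`]0, L[%classic : set Rm) by exact: measurable_itv.
have ci : lam.-integrable `]0, L[ (EFin \o cst (sn_norm (s := B) C)).
  apply: (@integrable_itvS _ _ _ 0 L (@cst_continuous _ _ _)) => //.
  by move=> x; rewrite /= !in_itv/= => /andP[/ltW -> /ltW].
have := integrableZr mI (M * M) (integrableD mI kernel_norm_integrable ci).
by congr (_.-integrable _ _); apply/funext => x; rewrite /= EFinM EFinD.
Qed.

Let combination (l : seq (R * R)) := \sum_(p <- l) p.1 *: E p.2.

Let symfield0 : symfield 0.
Proof.
have := symmetric_field_linear oOmega (-1) (sE 0) (sE 0).
by rewrite scaleN1r addNr.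
Qed.

Let symfield_combination l : symfield (combination l).
Proof.
rewrite /combination; elim: l => [|p l IH]; first by rewrite big_nil.
by rewrite big_cons; exact: symmetric_field_linear.
Qed.

Let pairing_combination A l : sn_mem (s := B) A ->
  pairing (fun r t => form A (E r) (E t)) l l = form A (combination l) (combination l).
Proof.
move=> BA.
have right l' H : symfield H -> form A (combination l') H = \sum_(p <- l') p.1 * form A (E p.2) H.
  move=> sH; rewrite /combination; elim: l' => [|p l' IH].
    rewrite !big_nil; have := field_form_linear oOmega (-1) BA (sE 0) (sE 0) sH.
    by rewrite scaleN1r addNr mulN1r addNr.
  rewrite !big_cons -IH.
  exact: (field_form_linear oOmega _ BA (sE p.2) (symfield_combination l') sH).
rewrite right; last exact: symfield_combination.
rewrite /pairing; apply: eq_bigr => p _.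
rewrite (field_form_sym oOmega BA (sE p.2) (symfield_combination l)) (right l _ (sE p.2)).
rewrite mulr_sumr; apply: eq_bigr => q _.
by rewrite (field_form_sym oOmega BA (sE p.2) (sE q.2)) mulrA.
Qed.

Let pairing_K tau l : 0 < tau < L -> pairing (K tau) l l =
  form (F tau) (combination l) (combination l) + form C (combination l) (combination l).
Proof.
move=> tL; have [BF _] := FP tL; rewrite -!pairing_combination//.
have := pairing_linear 1 (fun r t => form (F tau) (E r) (E t)) (fun r t => form C (E r) (E t)) l l.
by rewrite mul1r => <-; congr pairing; apply/funext => r; apply/funext => t; rewrite mul1r.
Qed.

(** The elastic part of the stress adds to the kernel a constant, which is
    nonnegative, nonincreasing and convex. *)
Lemma relaxation_form_ge0 s : 0 < s -> s <= T ->
  0 <= \int[lam]_(t in `[0, s]) \int[lam]_(r in `[0, t])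
    (form (F (t - r)) (E r) (E t) + form C (E r) (E t)).
Proof.
move=> s0 sT; apply: (@convolution_form_ge0 R T L g K) => //.
- move=> tau r t tL; have [BF _] := FP tL; rewrite /K.
  rewrite (field_form_sym oOmega BF (sE r) (sE t)).
  by rewrite (field_form_sym oOmega BC (sE r) (sE t)).
- move=> tau r t tL; have [BF _] := FP tL.
  rewrite (le_trans (ler_normD _ _))// /g mulrDl lerD//.
  + apply: (le_trans (field_form_bound oOmega BF (sE r) (sE t))).
    by apply: ler_wpM2l (Bspace_norm_ge0 _) _ _ _; exact: product_bound.
  + apply: (le_trans (field_form_bound oOmega BC (sE r) (sE t))).
    by apply: ler_wpM2l (Bspace_norm_ge0 _) _ _ _; exact: product_bound.
- move=> tau t tL; have [BF _] := FP tL.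
  have symE A : sn_mem (s := B) A ->
      (fun r => form A (E t) (E r)) = (fun r => form A (E r) (E t)).
    by move=> BA; apply/funext => r; exact: (field_form_sym oOmega BA (sE t) (sE r)).
  have h1 := Ec BF (sE t); have h2 := Ec BC (sE t).
  rewrite -(symE _ BF) in h1; rewrite -(symE _ BC) in h2.
  by move=> x; exact: cvgD (h1 x) (h2 x).
- move=> tau k tL k0.
  have [e e0 he] := kernel_uniform_continuity tL (mulr_ge0 M0 M0) k0.
  exists e => // u ue uL r t; rewrite /K opprD addrACA subrr addr0.
  by apply: (he u ue uL _ _ (sE r) (sE t)); exact: product_bound.
- move=> tau l tL; have [BF _] := FP tL; rewrite pairing_K// addr_ge0//.
    exact: (form_sign BF (symfield_combination l) (F_ge0 tL)).
  exact: (form_sign BC (symfield_combination l) C_ge0).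
- move=> a b l a0 ab bL; rewrite !pairing_K ?a0 ?bL ?andbT ?(le_lt_trans ab) ?(lt_le_trans a0)//.
  by rewrite lerD2r; apply: kernel_form_nonincreasing (symfield_combination l) _ _ a0 ab bL.
- move=> a h l a0 h0 aL.
  have := kernel_form_convex (symfield_combination l) a0 h0 aL.
  rewrite !pairing_K; [|by apply/andP; split; lra..].
  set c := form C _ _; move: (form _ _ _) (form _ _ _) (form _ _ _) => x y z.
  by rewrite (_ : z + c - 2 * (y + c) + (x + c) = z - 2 * y + x)//; ring.
Qed.

End paths.

End kernel.

End relaxation.

(** * Scalar consequences of the weak time derivative *)

Section bochner.
Context {R : realType}.
Local Notation Rm := (measurableTypeR R).
Local Notation lam := (@lebesgue_measure R).

(** Both sides are suprema of integrals of simple functions below the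
    integrand; this applies to norms whose measurability is not known. *)
Lemma le_lower_integral (D : set Rm) (f1 f2 : Rm -> \bar R) :
  (forall x, D x -> 0 <= f1 x)%E -> (forall x, D x -> f1 x <= f2 x)%E ->
  (\int[lam]_(x in D) f1 x <= \int[lam]_(x in D) f2 x)%E.
Proof.
move=> f10 f12; rewrite !(integral_mkcond D).
have h10 x : (0 <= (f1 \_ D) x)%E by apply: erestrict_ge0.
have h12 x : ((f1 \_ D) x <= (f2 \_ D) x)%E by apply: lee_restrict.
rewrite !ge0_integralTE// => [|x]; last exact: le_trans (h10 x) (h12 x).
apply: ereal_sup_le => _ [h /= hf <-]; exists h => // x.
exact: le_trans (hf x) (h12 x).
Qed.

Lemma Rintegral_simple (D : set Rm) (I : Type) (r : seq I) (c : I -> R) (A : I -> set Rm) :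
  measurable D -> (lam D < +oo)%E -> (forall i, measurable (A i)) ->
  lam.-integrable D (EFin \o (fun t => \sum_(i <- r) c i * \1_(A i) t)) /\
  \int[lam]_(t in D) (\sum_(i <- r) c i * \1_(A i) t) =
  \sum_(i <- r) c i * fine (lam (D `&` A i)).
Proof.
move=> mD Dfin mA.
have iA i : lam.-integrable D (EFin \o \1_(A i)).
  apply/integrableP; split.
    by apply/measurable_EFinP; exact: measurable_indic.
  rewrite (_ : (fun t => _) = (fun t => (\1_(A i) t)%:E)); last first.
    by apply/funext => t /=; rewrite ger0_norm// indicE.
  rewrite integral_indic//; apply: le_lt_trans Dfin.
  by apply: le_measure; rewrite ?inE//; exact: measurableI.
elim: r => [|i r [IH1 IH2]].
  split; first by under eq_fun do rewrite big_nil; exact: integrable0.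
  by under eq_Rintegral do rewrite big_nil; rewrite big_nil /Rintegral integral0.
have iZ : lam.-integrable D (EFin \o (fun t => c i * \1_(A i) t)).
  by have := integrableZl mD (c i) (iA i); congr (_.-integrable _ _); apply/funext => t.
have bE : (fun t => \sum_(k <- i :: r) c k * \1_(A k) t) =
    (fun t => c i * \1_(A i) t + \sum_(k <- r) c k * \1_(A k) t).
  by apply/funext => t; rewrite big_cons.
rewrite bE; split.
  by have := integrableD mD iZ IH1; congr (_.-integrable _ _); apply/funext => t.
rewrite RintegralD// IH2 big_cons; congr (_ + _).
rewrite (RintegralZl (c i) mD (iA i)); congr (_ * _).
by rewrite /Rintegral integral_indic// setIC.
Qed.

Variables (X : snspace R) (D : set Rm) (mD : measurable D) (Dfin : (lam D < +oo)%E).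
Hypothesis XL : forall a (x y : X), sn_mem x -> sn_mem y -> sn_mem (a *: x + y).
Hypothesis X0 : forall x : X, sn_mem x -> 0 <= sn_norm x.
Variables (l : X -> R) (dl : dual_element l).

Let lL a (x y : X) : sn_mem x -> sn_mem y -> l (a *: x + y) = a * l x + l y.
Proof. by case: dl => h _; exact: h. Qed.

Let mem0 (x : X) : sn_mem x -> sn_mem (0 : X) /\ l 0 = 0.
Proof.
move=> xP; have := lL (-1) xP xP; have := XL (-1) xP xP.
by rewrite scaleN1r addNr mulN1r addNr.
Qed.

Let memB (x y : X) : sn_mem x -> sn_mem y -> sn_mem (x - y) /\ l (x - y) = l x - l y.
Proof.
move=> xP yP; have -> : x - y = -1 *: y + x by rewrite scaleN1r addrC.
by split; [exact: XL|rewrite lL// mulN1r addrC].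
Qed.

Let dual_sum (r : seq X) (c : X -> R) (x0 : X) : sn_mem x0 -> (forall w : X, w \in r -> sn_mem w) ->
  sn_mem (\sum_(w <- r) c w *: w : X) /\ l (\sum_(w <- r) c w *: w) = \sum_(w <- r) c w * l w.
Proof.
move=> x0P; elim: r => [|w r IH] rP; first by rewrite !big_nil; exact: mem0 x0P.
have [|IH1 IH2] := IH; first by move=> z zr; apply: rP; rewrite inE zr orbT.
have wP : sn_mem w by apply: rP; rewrite inE eqxx.
by rewrite !big_cons; split; [exact: XL|rewrite lL// IH2].
Qed.

Lemma dual_simple_integral s : simple_function s ->
  lam.-integrable D (EFin \o (l \o s)) /\
  \int[lam]_(t in D) l (s t) = l (simple_integral D s) /\ sn_mem (simple_integral D s).
Proof.
move=> [fs sP ms]; pose r : seq X := finmap.enum_fset (fset_set (range s)).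
have rE w : (w \in r) = (w \in range s) by exact: in_fset_set.
have rP (w : X) : w \in r -> sn_mem w.
  by rewrite rE inE => -[t _ <-].
have lsE : l \o s = (fun t => \sum_(w <- r) l w * \1_(s @^-1` [set w]) t).
  apply/funext => t /=; rewrite (bigD1_seq (s t))/= ?finmap.fset_uniq//; last first.
    by rewrite rE inE; exists t.
  rewrite indicE mem_set// mulr1 big1 ?addr0// => w wt.
  by rewrite indicE memNset ?mulr0// => /= wE; rewrite wE eqxx in wt.
have [h1 h2] := @Rintegral_simple D _ r l (fun w => s @^-1` [set w]) mD Dfin ms.
have [h3 h4] := dual_sum (fun w => fine (lam (D `&` s @^-1` [set w]))) (sP 0) rP.
rewrite /simple_integral fsbig_finite//; split; first by rewrite lsE.
split; last exact: h3.
rewrite h4 -[LHS]/(\int[lam]_(t in D) (l \o s) t) lsE h2.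
by apply: eq_bigr => w _; rewrite mulrC.
Qed.

(** True for simple functions by finite additivity, then by approximation. *)
Lemma dual_bochner_integral f v : is_bochner_integral D f v ->
  (forall t, D t -> sn_mem (f t)) ->
  lam.-integrable D (EFin \o (l \o f)) -> \int[lam]_(t in D) l (f t) = l v.
Proof.
move=> [vP _ [s [ss scvg vcvg]]] fP lf; have [_ [M hM]] := dl.
have M1 : 0 < `|M| + 1 by rewrite ltr_wpDl.
have lM (x : X) : sn_mem x -> `|l x| <= (`|M| + 1) * sn_norm x.
  move=> xP; apply: (le_trans (hM x xP)); rewrite ler_wpM2r ?X0//.
  by rewrite (le_trans (ler_norm M))// lerDl.
have c1 : (fun n => l (simple_integral D (s n))) @ \oo --> l v.
  apply/cvgrPdist_lt => e e0.
  have e1 : 0 < e / (`|M| + 1) by rewrite divr_gt0.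
  have := vcvg; move/cvgrPdist_lt => /(_ _ e1); apply: filterS => n.
  rewrite sub0r normrN => h; have [_ [_ sP]] := dual_simple_integral (ss n).
  have [BP BE] := memB sP vP.
  rewrite distrC -BE (le_lt_trans (lM _ BP))// mulrC -ltr_pdivlMr//.
  exact: le_lt_trans (ler_norm _) h.
have c2 : (fun n => l (simple_integral D (s n))) @ \oo --> \int[lam]_(t in D) l (f t).
  apply/cvgrPdist_le => e e0.
  have e1 : 0 < e / (`|M| + 1) by rewrite divr_gt0.
  have := scvg; move/fine_cvgP => [sfin /cvgrPdist_lt /(_ _ e1)].
  move: sfin; apply: filterS2 => n sfin.
  rewrite /= sub0r normrN => h'; have [is_ [<- sP]] := dual_simple_integral (ss n).
  have -> : \int[lam]_(t in D) l (f t) - \int[lam]_(t in D) l (s n t) =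
      \int[lam]_(t in D) (l (f t) - l (s n t)) by rewrite RintegralB.
  have iB : lam.-integrable D (EFin \o (fun t => l (f t) - l (s n t))).
    exact: (integrableB mD lf is_).
  rewrite (le_trans (le_normr_Rintegral mD iB))//.
  pose h t := (`|M| + 1)^-1 * `|l (f t) - l (s n t)|.
  have ih : lam.-integrable D (EFin \o h).
    have := integrableZl mD (`|M| + 1)^-1 (integrable_abse iB).
    by congr (_.-integrable _ _); apply/funext => t.
  have -> : \int[lam]_(t in D) `|l (f t) - l (s n t)| = (`|M| + 1) * \int[lam]_(t in D) h t.
    rewrite -(RintegralZl _ mD ih); apply: eq_Rintegral => t _.
    by rewrite /h mulrA divff ?mul1r// gt_eqF.
  rewrite mulrC -ler_pdivlMr//; apply: le_trans (ltW h'); apply: le_trans (ler_norm _).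
  apply: fine_le; [exact: integrable_fin_num ih|exact: sfin|].
  apply: le_lower_integral => t Dt; rewrite lee_fin.
    by rewrite mulr_ge0// invr_ge0 ltW.
  have [BP BE] := memB (fP t Dt) (let: And3 _ p _ := ss n in p t).
  by rewrite /h -BE mulrC ler_pdivrMr// mulrC; exact: lM.
by rewrite -(cvg_lim _ c1)// -(cvg_lim _ c2).
Qed.

End bochner.

(** * Bounds, functionals and test functions for displacements *)

Lemma continuous_comp_clamp {R : realType} (T : R) (f : R -> R) : 0 <= T ->
  {within `[0, T]%classic, continuous f} -> continuous (fun t => f (clamp T t)).
Proof.
move=> T0 /subspace_continuousP fc t.
have cI s : `[0, T]%classic (clamp T s) by rewrite /= in_itv/=; exact: clamp_itv.
have h : clamp T @ t --> within `[0, T]%classic (nbhs (clamp T t)).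
  move=> A hA.
  have h1 : \forall s \near t, `[0, T]%classic (clamp T s) -> A (clamp T s).
    exact: (@continuous_clamp R T t _ hA).
  change (\forall s \near t, A (clamp T s)).
  by apply: filterS h1 => s hs; exact: (hs (cI s)).
exact: (cvg_comp _ _ h (fc _ (cI t))).
Qed.

Section semi_inner_constructions.
Context {R : realType} {V : lmodType R}.

Lemma si_restrict (P Q : set V) (B : V -> V -> R) : P `<=` Q ->
  (forall a x y, P x -> P y -> P (a *: x + y)) -> semi_inner Q B -> semi_inner P B.
Proof.
move=> PQ PL si; split=> // [a x y z xP yP zP|x y xP yP|x xP].
- exact: (si_linear si a (PQ _ xP) (PQ _ yP) (PQ _ zP)).
- exact: (si_sym si (PQ _ xP) (PQ _ yP)).
- exact: (si_ge0 si (PQ _ xP)).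
Qed.

Lemma si_add (P : set V) (B B' : V -> V -> R) : semi_inner P B -> semi_inner P B' ->
  semi_inner P (fun x y => B x y + B' x y).
Proof.
move=> si si'; split=> [a x y|a x y z xP yP zP|x y xP yP|x xP].
- exact: (si_mem si).
- by rewrite (si_linear si a xP yP zP) (si_linear si' a xP yP zP); ring.
- by rewrite (si_sym si xP yP) (si_sym si' xP yP).
- exact: addr_ge0 (si_ge0 si xP) (si_ge0 si' xP).
Qed.

Lemma si_normB_le (P : set V) (B : V -> V -> R) x y : semi_inner P B -> P x -> P y ->
  B (x - y) (x - y) <= 2 * B x x + 2 * B y y.
Proof.
move=> si xP yP; have hB := si_memB si xP yP; have hD := si_memD si xP yP.
have := si_ge0 si hD; rewrite (siDl si xP yP hD) (siBl si xP yP hB).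
rewrite (siBr si xP yP xP) (siBr si xP yP yP).
rewrite (si_sym si xP hD) (si_sym si yP hD) (siDl si xP yP xP) (siDl si xP yP yP).
rewrite (si_sym si yP xP); lra.
Qed.

End semi_inner_constructions.

Section norming.
Context {R : realType} (X : snspace R) (B : X -> X -> R).
Hypotheses (si : semi_inner (@sn_mem R X) B)
  (normE : forall x : X, sn_norm x = Num.sqrt (B x x)).

(** The normalized pairing with [x]. *)
Lemma si_norming (x : X) : sn_mem x -> exists2 l, contraction l & l x = sn_norm x.
Proof.
move=> xP; have [n0|n0] := eqVneq (sn_norm x) 0.
  exists (fun=> 0) => //; split=> [a y z _ _|y _]; first by rewrite mulr0 addr0.
  by rewrite normr0 normE sqrtr_ge0.
have npos : 0 < sn_norm x by rewrite lt_neqAle eq_sym n0 normE sqrtr_ge0.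
exists (fun y => B y x / sn_norm x); first split=> [a y z yP zP|y yP].
- by rewrite (si_linear si a yP zP xP) mulrDl mulrA.
- rewrite normrM normfV (gtr0_norm npos) ler_pdivrMr//.
  by rewrite !normE; exact: (si_CauchySchwarz_sqrt si yP xP).
- have -> : B x x = sn_norm x * sn_norm x.
    by rewrite normE -expr2 sqr_sqrtr//; exact: (si_ge0 si xP).
  by rewrite mulfK.
Qed.

Lemma si_normZ a (x : X) : sn_mem x -> sn_norm (a *: x) = `|a| * sn_norm x.
Proof.
move=> xP; have aP := si_memZ si a xP; have h1 := si_ge0 si xP.
rewrite !normE (siZl si a xP aP) (siZr si a xP xP) mulrA -expr2.
by rewrite sqrtrM ?sqr_ge0// sqrtr_sqr.
Qed.

Lemma dual_element_pairing (y : X) : sn_mem y -> dual_element (B^~ y).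
Proof.
move=> yP; split=> [a x z xP zP|]; first exact: (si_linear si a xP zP yP).
exists (sn_norm y) => x xP; rewrite mulrC !normE.
exact: (si_CauchySchwarz_sqrt si xP yP).
Qed.

End norming.

Section displacement_space.
Context {R : realType} {d : nat}.
Local Notation V := 'rV[R]_d.
Local Notation mu := (leb R d).
Variables (Omega K S : set V).
Hypotheses (bOmega : bounded_set Omega) (oOmega : open Omega) (cK : closed K)
  (K0 : leb R d K = 0%E).
Local Notation O := (Omega `\` K).
Local Notation U := (Uspace Omega K).
Local Notation UD := (UDspace Omega K S).
Local Notation H := (Hspace Omega 1 d).
Local Notation Hd := (Hspace Omega d d).
Local Notation e := (strain O).
Local Notation symfield := (@symmetric_field R d Omega).
Local Notation form := (field_form Omega).

Let mOmega := measurable_Omega oOmega.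

(** The inner product that induces the norm of the space of displacements. *)
Definition energy_form (u w : U) : R :=
  L2dot mu Omega (u : V -> V) w + L2dot mu Omega (e u) (e w).

Lemma U_mem_H u : sn_mem (s := U) u -> sn_mem (s := H) u.
Proof. by case. Qed.

Lemma symfield_strain u : sn_mem (s := U) u -> symfield (e u).
Proof. by move=> uU; split; [exact: strain_mem|exact: strain_sym]. Qed.

Lemma energy_si : semi_inner (@sn_mem R U) energy_form.
Proof.
have siH := @L2dot_si _ _ R mu Omega mOmega 1 d.
have siE : semi_inner (@sn_mem R U) (fun u w => L2dot mu Omega (e u) (e w)).
  apply: (strain_si bOmega oOmega cK K0).
    apply: (si_restrict _ _ (@L2dot_si _ _ R mu Omega mOmega d d)).
      by move=> E [].
    by move=> a x y; exact: symmetric_field_linear.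
  move=> E E' G h1 h2 h3 _ _ _ h4.
  by apply: (L2dot_ae mOmega h1 h2 h3 h3 h4); apply: aeW.
have siU : semi_inner (@sn_mem R U) (L2dot mu Omega).
  apply: (si_restrict _ _ siH); first exact: U_mem_H.
  by move=> a x y; exact: U_linear.
exact: (si_add siU siE).
Qed.

Lemma U_normE u : sn_norm (s := U) u = Num.sqrt (energy_form u u).
Proof. by rewrite /energy_form -!L2_norm_sqr. Qed.

Lemma strain_norm_le u : sn_norm (s := Hd) (e u) <= sn_norm (s := U) u.
Proof.
have h : sn_norm (s := Hd) (e u) = Num.sqrt (sn_norm (s := Hd) (e u) ^+ 2).
  by rewrite sqrtr_sqr ger0_norm// sqrtr_ge0.
by rewrite h; apply: ler_wsqrtr; rewrite lerDr sqr_ge0.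
Qed.

Lemma dual_element_strain_form A G : sn_mem (s := Bspace Omega) A -> symfield G ->
  dual_element (X := U) (fun u => form A (e u) G).
Proof.
move=> BA sG; split=> [a x y xU yU|].
  have [sx sy] := (symfield_strain xU, symfield_strain yU).
  rewrite -(field_form_linear oOmega a BA sx sy sG).
  apply: (field_form_ae oOmega BA) sG _.
  - exact/symfield_strain/U_linear.
  - exact: symmetric_field_linear.
  - exact: strain_linear_ae.
exists (sn_norm (s := Bspace Omega) A * sn_norm (s := Hd) G) => x xU.
apply: (le_trans (field_form_bound oOmega BA (symfield_strain xU) sG)).
rewrite -mulrA; apply: ler_wpM2l (Bspace_norm_ge0 _) _ _ _.
by rewrite mulrC; apply: ler_wpM2l (sqrtr_ge0 _) _ _ _; exact: strain_norm_le.
Qed.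

Lemma strainZ_ae a u : sn_mem (s := U) u ->
  {ae mu, forall x, Omega x -> e (a *: u) x = (a *: e u) x}.
Proof.
move=> uU; have u0 := si_mem0 energy_si uU.
have h0 := strain_linear_ae bOmega oOmega cK K0 (-1) uU uU.
rewrite !scaleN1r !addNr in h0.
have h1 := strain_linear_ae bOmega oOmega cK K0 a uU u0; rewrite addr0 in h1.
apply: (ae_imply2 h0 h1) => x g0 g1 Ox; rewrite (g1 Ox).
have g2 : e 0 x = 0 by exact: (g0 Ox).
change (a *: e u x + e 0 x = a *: e u x).
by rewrite g2 addr0.
Qed.

Lemma strain_formZr a E u : sn_mem (s := Hd) E -> sn_mem (s := U) u ->
  L2dot mu Omega E (e (a *: u)) = a * L2dot mu Omega E (e u).
Proof.
move=> hE uU; have si := @L2dot_si _ _ R mu Omega mOmega d d.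
have eu := strain_mem oOmega cK K0 uU.
have aU := si_memZ energy_si a uU.
rewrite -(siZr si a eu hE).
apply: (L2dot_ae mOmega hE hE (strain_mem oOmega cK K0 aU) (si_memZ si a eu)).
  exact: aeW.
exact: strainZ_ae.
Qed.

Lemma UD_memZ a (u : UD) : sn_mem u -> sn_mem (a *: u).
Proof.
move=> uP.
have h0 : sn_mem (0 : UD).
  by have := UD_linear bOmega oOmega cK K0 (-1) uP uP; rewrite scaleN1r addNr.
by have := UD_linear bOmega oOmega cK K0 a uP h0; rewrite addr0.
Qed.

Lemma UD_normZ a (u : UD) : sn_mem u -> sn_norm (a *: u) = `|a| * sn_norm u.
Proof. by move=> [uU _]; exact: (si_normZ energy_si U_normE a uU). Qed.

(** Products [eta(t) * psi(x)] are enough to determine the equation. *)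
Lemma separated_test T eta (psi : UD) : sn_mem psi -> test_function1 0 T eta ->
  C1c_with (X := UD) 0 T (fun t => eta t *: psi) (fun t => derive1 eta t *: psi).
Proof.
move=> pP heta; have [deta [c [b [c0 bT cb]]]] := heta.
have [_ ceta] := test_function1_derive1_continuous heta.
have N0 : 0 <= sn_norm psi by exact: sqrtr_ge0.
split.
- move=> t _; split; [exact: UD_memZ|exact: UD_memZ|].
  have dt : derivable eta t 1 := deta 0%N t.
  have hc : (fun h => h^-1 * (eta (t + h) - eta t)) @ 0^' --> derive1 eta t.
    have h1 : (fun h => h^-1 *: ((eta \o shift t) (h *: 1) - eta t)) @ 0^' --> 'D_1 eta t.
      exact: dt.
    rewrite derive1E (_ : (fun h => _) =
      (fun h => h^-1 *: ((eta \o shift t) (h *: 1) - eta t)))//.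
    by apply/funext => h; rewrite /= [h *: 1]mulr1 [h + t]addrC.
  apply/cvgrPdist_le => k k0.
  have k1 : 0 < k / (sn_norm psi + 1) by rewrite divr_gt0// ltr_wpDl.
  move/cvgrPdist_le : hc => /(_ _ k1); apply: filterS => h hh.
  have -> : h^-1 *: (eta (t + h) *: psi - eta t *: psi) - derive1 eta t *: psi =
      (h^-1 * (eta (t + h) - eta t) - derive1 eta t) *: psi.
    by rewrite -scalerBl scalerA -scalerBl.
  rewrite UD_normZ// sub0r normrN normrM normr_id (ger0_norm N0).
  move: hh; rewrite distrC ler_pdivlMr ?ltr_wpDl//; apply: le_trans.
  by rewrite ler_wpM2l// lerDl.
- move=> t _; split; first exact: UD_memZ.
  apply/cvgrPdist_le => k k0.
  have k1 : 0 < k / (sn_norm psi + 1) by rewrite divr_gt0// ltr_wpDl.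
  have [a a0 ha] := continuous_near t ceta k1.
  rewrite near_withinE; apply/nbhs_ballP; exists a => // s sb _.
  have hs := ha s; rewrite distrC in hs; move: (hs sb) => {}hs.
  rewrite -scalerBl UD_normZ// sub0r normrN normrM normr_id (ger0_norm N0).
  move: hs; rewrite ler_pdivlMr ?ltr_wpDl//; apply: le_trans.
  by rewrite ler_wpM2l// lerDl.
- exists c, b; split; [exact: c0|exact: bT|].
  by move=> t _ tcb; rewrite (cb t tcb) UD_normZ// normr0 mul0r.
Qed.

End displacement_space.

(** * The equation tested against a fixed displacement *)

Section solution_equation.
Context {R : realType} {d : nat}.
Local Notation V := 'rV[R]_d.
Local Notation mu := (leb R d).
Local Notation lam := (@lebesgue_measure R).
Local Notation Rm := (measurableTypeR R).
Variables (T L : R) (Omega K S : set V).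
Hypotheses (T0 : 0 < T) (TL : T < L)
  (bOmega : bounded_set Omega) (oOmega : open Omega) (cK : closed K)
  (K0 : leb R d K = 0%E).
Local Notation O := (Omega `\` K).
Local Notation U := (Uspace Omega K).
Local Notation UD := (UDspace Omega K S).
Local Notation H := (Hspace Omega 1 d).
Local Notation Hd := (Hspace Omega d d).
Local Notation B := (Bspace Omega).
Local Notation e := (strain O).
Local Notation symfield := (@symmetric_field R d Omega).
Local Notation form := (field_form Omega).
Local Notation "<< f , g >>" := (L2dot mu Omega f g).

Let mOmega := measurable_Omega oOmega.
Let siH := @L2dot_si _ _ R mu Omega mOmega 1 d.

(** The properties of strain histories used below; weak continuity is only
    tested against bounded operators applied to fixed fields. *)
Record strain_path (E : R -> V -> 'M[R]_d) : Prop := StrainPath {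
  path_sym : forall t, symfield (E t);
  path_bounded : exists M, forall t, sn_norm (s := Hd) (E t) <= M;
  path_continuous : forall A G, sn_mem (s := B) A -> symfield G ->
    continuous (fun t => form A (E t) G) }.

Lemma field_formBl A E E' G : sn_mem (s := B) A -> symfield E -> symfield E' ->
  symfield G -> form A (E - E') G = form A E G - form A E' G.
Proof.
move=> BA sE sE' sG; have := field_form_linear oOmega (-1) BA sE' sE sG.
by rewrite scaleN1r addrC mulN1r => ->; rewrite addrC.
Qed.

Lemma strain_path_cst E : symfield E -> strain_path (fun=> E).
Proof.
move=> sE; split=> //; first by exists (sn_norm (s := Hd) E).
by move=> A G _ _ t; exact: cvg_cst.
Qed.

Lemma strain_pathB E E' : strain_path E -> strain_path E' ->
  strain_path (fun t => E t - E' t).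
Proof.
move=> [sE [M EM] cE] [sE' [M' EM'] cE'].
have sB t : symfield (E t - E' t).
  have := symmetric_field_linear oOmega (-1) (sE' t) (sE t).
  by rewrite scaleN1r addrC.
split=> //.
  exists (Num.sqrt (2 * M ^+ 2 + 2 * M' ^+ 2)) => t.
  have si := @L2dot_si _ _ R mu Omega mOmega d d.
  have [[h _] [h' _]] := (sE t, sE' t).
  rewrite L2_normE; apply: ler_wsqrtr.
  apply: (le_trans (si_normB_le si h h')).
  have g1 : <<E t, E t>> <= M ^+ 2.
    by rewrite -L2_norm_sqr lerXn2r ?nnegrE ?sqrtr_ge0 ?(le_trans _ (EM t)) ?sqrtr_ge0.
  have g2 : <<E' t, E' t>> <= M' ^+ 2.
    by rewrite -L2_norm_sqr lerXn2r ?nnegrE ?sqrtr_ge0 ?(le_trans _ (EM' t)) ?sqrtr_ge0.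
  by apply: lerD; rewrite ler_pM2l.
move=> A G BA sG.
have -> : (fun t => form A (E t - E' t) G) = (fun t => form A (E t) G - form A (E' t) G).
  by apply/funext => t; exact: (field_formBl BA (sE t) (sE' t) sG).
by move=> t; exact: cvgB (cE A G BA sG t) (cE' A G BA sG t).
Qed.

Lemma strain_path_displacement u : weakly_continuous (X := U) `[0, T]%classic u ->
  strain_path (fun t => e (u (clamp T t))).
Proof.
move=> uw; have [uU uc] := uw.
have cU t : sn_mem (s := U) (u (clamp T t)).
  by apply: uU; rewrite /= in_itv/=; apply: clamp_itv; exact: ltW.
split.
- by move=> t; exact: (symfield_strain oOmega cK K0 (cU t)).
- have nrm := si_norming (energy_si bOmega oOmega cK K0) (@U_normE R d Omega K).
  have [M uM] := weakly_continuous_bounded (ltW T0) nrm uw.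
  exists M => t; apply: le_trans (strain_norm_le _ _ _) (uM _ _).
  by apply: clamp_itv; exact: ltW.
- move=> A G BA sG; apply: (continuous_comp_clamp (f := fun t => form A (e (u t)) G) (ltW T0)).
  exact: (uc _ (dual_element_strain_form bOmega oOmega cK K0 BA sG)).
Qed.

Lemma continuous_L2_path v psi : weakly_continuous (X := H) `[0, T]%classic v ->
  sn_mem (s := H) psi -> continuous (fun t => <<v (clamp T t), psi>>).
Proof.
move=> [_ vc] pH; apply: (continuous_comp_clamp (f := fun t => <<v t, psi>>) (ltW T0)).
exact: (vc _ (dual_element_pairing siH (@L2_normE _ _ _ _ _ _ _) pH)).
Qed.

Lemma dual_element_displacement psi : sn_mem (s := H) psi ->
  dual_element (X := U) (fun u => <<u : V -> V, psi>>).
Proof.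
move=> pH; split=> [a x y xU yU|].
  exact: (si_linear siH a (U_mem_H xU) (U_mem_H yU) pH).
exists (sn_norm (s := H) psi) => x xU.
apply: (le_trans (L2_CauchySchwarz mOmega (U_mem_H xU) pH)).
rewrite mulrC; apply: ler_wpM2l (sqrtr_ge0 _) _ _ _.
have h : sn_norm (s := H) x = Num.sqrt (sn_norm (s := H) x ^+ 2).
  by rewrite sqrtr_sqr ger0_norm// sqrtr_ge0.
by rewrite h; apply: ler_wsqrtr; rewrite lerDl sqr_ge0.
Qed.

Variables (u v : R -> V -> V).
Hypotheses (uw : weakly_continuous (X := U) `[0, T]%classic u)
  (vw : weakly_continuous (X := H) `[0, T]%classic v).

Let uH t : 0 <= t <= T -> sn_mem (s := H) (u t).
Proof. by move=> tT; have [uU _] := uw; apply: U_mem_H; apply: uU; rewrite /= in_itv. Qed.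

Let vH t : 0 <= t <= T -> sn_mem (s := H) (v t).
Proof. by move=> tT; have [vU _] := vw; apply: vU; rewrite /= in_itv. Qed.

Let cT t : 0 <= clamp T t <= T. Proof. by apply: clamp_itv; exact: ltW. Qed.

(** Tested against [psi], the weak derivative in time is a scalar distributional
    derivative, to which the du Bois-Reymond lemma applies. *)
Lemma displacement_primitive psi : weak_derivative (X := H) 0 T u v ->
  sn_mem (s := H) psi -> forall t, 0 <= t <= T ->
  <<u t, psi>> = <<u 0, psi>> + primitive (fun r => <<v (clamp T r), psi>>) t.
Proof.
move=> uv pH.
have dl := dual_element_pairing siH (@L2_normE _ _ _ _ _ _ _) pH.
have cv := continuous_L2_path vw pH.
have cu : continuous (fun t => <<u (clamp T t), psi>>).
  apply: (continuous_comp_clamp (f := fun t => <<u t, psi>>) (ltW T0)).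
  have [_ uc] := uw; exact: (uc _ (dual_element_displacement pH)).
have cvN : continuous (fun t => - <<v (clamp T t), psi>>).
  by move=> t; exact: cvgN (cv t).
have dbr := @du_bois_reymond R T (fun t => <<u (clamp T t), psi>>)
  (fun t => - <<v (clamp T t), psi>>) T0 cu cvN.
have {dbr} h t : 0 <= t <= T -> <<u (clamp T t), psi>> = <<u (clamp T 0), psi>> -
    primitive (fun t => - <<v (clamp T t), psi>>) t.
  move: t; apply: dbr => eta heta.
  have [ceta ceta'] := test_function1_derive1_continuous heta.
  have := uv eta heta.
  set f := (fun t => _ *: _ + _) => bf.
  pose a t := <<u (clamp T t), psi>> * derive1 eta t.
  pose b t := <<v (clamp T t), psi>> * eta t.
  have ca : continuous a by move=> t; exact: cvgM (cu t) (ceta' t).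
  have cb : continuous b by move=> t; exact: cvgM (cv t) (ceta t).
  pose ab t := 1 * a t + 1 * b t.
  have cab : continuous ab.
    by move=> t; exact: cvgD (cvgM (cvg_cst _) (ca t)) (cvgM (cvg_cst _) (cb t)).
  have fH t : 0 <= t <= T -> sn_mem (s := H) (f t).
    move=> tT; exact: (si_memD siH (si_memZ siH _ (uH tT)) (si_memZ siH _ (vH tT))).
  have fE t : 0 <= t <= T -> <<f t, psi>> = ab t.
    move=> tT; rewrite /ab /a /b clampE// /f.
    have uZ := si_memZ siH (derive1 eta t) (uH tT); have vZ := si_memZ siH (eta t) (vH tT).
    rewrite (siDl siH uZ vZ pH) (siZl siH _ (uH tT) pH) (siZl siH _ (vH tT) pH).
    by rewrite !mul1r mulrC [eta t * _]mulrC.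
  have mI : measurable (`]0, T[%classic : set Rm) by exact: measurable_itv.
  have inT t : `]0, T[%classic t -> 0 <= t <= T.
    by rewrite /= in_itv/= => /andP[/ltW -> /ltW ->].
  have Ifin : (lam (`]0%R, T[%classic : set Rm) < +oo)%E.
    by rewrite lebesgue_measure_itv/=; case: ifP => _; rewrite ltry.
  have iab (D : set Rm) : measurable D -> D `<=` `[0, T] -> lam.-integrable D (EFin \o ab).
    by move=> mD DT; exact: (integrable_itvS cab mD DT).
  have iI : lam.-integrable `]0, T[ (EFin \o ab).
    by apply: iab => // x /inT; rewrite /= in_itv.
  have lf : lam.-integrable `]0, T[ (EFin \o ((fun x => <<x : V -> V, psi>>) \o f)).
    apply: eq_integrable iI => //= t; rewrite inE => /inT tT.
    by rewrite fE.
  have := dual_bochner_integral mI Ifin (fun c x y => si_mem siH c (x := x) (y := y))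
    (fun x _ => sqrtr_ge0 _) dl bf (fun t tI => fH t (inT t tI)) lf.
  rewrite (si0l siH pH pH).
  have -> : \int[lam]_(t in `]0, T[) <<f t, psi>> = \int[lam]_(t in `]0, T[) ab t.
    by apply: eq_Rintegral => t; rewrite inE => /inT; exact: fE.
  rewrite Rintegral_itv_bndo_bndc// Rintegral_itv_obnd_cbnd//; last first.
    by apply: iab => // x; rewrite /= !in_itv/= => /andP[/ltW -> ->].
  rewrite -/(primitive ab T) (primitive_linear 1 1 T ca cb) !mul1r => /eqP.
  rewrite addr_eq0 => /eqP ->; rewrite -RintegralN /primitive.
  by apply: eq_Rintegral => t _; rewrite /b mulNr.
move=> t tT; have := h t tT; rewrite (clampE tT) clampE ?lexx ?(ltW T0)// => ->.
by rewrite /primitive RintegralN opprK.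
Qed.

Variables (F F1 F2 : R -> V -> 'M[R]_d -> 'M[R]_d) (C : V -> 'M[R]_d -> 'M[R]_d).
Hypotheses (F_C2 : C2_with (X := B) 0 L F F1 F2)
  (F_L1 : bochner_Lp (X := B) 1 `]0, L[%classic F) (BC : sn_mem (s := B) C).
Variable (E0 : V -> 'M[R]_d).
Hypothesis sE0 : symfield E0.

Let BF t : 0 < t < L -> sn_mem (s := B) (F t).
Proof. by move=> tL; have [h _ _] := F_C2; have [] := h t; rewrite ?/= ?in_itv. Qed.

Definition memory_strain t : V -> 'M[R]_d := e (u (clamp T t)) - E0.

Lemma strain_path_memory : strain_path memory_strain.
Proof.
by apply: strain_pathB; [exact: strain_path_displacement|exact: strain_path_cst].
Qed.

Definition memory_term psi t :=
  convolution (fun tau r => form (F tau) (memory_strain r) (e psi)) t.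

Lemma memory_term_integrable psi t : sn_mem (s := U) psi -> 0 <= t <= T ->
  lam.-integrable `[0, t[ (EFin \o (fun r => form (F (t - r)) (memory_strain r) (e psi))).
Proof.
move=> pU tT; have [sY [M YM] Yc] := strain_path_memory.
have sp := symfield_strain oOmega cK K0 pU.
exact: (path_convolution_integrable oOmega F_C2 F_L1 TL sY YM Yc sp tT).
Qed.

Lemma continuous_memory_term psi : sn_mem (s := U) psi ->
  continuous (fun t => memory_term psi (clamp T t)).
Proof.
move=> pU; have [sY [M YM] Yc] := strain_path_memory.
have sp := symfield_strain oOmega cK K0 pU.
exact: (continuous_path_convolution oOmega F_C2 F_L1 T0 TL sY YM Yc sp).
Qed.

Let memory_scale c psi t : sn_mem (s := U) psi -> 0 <= t <= T ->
  \int[lam]_(r in `[0, t]) <<apply_field (F (t - r)) (e (u r) - E0), e (c *: psi)>> =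
  c * memory_term psi t.
Proof.
move=> pU /[dup] tT /andP[t0 tle].
have iJ := memory_term_integrable pU tT.
have eJ r : `[0, t[%classic r ->
    <<apply_field (F (t - r)) (e (u r) - E0), e (c *: psi)>> =
    c * form (F (t - r)) (memory_strain r) (e psi).
  rewrite /= in_itv/= => /andP[r0 rt].
  have rT : 0 <= r <= T by rewrite r0 (le_trans (ltW rt)).
  have tr : 0 < t - r < L.
    by rewrite subr_gt0 rt (le_lt_trans _ TL)// (le_trans _ tle)// gerBl.
  have [sY _ _] := strain_path_memory; have := sY r; rewrite /memory_strain clampE// => sYr.
  exact: (strain_formZr bOmega oOmega cK K0 c (apply_field_mem oOmega (BF tr) sYr) pU).
have mJ : measurable (`[0, t[%classic : set Rm) by exact: measurable_itv.
set h := (fun r => <<_, _>>); have hE r : `[0, t[%classic r ->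
    h r = c * form (F (t - r)) (memory_strain r) (e psi) by exact: eJ.
have iZ : lam.-integrable `[0, t[ (EFin \o h).
  have := integrableZl mJ c iJ; apply: (eq_integrable mJ) => r.
  by rewrite inE => /hE /= ->; rewrite EFinM.
clearbody h; transitivity (\int[lam]_(r in `[0, t[) h r).
  by rewrite (Rintegral_itv_bndo_bndc iZ).
rewrite /memory_term /convolution -(Rintegral_itv_bndo_bndc iJ).
by rewrite -(RintegralZl c mJ iJ); apply: eq_Rintegral => r; rewrite inE; exact: hE.
Qed.

Lemma continuous_momentum psi : sn_mem (s := U) psi ->
  continuous (fun t => <<v (clamp T t), psi>> + memory_term psi (clamp T t)).
Proof.
move=> pU; have cv := continuous_L2_path vw (U_mem_H pU).
by have cm := continuous_memory_term pU; move=> t; exact: cvgD (cv t) (cm t).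
Qed.

(** The terms that contain the derivative of [eta] are gathered, in view of the
    du Bois-Reymond lemma. *)
Lemma tested_equation psi eta : sn_mem (s := U) psi -> test_function1 0 T eta ->
  - (\int[lam]_(t in `[0, T]) <<v t, derive1 eta t *: psi>>) +
    (\int[lam]_(t in `[0, T]) <<apply_field C (e (u t)), e (eta t *: psi)>>) -
    (\int[lam]_(t in `[0, T]) (\int[lam]_(r in `[0, t])
      <<apply_field (F (t - r)) (e (u r) - E0), e (derive1 eta t *: psi)>>)) =
  primitive (fun t => form C (e (u (clamp T t))) (e psi) * eta t) T -
  primitive (fun t => (<<v (clamp T t), psi>> + memory_term psi (clamp T t)) *
    derive1 eta t) T.
Proof.
move=> pU heta; have pH := U_mem_H pU.
have [ceta ceta'] := test_function1_derive1_continuous heta.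
have cv := continuous_L2_path vw pH; have cm := continuous_memory_term pU.
have [su _ _] := strain_path_displacement uw.
have inT t : t \in `[0, T]%classic -> 0 <= t <= T by rewrite inE /= in_itv.
pose a t := <<v (clamp T t), psi>> * derive1 eta t.
pose b t := memory_term psi (clamp T t) * derive1 eta t.
have ca : continuous a by move=> t; exact: cvgM (cv t) (ceta' t).
have cb : continuous b by move=> t; exact: cvgM (cm t) (ceta' t).
have -> : \int[lam]_(t in `[0, T]) <<v t, derive1 eta t *: psi>> = primitive a T.
  apply: eq_Rintegral => t /inT tT; rewrite /a clampE//.
  by rewrite (siZr siH _ pH (vH tT)) mulrC.
have -> : \int[lam]_(t in `[0, T]) (\int[lam]_(r in `[0, t])
      <<apply_field (F (t - r)) (e (u r) - E0), e (derive1 eta t *: psi)>>) = primitive b T.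
  apply: eq_Rintegral => t /inT tT; rewrite /b clampE// mulrC.
  exact: memory_scale.
have -> : \int[lam]_(t in `[0, T]) <<apply_field C (e (u t)), e (eta t *: psi)>> =
    primitive (fun t => form C (e (u (clamp T t))) (e psi) * eta t) T.
  apply: eq_Rintegral => t /inT tT; rewrite clampE// mulrC.
  have := su t; rewrite clampE// => sut.
  exact: (strain_formZr bOmega oOmega cK K0 _ (apply_field_mem oOmega BC sut) pU).
have -> : primitive (fun t => (<<v (clamp T t), psi>> + memory_term psi (clamp T t)) *
    derive1 eta t) T = primitive a T + primitive b T.
  have := primitive_linear 1 1 T ca cb; rewrite !mul1r => <-.
  by apply: eq_Rintegral => t _; rewrite !mul1r mulrDl.
by move: (primitive a T) (primitive b T) (primitive _ T) => x y z; ring.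
Qed.

End solution_equation.

(** * Uniqueness *)

Lemma du_bois_reymond_difference {R : realType} (T : R) (P P' q q' : R -> R) (t : R) :
  0 < T -> continuous P -> continuous P' -> continuous q -> continuous q' ->
  (forall eta, test_function1 0 T eta ->
     primitive (fun t => q t * eta t) T - primitive (fun t => P t * derive1 eta t) T =
     primitive (fun t => q' t * eta t) T - primitive (fun t => P' t * derive1 eta t) T) ->
  0 <= t <= T -> P t - P' t = P 0 - P' 0 - primitive (fun t => q t - q' t) t.
Proof.
move=> T0 cP cP' cq cq' key.
have diff (f f' g : R -> R) : continuous f -> continuous f' -> continuous g ->
    primitive (fun t => (f t - f' t) * g t) T =
    primitive (fun t => f t * g t) T - primitive (fun t => f' t * g t) T.
  move=> cf cf' cg.
  have c1 : continuous (fun t => f t * g t) by move=> x; exact: cvgM (cf x) (cg x).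
  have c2 : continuous (fun t => f' t * g t) by move=> x; exact: cvgM (cf' x) (cg x).
  have := primitive_linear 1 (-1) T c1 c2; rewrite mul1r mulN1r => <-.
  by apply: eq_Rintegral => x _; ring.
have cPP : continuous (fun t => P t - P' t) by move=> x; exact: cvgB (cP x) (cP' x).
have cqq : continuous (fun t => q t - q' t) by move=> x; exact: cvgB (cq x) (cq' x).
move: t; apply: (du_bois_reymond T0 cPP cqq) => eta heta.
have [ceta ceta'] := test_function1_derive1_continuous heta.
rewrite (diff P P' _ cP cP' ceta') (diff q q' _ cq cq' ceta).
by have /eqP := key eta heta; rewrite subr_eq => /eqP ->; ring.
Qed.

Section uniqueness.
Context {R : realType} {d : nat}.
Local Notation V := 'rV[R]_d.
Local Notation mu := (leb R d).
Local Notation lam := (@lebesgue_measure R).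
Local Notation Rm := (measurableTypeR R).
Variables (T L : R) (Omega K S : set V).
Hypotheses (T0 : 0 < T) (TL : T < L)
  (bOmega : bounded_set Omega) (oOmega : open Omega) (cK : closed K)
  (K0 : leb R d K = 0%E).
Local Notation O := (Omega `\` K).
Local Notation U := (Uspace Omega K).
Local Notation UD := (UDspace Omega K S).
Local Notation H := (Hspace Omega 1 d).
Local Notation Hd := (Hspace Omega d d).
Local Notation B := (Bspace Omega).
Local Notation e := (strain O).
Local Notation symfield := (@symmetric_field R d Omega).
Local Notation form := (field_form Omega).
Local Notation "<< f , g >>" := (L2dot mu Omega f g).

Let mOmega := measurable_Omega oOmega.
Let siH := @L2dot_si _ _ R mu Omega mOmega 1 d.
Let cT t : 0 <= clamp T t <= T. Proof. by apply: clamp_itv; exact: ltW. Qed.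

Variables (F F1 F2 : R -> V -> 'M[R]_d -> 'M[R]_d) (C : V -> 'M[R]_d -> 'M[R]_d).
Hypotheses (F_C2 : C2_with (X := B) 0 L F F1 F2)
  (F_L1 : bochner_Lp (X := B) 1 `]0, L[%classic F) (BC : sn_mem (s := B) C)
  (C_ge0 : {ae mu, forall x, Omega x ->
     forall xi, symmx xi -> 0 <= mdot (C x xi) xi})
  (F_ge0 : forall t : R, 0 < t < L -> {ae mu, forall x, Omega x ->
     forall xi, symmx xi -> 0 <= mdot (F t x xi) xi})
  (F1_le0 : forall t : R, 0 < t < L -> {ae mu, forall x, Omega x ->
     forall xi, symmx xi -> mdot (F1 t x xi) xi <= 0})
  (F2_ge0 : forall t : R, 0 < t < L -> {ae mu, forall x, Omega x ->
     forall xi, symmx xi -> 0 <= mdot (F2 t x xi) xi}).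
Variables (E0 : V -> 'M[R]_d) (sE0 : symfield E0) (u v w y : R -> V -> V).
Hypotheses (uw : weakly_continuous (X := U) `[0, T]%classic u)
  (vw : weakly_continuous (X := H) `[0, T]%classic v)
  (uv : weak_derivative (X := H) 0 T u v)
  (ww : weakly_continuous (X := U) `[0, T]%classic w)
  (yw : weakly_continuous (X := H) `[0, T]%classic y)
  (wy : weak_derivative (X := H) 0 T w y).

Definition tested_terms (u v : R -> V -> V) (eta : R -> R) (psi : V -> V) :=
  - (\int[lam]_(t in `[0, T]) <<v t, derive1 eta t *: psi>>) +
    (\int[lam]_(t in `[0, T]) <<apply_field C (e (u t)), e (eta t *: psi)>>) -
    (\int[lam]_(t in `[0, T]) (\int[lam]_(r in `[0, t])
      <<apply_field (F (t - r)) (e (u r) - E0), e (derive1 eta t *: psi)>>)).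

Hypotheses (diffD : forall t : R, 0 <= t <= T -> sn_mem (s := UD) (u t - w t))
  (u0w0 : sn_norm (s := H) (u 0 - w 0) = 0)
  (v0y0 : sn_norm (s := H) (v 0 - y 0) = 0)
  (same : forall psi eta, sn_mem (s := UD) psi -> test_function1 0 T eta ->
     tested_terms u v eta psi = tested_terms w y eta psi).

Let BF t : 0 < t < L -> sn_mem (s := B) (F t).
Proof. by move=> tL; have [h _ _] := F_C2; have [] := h t; rewrite ?/= ?in_itv. Qed.

Let uU t : 0 <= t <= T -> sn_mem (s := U) (u t).
Proof. by move=> tT; have [h _] := uw; apply: h; rewrite /= in_itv. Qed.
Let wU t : 0 <= t <= T -> sn_mem (s := U) (w t).
Proof. by move=> tT; have [h _] := ww; apply: h; rewrite /= in_itv. Qed.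
Let vH t : 0 <= t <= T -> sn_mem (s := H) (v t).
Proof. by move=> tT; have [h _] := vw; apply: h; rewrite /= in_itv. Qed.
Let yH t : 0 <= t <= T -> sn_mem (s := H) (y t).
Proof. by move=> tT; have [h _] := yw; apply: h; rewrite /= in_itv. Qed.

Let Ed t : V -> 'M[R]_d := e (u (clamp T t)) - e (w (clamp T t)).
Let dv t : V -> V := v (clamp T t) - y (clamp T t).

Let T00 : 0 <= (0 : R) <= T. Proof. by rewrite lexx ltW. Qed.

Let dvH t : sn_mem (s := H) (dv t).
Proof. exact: (si_memB siH (vH (cT t)) (yH (cT t))). Qed.

Let Ed_path : strain_path Omega Ed.
Proof.
by apply: (strain_pathB oOmega); apply: (strain_path_displacement T0 bOmega oOmega cK K0).
Qed.

Let null_pairing f psi : sn_mem (s := H) f -> sn_norm (s := H) f = 0 ->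
  sn_mem (s := H) psi -> <<f, psi>> = 0.
Proof.
move=> fH f0 pH; apply/eqP; rewrite -normr_le0.
by apply: (le_trans (L2_CauchySchwarz mOmega fH pH)); rewrite f0 mul0r.
Qed.

Let memory_difference psi t : sn_mem (s := U) psi -> 0 <= t <= T ->
  lam.-integrable `[0, t[ (EFin \o (fun r => form (F (t - r)) (Ed r) (e psi))) /\
  memory_term T Omega K u F E0 psi t - memory_term T Omega K w F E0 psi t =
  \int[lam]_(r in `[0, t[) form (F (t - r)) (Ed r) (e psi).
Proof.
move=> pU tT; have sp := symfield_strain oOmega cK K0 pU.
have iu := memory_term_integrable T0 TL bOmega oOmega cK K0 uw F_C2 F_L1 sE0 pU tT.
have iw := memory_term_integrable T0 TL bOmega oOmega cK K0 ww F_C2 F_L1 sE0 pU tT.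
have [su _ _] := strain_path_memory T0 bOmega oOmega cK K0 uw sE0.
have [sw _ _] := strain_path_memory T0 bOmega oOmega cK K0 ww sE0.
have mJ : measurable (`[0, t[%classic : set Rm) by exact: measurable_itv.
have EdE r : Ed r = memory_strain T Omega K u E0 r - memory_strain T Omega K w E0 r.
  by rewrite /Ed /memory_strain opprB addrA subrK.
have eJ r : `[0, t[%classic r -> form (F (t - r)) (Ed r) (e psi) =
    form (F (t - r)) (memory_strain T Omega K u E0 r) (e psi) -
    form (F (t - r)) (memory_strain T Omega K w E0 r) (e psi).
  rewrite /= in_itv/= => /andP[r0 rt]; rewrite EdE; case/andP: tT => t0 tle.
  have tr : 0 < t - r < L.
    by rewrite subr_gt0 rt (le_lt_trans _ TL)// (le_trans _ tle)// gerBl.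
  exact: (field_formBl oOmega (BF tr) (su r) (sw r) sp).
have iB := integrableB mJ iu iw.
split.
  by apply: (eq_integrable mJ) iB => r; rewrite inE => /eJ /= ->; rewrite EFinB.
have hu : memory_term T Omega K u F E0 psi t =
    \int[lam]_(r in `[0, t[) form (F (t - r)) (memory_strain T Omega K u E0 r) (e psi).
  exact: (esym (Rintegral_itv_bndo_bndc iu)).
have hw : memory_term T Omega K w F E0 psi t =
    \int[lam]_(r in `[0, t[) form (F (t - r)) (memory_strain T Omega K w E0 r) (e psi).
  exact: (esym (Rintegral_itv_bndo_bndc iw)).
rewrite hu hw -(RintegralB mJ iu iw); apply: eq_Rintegral => r; rewrite inE => /eJ ->.
by [].
Qed.

Let elastic_difference psi t : sn_mem (s := U) psi ->
  form C (e (u (clamp T t))) (e psi) - form C (e (w (clamp T t))) (e psi) =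
  form C (Ed t) (e psi).
Proof.
move=> pU; have sp := symfield_strain oOmega cK K0 pU.
have su := symfield_strain oOmega cK K0 (uU (cT t)).
have sw := symfield_strain oOmega cK K0 (wU (cT t)).
by rewrite (field_formBl oOmega BC su sw sp).
Qed.

(** The loads cancel in the difference of the two equations, and the du
    Bois-Reymond lemma makes the equation hold at every time; the constant is
    zero by equality of the initial data. *)
Let difference_equation psi t : sn_mem (s := UD) psi -> 0 <= t <= T ->
  <<dv t, psi>> = - \int[lam]_(r in `[0, t])
    (form (F (t - r)) (Ed r) (e psi) + form C (Ed r) (e psi)).
Proof.
move=> pD tT; have [pU _] := pD; have pH := U_mem_H pU.
have eu := tested_equation T0 TL bOmega oOmega cK K0 uw vw F_C2 F_L1 BC sE0 pU.
have ew := tested_equation T0 TL bOmega oOmega cK K0 ww yw F_C2 F_L1 BC sE0 pU.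
pose Pu t := <<v (clamp T t), psi>> + memory_term T Omega K u F E0 psi (clamp T t).
pose Pw t := <<y (clamp T t), psi>> + memory_term T Omega K w F E0 psi (clamp T t).
pose qu t := form C (e (u (clamp T t))) (e psi).
pose qw t := form C (e (w (clamp T t))) (e psi).
have cPu : continuous Pu.
  exact: (continuous_momentum T0 TL bOmega oOmega cK K0 uw vw F_C2 F_L1 sE0 pU).
have cPw : continuous Pw.
  exact: (continuous_momentum T0 TL bOmega oOmega cK K0 ww yw F_C2 F_L1 sE0 pU).
have sp := symfield_strain oOmega cK K0 pU.
have cqu : continuous qu.
  by have [_ _ h] := strain_path_displacement T0 bOmega oOmega cK K0 uw; exact: (h _ _ BC sp).
have cqw : continuous qw.
  by have [_ _ h] := strain_path_displacement T0 bOmega oOmega cK K0 ww; exact: (h _ _ BC sp).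
have key eta : test_function1 0 T eta ->
    primitive (fun t => qu t * eta t) T - primitive (fun t => Pu t * derive1 eta t) T =
    primitive (fun t => qw t * eta t) T - primitive (fun t => Pw t * derive1 eta t) T.
  by move=> heta; exact: (etrans (esym (eu eta heta)) (etrans (same pD heta) (ew eta heta))).
have main := du_bois_reymond_difference T0 cPu cPw cqu cqw key tT.
have mem0 (z : R -> V -> V) : memory_term T Omega K z F E0 psi 0 = 0.
  by rewrite /memory_term /convolution set_itv1 Rintegral_set1.
have P0 : Pu 0 - Pw 0 = 0.
  rewrite /Pu /Pw clampE// !mem0 !addr0 -(siBl siH (vH T00) (yH T00) pH).
  exact: (null_pairing (si_memB siH (vH T00) (yH T00)) v0y0 pH).
have {}main : <<v t, psi>> + memory_term T Omega K u F E0 psi t -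
    (<<y t, psi>> + memory_term T Omega K w F E0 psi t) =
    - primitive (fun t => qu t - qw t) t.
  have h : Pu t - Pw t = - primitive (fun t => qu t - qw t) t.
    exact: (etrans main (etrans (congr1 (fun z => z - _) P0) (sub0r _))).
  by have ct := clampE tT; rewrite /Pu /Pw ct in h.
have [iF hF] := memory_difference pU tT.
have cC : continuous (fun t => form C (Ed t) (e psi)).
  have [_ _ h] := Ed_path; exact: (h C (e psi) BC (symfield_strain oOmega cK K0 pU)).
have mJ : measurable (`[0, t[%classic : set Rm) by exact: measurable_itv.
have iC : lam.-integrable `[0, t[ (EFin \o (fun r => form C (Ed r) (e psi))).
  apply: (integrable_itvS (a := 0) (b := t) cC mJ).
  by move=> r; rewrite /= !in_itv/= => /andP[-> /ltW].
have hq : primitive (fun t => qu t - qw t) t = \int[lam]_(r in `[0, t[) form C (Ed r) (e psi).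
  rewrite (Rintegral_itv_bndo_bndc iC).
  by apply: eq_Rintegral => r _; exact: elastic_difference.
have iD : lam.-integrable `[0, t[ (EFin \o (fun r =>
    form (F (t - r)) (Ed r) (e psi) + form C (Ed r) (e psi))).
  by have := integrableD mJ iF iC; congr (_.-integrable _ _); apply/funext => r.
have hD := RintegralD mJ iF iC; rewrite -hF -hq (Rintegral_itv_bndo_bndc iD) in hD.
rewrite hD /dv clampE// (siBl siH (vH tT) (yH tT) pH).
move: main; move: (memory_term T Omega K u F E0 psi t) (memory_term T Omega K w F E0 psi t).
move: (primitive _ t) (<<v t, psi>>) (<<y t, psi>>) => a b c f h.
by rewrite opprD addrACA => /eqP; rewrite eq_sym -subr_eq => /eqP <-; ring.
Qed.

Let de t : V -> V := u t - w t.

Let deH t : 0 <= t <= T -> sn_mem (s := H) (de t).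
Proof. by move=> tT; exact: (si_memB siH (U_mem_H (uU tT)) (U_mem_H (wU tT))). Qed.

Let difference_primitive psi t : sn_mem (s := H) psi -> 0 <= t <= T ->
  <<de t, psi>> = primitive (fun r => <<dv r, psi>>) t.
Proof.
move=> pH tT.
have hu := displacement_primitive T0 oOmega uw vw uv pH tT.
have hw := displacement_primitive T0 oOmega ww yw wy pH tT.
have cv := continuous_L2_path T0 oOmega vw pH.
have cy := continuous_L2_path T0 oOmega yw pH.
have h0 : <<u 0, psi>> - <<w 0, psi>> = 0.
  rewrite -(siBl siH (U_mem_H (uU T00)) (U_mem_H (wU T00)) pH).
  exact: (null_pairing (deH T00) u0w0 pH).
have -> : primitive (fun r => <<dv r, psi>>) t =
    primitive (fun r => <<v (clamp T r), psi>>) t - primitive (fun r => <<y (clamp T r), psi>>) t.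
  have := primitive_linear 1 (-1) t cv cy; rewrite mul1r mulN1r => <-.
  apply: eq_Rintegral => r _; rewrite mul1r mulN1r.
  exact: (siBl siH (vH (cT r)) (yH (cT r)) pH).
rewrite /de (siBl siH (U_mem_H (uU tT)) (U_mem_H (wU tT)) pH) hu hw.
by rewrite opprD addrACA h0 add0r.
Qed.

Let k r t : R := <<dv r, dv t>>.

Let k_sym r t : k r t = k t r. Proof. exact: (si_sym siH (dvH r) (dvH t)). Qed.

Let k_continuous r : continuous (k r).
Proof.
have -> : k r = (fun t => <<v (clamp T t), dv r>> - <<y (clamp T t), dv r>>).
  apply/funext => t; rewrite k_sym; exact: (siBl siH (vH (cT t)) (yH (cT t)) (dvH r)).
have cv := continuous_L2_path T0 oOmega vw (dvH r).
have cy := continuous_L2_path T0 oOmega yw (dvH r).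
by move=> t; exact: cvgB (cv t) (cy t).
Qed.

Let k_bounded : exists M, forall r t, `|k r t| <= M.
Proof.
have nrm := si_norming siH (@L2_normE _ _ _ mu Omega 1 d).
have [Mv hv] := weakly_continuous_bounded (ltW T0) nrm vw.
have [My hy] := weakly_continuous_bounded (ltW T0) nrm yw.
have sq (f : V -> V) M : sn_norm (s := H) f <= M -> <<f, f>> <= M ^+ 2.
  move=> fM; have f0 : 0 <= sn_norm (s := H) f by exact: sqrtr_ge0.
  by rewrite -L2_norm_sqr lerXn2r ?nnegrE// (le_trans f0).
have kk t : k t t <= 2 * Mv ^+ 2 + 2 * My ^+ 2.
  apply: (le_trans (si_normB_le siH (vH (cT t)) (yH (cT t)))).
  by apply: lerD; rewrite ler_pM2l//; apply: sq; [exact: hv|exact: hy].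
exists (2 * Mv ^+ 2 + 2 * My ^+ 2) => r t.
apply: (le_trans (si_arith_geom siH (dvH r) (dvH t))).
rewrite ler_pdivrMr// mulr_natr mulr2n; exact: lerD (kk r) (kk t).
Qed.

(** The difference of the two displacements is itself an admissible test. *)
Let k_triangle t : 0 <= t <= T -> primitive (k t) t =
  - \int[lam]_(r in `[0, t]) (form (F (t - r)) (Ed r) (Ed t) + form C (Ed r) (Ed t)).
Proof.
move=> /[dup] tT /andP[t0 tle].
transitivity (<<dv t, de t>>).
  rewrite (si_sym siH (dvH t) (deH tT)) (difference_primitive (dvH t) tT).
  by apply: eq_Rintegral => r _; exact: k_sym.
transitivity (- \int[lam]_(r in `[0, t])
    (form (F (t - r)) (Ed r) (e (de t)) + form C (Ed r) (e (de t)))).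
  exact: (difference_equation (diffD tT) tT).
apply: (congr1 (fun z : R => - z)).
have [sE _ _] := Ed_path; have sEt := sE t.
have seD := symfield_strain oOmega cK K0 (proj1 (diffD tT)).
have aeE : {ae mu, forall x, Omega x -> e (de t) x = Ed t x}.
  have h := strain_linear_ae bOmega oOmega cK K0 (-1) (wU tT) (uU tT).
  rewrite scaleN1r addrC in h; apply: (ae_imply h) => x hx Ox.
  by rewrite (hx Ox) /Ed (clampE tT) scaleN1r addrC.
have swap A r : sn_mem (s := B) A -> form A (Ed r) (e (de t)) = form A (Ed r) (Ed t).
  move=> BA; rewrite (field_form_sym oOmega BA (sE r) seD).
  rewrite (field_form_ae oOmega BA seD sEt (sE r) aeE).
  exact: (field_form_sym oOmega BA sEt (sE r)).
have tr r : `[0, t[%classic r -> 0 < t - r < L.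
  rewrite /= in_itv/= => /andP[r0 rt].
  by rewrite subr_gt0 rt (le_lt_trans _ TL)// (le_trans _ tle)// gerBl.
have [iF _] := memory_difference (proj1 (diffD tT)) tT.
have mJ : measurable (`[0, t[%classic : set Rm) by exact: measurable_itv.
have iC : lam.-integrable `[0, t[ (EFin \o (fun r => form C (Ed r) (e (de t)))).
  have [_ _ h] := Ed_path; apply: (integrable_itvS (a := 0) (b := t) (h C _ BC seD) mJ).
  by move=> r; rewrite /= !in_itv/= => /andP[-> /ltW].
pose f1 r := form (F (t - r)) (Ed r) (e (de t)) + form C (Ed r) (e (de t)).
pose f2 r := form (F (t - r)) (Ed r) (Ed t) + form C (Ed r) (Ed t).
have i1 : lam.-integrable `[0, t[ (EFin \o f1).
  by have := integrableD mJ iF iC; congr (_.-integrable _ _); apply/funext => r.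
have f12 r : `[0, t[%classic r -> f1 r = f2 r.
  by move=> /tr h; rewrite /f1 /f2 (swap _ _ (BF h)) (swap _ _ BC).
have i2 : lam.-integrable `[0, t[ (EFin \o f2).
  by apply: (eq_integrable mJ) i1 => r; rewrite inE => /f12 /= ->.
transitivity (\int[lam]_(r in `[0, t[) f1 r); first exact: (esym (Rintegral_itv_bndo_bndc i1)).
transitivity (\int[lam]_(r in `[0, t[) f2 r); last exact: (Rintegral_itv_bndo_bndc i2).
by apply: eq_Rintegral => r; rewrite inE; exact: f12.
Qed.

(** The square of the norm of the difference is an iterated integral of [k],
    which the equation and the positivity of the kernel make nonpositive. *)
Lemma displacement_unique s : 0 <= s <= T -> {ae mu, forall x, Omega x -> u s x = w s x}.
Proof.
move=> /[dup] sT /andP[s0 sle].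
suff h : <<de s, de s>> <= 0.
  have n0 : sn_norm (s := H) (de s) = 0.
    have := L2_norm_sqr mu Omega (de s) => hn; apply/eqP.
    rewrite -sqrf_eq0 hn eq_le h/=; exact: (si_ge0 siH (deH sT)).
  apply: (ae_imply (L2_norm_eq0 mOmega (deH sT) n0)) => x hx Ox.
  by apply/eqP; rewrite -subr_eq0; apply/eqP; exact: (hx Ox).
have [sz|s1] := eqVneq s 0.
  by rewrite sz (null_pairing (deH T00) u0w0 (deH T00)).
have sp : 0 < s by rewrite lt_neqAle eq_sym s1.
have [M kM] := k_bounded.
have -> : <<de s, de s>> = primitive (fun t => primitive (k t) s) s.
  rewrite (difference_primitive (deH sT) sT); apply: eq_Rintegral => r _.
  rewrite (si_sym siH (dvH r) (deH sT)) (difference_primitive (dvH r) sT).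
  by apply: eq_Rintegral => q _; exact: k_sym.
rewrite (square_triangle k_sym k_continuous kM sp) pmulr_rle0//.
have [sE [N EN] cE] := Ed_path.
have := relaxation_form_ge0 oOmega F_C2 F_L1 T0 TL BC C_ge0 F_ge0 F1_le0 F2_ge0 sE EN cE sp sle.
rewrite -oppr_le0 -RintegralN; congr (_ <= 0); apply: eq_Rintegral => t.
rewrite inE/= in_itv/= => /andP[t0 ts].
by rewrite k_triangle// t0 (le_trans ts).
Qed.

End uniqueness.

Lemma L2_normB_eq0 {disp} {X : measurableType disp} {R : realType}
    (mu : {measure set X -> \bar R}) (D : set X) m n (f g h : X -> 'M[R]_(m, n)) :
  measurable D -> sn_mem (s := L2 mu D m n) f -> sn_mem (s := L2 mu D m n) g ->
  sn_mem (s := L2 mu D m n) h ->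
  sn_norm (s := L2 mu D m n) (f - h) = 0 -> sn_norm (s := L2 mu D m n) (g - h) = 0 ->
  sn_norm (s := L2 mu D m n) (f - g) = 0.
Proof.
move=> mD fP gP hP fh gh; have si := @L2dot_si _ _ R mu D mD m n.
have := si_normB_le si (si_memB si fP hP) (si_memB si gP hP).
rewrite -!L2_norm_sqr fh gh expr0n/= mulr0 addr0.
have -> : f - h - (g - h) = f - g by rewrite opprB addrA subrK.
by move=> n0; apply/eqP; rewrite -sqrf_eq0 eq_le n0 sqr_ge0.
Qed.

Theorem theorem5p3 (R : realType) (d : nat) (d_gt0 : (0 < d)%N) (T : R)
    (Omega S Gamma : set 'rV[R]_d) (Gammat : R -> set 'rV[R]_d)
    (geo : crack_geometry T Omega S Gamma Gammat)
    (z N f : R -> 'rV[R]_d -> 'rV[R]_d)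
    (u0 u1 : 'rV[R]_d -> 'rV[R]_d)
    (zW : sobolev21 (X := Uspace Omega (Gammat 0)) 0 T z)
    (NW : sobolev11 (X := HNspace Omega S) 0 T N)
    (fL2 : bochner_Lp (X := Hspace Omega 1 d) 2 `]0, T[%classic f)
    (u0U : sn_mem (s := Uspace Omega (Gammat 0)) u0)
    (u0z : sn_mem (s := UDspace Omega (Gammat 0) S) (u0 - z 0))
    (u1H : sn_mem (s := Hspace Omega 1 d) u1)
    (C : 'rV[R]_d -> 'M[R]_d -> 'M[R]_d)
    (CB : sn_mem (s := Bspace Omega) C)
    (gamma : R) (gamma_gt0 : 0 < gamma)
    (C_coercive : {ae leb R d, forall x, Omega x ->
       forall xi, symmx xi -> gamma * enorm xi ^+ 2 <= mdot (C x xi) xi})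
    (delta0 : R) (delta0_gt0 : 0 < delta0)
    (F F1 F2 : R -> 'rV[R]_d -> 'M[R]_d -> 'M[R]_d)
    (F_C2 : C2_with (X := Bspace Omega) 0 (T + delta0) F F1 F2)
    (F_L1 : bochner_Lp (X := Bspace Omega) 1 `]0, (T + delta0)[%classic F)
    (F_ge0 : forall t, t \in `]0, (T + delta0)[ ->
       {ae leb R d, forall x, Omega x ->
          forall xi, symmx xi -> 0 <= mdot (F t x xi) xi})
    (F1_le0 : forall t, t \in `]0, (T + delta0)[ ->
       {ae leb R d, forall x, Omega x ->
          forall xi, symmx xi -> mdot (F1 t x xi) xi <= 0})
    (F2_ge0 : forall t, t \in `]0, (T + delta0)[ ->
       {ae leb R d, forall x, Omega x ->
          forall xi, symmx xi -> 0 <= mdot (F2 t x xi) xi})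
    (no_growth : Gammat T = Gammat 0)
    (u w : R -> 'rV[R]_d -> 'rV[R]_d)
    (u_sol : generalized_solution T Omega S Gammat z N f u0 u1 C F u)
    (w_sol : generalized_solution T Omega S Gammat z N f u0 u1 C F w) :
  forall t, t \in `[0, T] ->
    {ae leb R d, forall x, Omega x -> u t x = w t x}.
Proof.
have [T0 bOmega oOmega _ _ _ _ _ G0 _ _ Gcl Gsub Gincr] := geo.
have TT : T \in `[0, T] by rewrite in_itv/= lexx ltW.
have cK := Gcl T TT.
have K0 : leb R d (Gammat T) = 0%E.
  apply/eqP; rewrite eq_le measure_ge0 andbT -G0.
  exact: (le_outer_measure (lebesgue_om R d) _ _ (Gsub T TT)).
have Gt t : t \in `[0, T] -> Gammat t = Gammat T.
  rewrite in_itv/= => /andP[t0 tT]; apply/seteqP; split; first exact: Gincr.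
  by rewrite {1}no_growth; apply: Gincr.
have TL : T < T + delta0 by rewrite ltrDl.
have inL t : 0 < t < T + delta0 -> t \in `]0, (T + delta0)[ by rewrite in_itv.
have C_ge0 : {ae leb R d, forall x, Omega x ->
    forall xi, symmx xi -> 0 <= mdot (C x xi) xi}.
  apply: (ae_imply C_coercive) => x h Ox xi sxi; apply: le_trans (h Ox xi sxi).
  by rewrite mulr_ge0 ?sqr_ge0// ltW.
have U0 : sn_mem (s := Uspace Omega (Gammat T)) u0 by rewrite no_growth.
have sE0 := symfield_strain oOmega cK K0 U0.
have [v [[uw vw uv _] uz [un vn] equ]] := u_sol.
have [y [[ww yw wy _] wz [wn yn] eqw]] := w_sol.
have T00 : (0 : R) \in `[0, T] by rewrite in_itv/= lexx ltW.
have I0 : `[0, T]%classic (0 : R) by exact: T00.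
have u0P := uw.1 _ I0; have w0P := ww.1 _ I0.
have v0P := vw.1 _ I0; have y0P := yw.1 _ I0.
have mOmega := measurable_Omega oOmega.
have U_norm0 (g : 'rV[R]_d -> 'rV[R]_d) : sn_norm (s := Uspace Omega (Gammat 0)) g = 0 ->
    sn_norm (s := Hspace Omega 1 d) g = 0.
  move=> g0; apply/eqP; rewrite -sqrf_eq0 eq_le sqr_ge0 andbT.
  have : sn_norm (s := Uspace Omega (Gammat 0)) g ^+ 2 <= 0 by rewrite g0 expr0n.
  by rewrite sqr_sqrtr ?addr_ge0 ?sqr_ge0//; apply: le_trans; rewrite lerDl sqr_ge0.
move=> s sI; have sT : 0 <= s <= T by rewrite in_itv in sI.
apply: (displacement_unique (S := S) T0 TL bOmega oOmega cK K0 F_C2 F_L1 CB C_ge0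
  _ _ _ sE0 uw vw uv ww yw wy _ _ _ _ sT).
- by move=> t /inL; exact: F_ge0.
- by move=> t /inL; exact: F1_le0.
- by move=> t /inL; exact: F2_ge0.
- move=> t tT; have tI : t \in `[0, T] by rewrite in_itv.
  have h1 := uz t tI; have h2 := wz t tI; rewrite (Gt t tI) in h1 h2.
  have := UD_linear bOmega oOmega cK K0 (-1) h2 h1.
  by rewrite scaleN1r addrC opprB addrA subrK.
- exact: (L2_normB_eq0 mOmega (U_mem_H u0P) (U_mem_H w0P) (U_mem_H U0)
    (U_norm0 _ un) (U_norm0 _ wn)).
- exact: (L2_normB_eq0 mOmega v0P y0P u1H vn yn).
- move=> psi eta pD heta.
  have test : admissible_test T Omega S Gammat (fun t => eta t *: (psi : _ -> _))
      (fun t => derive1 eta t *: (psi : _ -> _)).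
    split; first exact: (separated_test bOmega oOmega cK K0 pD heta).
    by move=> t tI; rewrite (Gt t tI); exact: (UD_memZ bOmega oOmega cK K0 _ pD).
  have := etrans (equ _ _ test) (esym (eqw _ _ test)).
  by rewrite -no_growth.
Qed.
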